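(* Let $\mu_c$ (for real $c<-2$ sufficiently close to $-2$) be the probability measure on $\mathbb{C}$ which assigns equal mass to each zero of $D_c$ of modulus less than $1000$, zeros counted with multiplicity. Then, as $c\to-2$ with $c<-2$, the measures $\mu_c$ converge weakly to the uniform probability distribution (normalized arc length) on the circle $\{\lambda\in\mathbb{C}:|\lambda|=4\}$.
   Context: For real $c<-2$ let $f_c(z)=z^2+c$, and let $r_n(c)=f_c^{\circ n}(0)$ denote the $n$-th iterate of $f_c$ at $0$; thus $r_1(c)=c$ and $r_{n+1}(c)=r_n(c)^2+c$. Define the entire function $D_c(\lambda)=1+\sum_{n=1}^{\infty}\frac{\lambda^n}{2^n r_1(c)r_2(c)\cdots r_n(c)}$. For $c<-2$ close to $-2$ the function $D_c$ has at least one zero of modulus less than $1000$, so $\mu_c$ is well defined. *)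

(* Defs.v *)
From Stdlib Require Import Reals Lra List Arith.
Open Scope R_scope.

Definition Co : Type := (R * R)%type.
Definition Cadd (z w : Co) : Co := (fst z + fst w, snd z + snd w).
Definition Csub (z w : Co) : Co := (fst z - fst w, snd z - snd w).
Definition Cmul (z w : Co) : Co :=
  (fst z * fst w - snd z * snd w, fst z * snd w + snd z * fst w).
Definition Cscal (a : R) (z : Co) : Co := (a * fst z, a * snd z).
Fixpoint Cpow (z : Co) (n : nat) : Co :=
  match n with O => (1, 0) | S m => Cmul z (Cpow z m) end.
Definition Cmod (z : Co) : R := sqrt (fst z ^ 2 + snd z ^ 2).

Definition Co_eq_dec (z w : Co) : {z = w} + {z <> w}.
Proof.
  destruct z as [a b], w as [c d].
  destruct (Req_EM_T a c) as [H1|H1]; destruct (Req_EM_T b d) as [H2|H2];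
  [left; subst; reflexivity | right | right | right];
  intro H; inversion H; contradiction.
Defined.

Definition Csum_to (u : nat -> Co) (w : Co) : Prop :=
  infinite_sum (fun n => fst (u n)) (fst w) /\
  infinite_sum (fun n => snd (u n)) (snd w).

Fixpoint r (c : R) (n : nat) : R :=
  match n with O => 0 | S m => (r c m) ^ 2 + c end.

Fixpoint rprod (c : R) (n : nat) : R :=
  match n with O => 1 | S m => rprod c m * r c (S m) end.

Definition Dcoef (c : R) (n : nat) : R := / (2 ^ n * rprod c n).

(* D_c^{(k)}(z) = sum_n ((n+k)!/n!) a_{n+k} z^n  (termwise k-th derivative
   of the power series D_c(lambda) = sum_n a_n lambda^n). *)
Definition Dderiv_is (c : R) (k : nat) (z w : Co) : Prop :=
  Csum_to (fun n => Cscal (INR (Factorial.fact (n + k)) / INR (Factorial.fact n) * Dcoef c (n + k))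
                          (Cpow z n)) w.

(* z is a zero of D_c of multiplicity exactly m (m = 0: not a zero). *)
Definition zero_mult (c : R) (z : Co) (m : nat) : Prop :=
  (forall k, (k < m)%nat -> Dderiv_is c k z (0, 0)) /\
  (exists w, Dderiv_is c m z w /\ w <> (0, 0)).

Definition zeros_list (c : R) (l : list Co) : Prop :=
  (forall z, In z l -> Cmod z < 1000) /\
  (forall z m, Cmod z < 1000 -> zero_mult c z m -> count_occ Co_eq_dec l z = m).

(* integral of f against mu_c (given the zero list l). *)
Definition avg_over (f : Co -> R) (l : list Co) : R :=
  fold_right Rplus 0 (map f l) / INR (length l).

Definition bounded_fun (f : Co -> R) : Prop :=
  exists M, forall z, Rabs (f z) <= M.

Definition continuous_fun (f : Co -> R) : Prop :=
  forall z eps, 0 < eps -> exists d, 0 < d /\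
    forall w, Cmod (Csub w z) < d -> Rabs (f w - f z) < eps.

Definition circ4 (f : Co -> R) (t : R) : R := f (4 * cos t, 4 * sin t).

(* Main.v *)
(* Everything rests on factorizations [D_c = prod_j (1 - z/z_j) * Q] over the zeros in a disc
   [|z| < rho], compared with [H = prod_j (1 - conj z_j z/rho^2) * Q], whose modulus on
   [|z| = rho] is [prod_j (|z_j|/rho) |D_c|].  The mean square over a circle turns this into Jensen's
   inequality [sum_j ln (rho/|z_j|) <= ln (sum_n |a_n| rho^n)]; conversely, when the list of zeros is
   complete, the minimum principle for the nonvanishing [H] bounds the same sum from below by
   [ln min |D_c|].

   Let [M] be the first index with [r_M >= 100].  At [rho = 16 r_M] and at [2 rho] the [M]-th term
   dominates the series, and [4^M |a_M|] is bounded below, so there are [M/2 - O(1)] zeros or more in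
   the disc and at most [M + O(1)]; since [sum_n |a_n| 4^n <= M + 2], Jensen's inequality at radius 4
   gives [sum_j |ln (|z_j|/4)| = O(ln M)].  Newton's identities bound the power sums attached to [D_c]
   and to [H] independently of [c]; subtracting them eliminates [Q] and leaves
   [sum_j (z_j^-m - (conj z_j/rho^2)^m) = O(1)], which controls the trigonometric moments of the
   arguments of the [z_j].  Interpolation by the Fejer kernel at roots of unity then gives
   equidistribution. *)

(* No integral of [ln |D_c|], argument principle or Cauchy formula occurs: a function is its
   coefficient sequence, and its mean square over [|z| = rho] is the sum of the [(|a_n| rho^n)^2].

   The limit [c -> -2] acts only through [M]. The orbit of 0 under [f_{-2}] stays in [[-2, 2]], so
   [M] tends to infinity, while [r_M < 100^2] keeps [rho] below 160000. Hence every constant is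
   independent of [c], and the errors are weighed against a number of zeros of order [M].

   The radius 4 comes from the ratio of successive terms, [|z| / (2 |r_{n+1}|)], with [|r_{n+1}|]
   close to 2 for most [n < M]. The excess [|r_n| - 2] at least triples at each step, so the losses
   [ln (|r_n|/2)] add up geometrically; this is why [4^M |a_M|] stays away from 0.

   The obstacle for the arguments is [Q]: it carries the zeros beyond [rho], about which nothing is
   known, and Newton's identities for [D_c] alone see all zeros together. The reflected product [H]
   contains the same [Q], and its coefficients are bounded by its mean square. *)
Require Import Defs.
From Stdlib Require Import Reals Lra Lia Arith List Permutation FunctionalExtensionality ClassicalEpsilon.
From Coquelicot Require Import Coquelicot.
Open Scope R_scope.

(** * Power series with infinite radius of convergence *)

Definition Cser (u : nat -> C) : C :=
  (Series (fun n => fst (u n)), Series (fun n => snd (u n))).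

Definition abs_summable (u : nat -> C) : Prop := ex_series (fun n => Cmod (u n)).

Lemma Rabs_fst_le_Cmod (z : C) : Rabs (fst z) <= Cmod z.
Proof. eapply Rle_trans; [apply Rmax_l | apply Rmax_Cmod]. Qed.

Lemma Rabs_snd_le_Cmod (z : C) : Rabs (snd z) <= Cmod z.
Proof. eapply Rle_trans; [apply Rmax_r | apply Rmax_Cmod]. Qed.

Lemma Cmod_le_sum (z : C) : Cmod z <= Rabs (fst z) + Rabs (snd z).
Proof.
  unfold Cmod. apply Rsqr_incr_0_var.
  - rewrite Rsqr_sqrt by nra.
    assert (H1 := Rabs_pos (fst z)). assert (H2 := Rabs_pos (snd z)).
    rewrite <- (pow2_abs (fst z)), <- (pow2_abs (snd z)). unfold Rsqr. nra.
  - assert (H1 := Rabs_pos (fst z)). assert (H2 := Rabs_pos (snd z)). lra.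
Qed.

Lemma ex_series_fst (u : nat -> C) : abs_summable u -> ex_series (fun n => fst (u n)).
Proof.
  intros H. apply @ex_series_le with (fun n => Cmod (u n)); auto.
  intros n. apply Rabs_fst_le_Cmod.
Qed.

Lemma ex_series_snd (u : nat -> C) : abs_summable u -> ex_series (fun n => snd (u n)).
Proof.
  intros H. apply @ex_series_le with (fun n => Cmod (u n)); auto.
  intros n. apply Rabs_snd_le_Cmod.
Qed.

Lemma Cser_ext (u v : nat -> C) : (forall n, u n = v n) -> Cser u = Cser v.
Proof. intros H. unfold Cser. f_equal; apply Series_ext; intro; now rewrite H. Qed.

Lemma Cser_plus (u v : nat -> C) : abs_summable u -> abs_summable v ->
  Cser (fun n => u n + v n)%C = (Cser u + Cser v)%C.
Proof.
  intros Hu Hv. unfold Cser, Cplus. simpl. f_equal; apply Series_plus;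
    auto using ex_series_fst, ex_series_snd.
Qed.

Lemma Cser_mult_l (c : C) (u : nat -> C) : abs_summable u ->
  Cser (fun n => c * u n)%C = (c * Cser u)%C.
Proof.
  intros Hu. assert (H1 := ex_series_fst u Hu). assert (H2 := ex_series_snd u Hu).
  unfold Cser, Cmult. simpl. f_equal.
  - rewrite Series_minus; [| now apply @ex_series_scal | now apply @ex_series_scal].
    now rewrite !Series_scal_l.
  - rewrite Series_plus; [| now apply @ex_series_scal | now apply @ex_series_scal].
    now rewrite !Series_scal_l.
Qed.

Lemma Cser_incr_1 (u : nat -> C) : abs_summable u ->
  Cser u = (u O + Cser (fun n => u (S n)))%C.
Proof.
  intros Hu. unfold Cser, Cplus. simpl.
  rewrite Series_incr_1 by auto using ex_series_fst.
  rewrite (Series_incr_1 (fun n => snd (u n))) by auto using ex_series_snd. reflexivity.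
Qed.

Lemma abs_summable_le (u : nat -> C) (b : nat -> R) :
  (forall n, Cmod (u n) <= b n) -> ex_series b -> abs_summable u.
Proof.
  intros H Hb. apply @ex_series_le with b; auto.
  intros n. change (Rabs (Cmod (u n)) <= b n). rewrite Rabs_pos_eq; auto using Cmod_ge_0.
Qed.

Lemma abs_summable_incr_1 (u : nat -> C) :
  abs_summable u -> abs_summable (fun n => u (S n)).
Proof. intros H. apply (ex_series_incr_1 (fun n => Cmod (u n))). exact H. Qed.

(** The modulus is a supremum of real linear functionals, attained in the direction of [z]. This
    lets bounds on real series pass to [Cser], which is defined componentwise. *)
Lemma Cmod_le_of_projections (z : C) (M : R) :
  (forall a b, a ^ 2 + b ^ 2 <= 1 -> a * fst z + b * snd z <= M) -> Cmod z <= M.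
Proof.
  intros H. destruct (Req_dec (Cmod z) 0) as [E|E].
  - rewrite E. specialize (H 0 0). lra.
  - assert (P := Cmod_ge_0 z).
    assert (Q : Cmod z ^ 2 = fst z ^ 2 + snd z ^ 2) by apply Cmod2_alt.
    specialize (H (fst z / Cmod z) (snd z / Cmod z)).
    replace (fst z / Cmod z * fst z + snd z / Cmod z * snd z) with (Cmod z) in H.
    2:{ apply Rmult_eq_reg_r with (Cmod z); auto. field_simplify; auto. }
    apply H. apply Req_le. apply Rmult_eq_reg_r with (Cmod z ^ 2); [|nra].
    field_simplify; auto.
Qed.

Lemma Cmod_Cser_le (u : nat -> C) (b : nat -> R) :
  (forall n, Cmod (u n) <= b n) -> ex_series b -> Cmod (Cser u) <= Series b.
Proof.
  intros H Hb. assert (Hu := abs_summable_le u b H Hb).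
  apply Cmod_le_of_projections. intros x y Hxy. unfold Cser. simpl.
  rewrite <- !Series_scal_l, <- Series_plus;
    try (apply @ex_series_scal; auto using ex_series_fst, ex_series_snd).
  assert (Hk : forall n, Rabs (x * fst (u n) + y * snd (u n)) <= b n).
  { intros n. eapply Rle_trans; [|apply H].
    rewrite <- (Rabs_pos_eq (Cmod (u n))) by apply Cmod_ge_0.
    apply Rsqr_le_abs_0. rewrite !Rsqr_pow2, Cmod2_alt. unfold Re, Im.
    (* Lagrange's identity: this square and the one to be bounded add up to
       [(x^2 + y^2) |u_n|^2]. *)
    assert (0 <= (x * snd (u n) - y * fst (u n)) ^ 2) by apply pow2_ge_0.
    assert (0 <= fst (u n) ^ 2 + snd (u n) ^ 2) by nra.
    nra. }
  eapply Rle_trans; [apply Rle_abs|].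
  assert (E : ex_series (fun n => Rabs (x * fst (u n) + y * snd (u n)))).
  { apply @ex_series_le with b; auto. intros n.
    change (Rabs (Rabs (x * fst (u n) + y * snd (u n))) <= b n). now rewrite Rabs_Rabsolu. }
  eapply Rle_trans; [now apply Series_Rabs|].
  apply Series_le; auto. intros n; split; auto using Rabs_pos.
Qed.

Lemma ex_series_geom_scal (K q : R) : 0 <= q < 1 -> ex_series (fun n => K * q ^ n).
Proof.
  intros H. apply @ex_series_scal. apply ex_series_geom. rewrite Rabs_pos_eq; lra.
Qed.

Lemma Series_geom_scal (K q : R) : 0 <= q < 1 -> Series (fun n => K * q ^ n) = K / (1 - q).
Proof.
  intros H. rewrite Series_scal_l, Series_geom by (rewrite Rabs_pos_eq; lra). reflexivity.
Qed.

(* Power series are represented by their coefficient sequences. *)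
Definition entire (a : nat -> C) : Prop :=
  forall B, 0 < B -> exists K, forall n, Cmod (a n) * B ^ n <= K.

Definition ev (a : nat -> C) (z : C) : C := Cser (fun n => a n * z ^ n)%C.

(* Coefficients of [(1 + b z) a(z)]. *)
Definition lin (b : C) (a : nat -> C) (n : nat) : C :=
  match n with O => a O | S m => (a (S m) + b * a m)%C end.

Lemma entire_of_large (a : nat -> C) (B0 : R) :
  (forall B, B0 < B -> 0 < B -> exists K, forall n, Cmod (a n) * B ^ n <= K) -> entire a.
Proof.
  intros H B HB.
  destruct (H (Rmax B B0 + 1)) as [K HK].
  - assert (X := Rmax_r B B0). lra.
  - assert (X := Rmax_l B B0). lra.
  - exists K. intros n. eapply Rle_trans; [|apply HK].
    apply Rmult_le_compat_l; [apply Cmod_ge_0|]. apply pow_incr.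
    assert (X := Rmax_l B B0). lra.
Qed.

Lemma entire_geom (a : nat -> C) (rho : R) : entire a -> 0 <= rho ->
  exists K, 0 <= K /\ forall n, Cmod (a n) * rho ^ n <= K * (/ 2) ^ n.
Proof.
  (* A bound at more than twice the radius gives the ratio 1/2; the summand 1 keeps the radius
     positive when [rho = 0]. *)
  intros H Hr. destruct (H (2 * rho + 1)) as [K HK]; [lra|].
  exists K. assert (HK0 : 0 <= K).
  { eapply Rle_trans; [|apply (HK O)]. simpl. assert (X := Cmod_ge_0 (a O)). lra. }
  split; auto. intros n.
  apply Rle_trans with (Cmod (a n) * (2 * rho + 1) ^ n * (/2) ^ n).
  - rewrite Rmult_assoc, <- Rpow_mult_distr.
    apply Rmult_le_compat_l; [apply Cmod_ge_0|]. apply pow_incr. lra.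
  - apply Rmult_le_compat_r; auto. apply pow_le. lra.
Qed.

Lemma entire_ex_series (a : nat -> C) (rho : R) : entire a -> 0 <= rho ->
  ex_series (fun n => Cmod (a n) * rho ^ n).
Proof.
  intros H Hr. destruct (entire_geom a rho H Hr) as [K [HK0 HK]].
  apply @ex_series_le with (fun n => K * (/2) ^ n).
  - intros n. change (Rabs (Cmod (a n) * rho ^ n) <= K * (/2) ^ n).
    rewrite Rabs_pos_eq; auto. apply Rmult_le_pos; [apply Cmod_ge_0|now apply pow_le].
  - apply ex_series_geom_scal. lra.
Qed.

Lemma ev_summable (a : nat -> C) (z : C) : entire a -> abs_summable (fun n => a n * z ^ n)%C.
Proof.
  intros H. apply abs_summable_le with (fun n => Cmod (a n) * Cmod z ^ n).
  - intros n. rewrite Cmod_mult, Cmod_pow. lra.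
  - apply entire_ex_series; auto. apply Cmod_ge_0.
Qed.

(** Stands in for the maximum modulus on [|z| <= rho]: it bounds [ev a] there and can be computed
    from the coefficients. *)
Definition S1 (a : nat -> C) (rho : R) : R := Series (fun n => Cmod (a n) * rho ^ n).

Lemma Cmod_ev_le (a : nat -> C) (z : C) (rho : R) :
  entire a -> Cmod z <= rho -> Cmod (ev a z) <= S1 a rho.
Proof.
  intros H Hz. apply Cmod_Cser_le.
  - intros n. rewrite Cmod_mult, Cmod_pow. apply Rmult_le_compat_l; [apply Cmod_ge_0|].
    apply pow_incr. split; auto. apply Cmod_ge_0.
  - apply entire_ex_series; auto. assert (X := Cmod_ge_0 z). lra.
Qed.

Lemma S1_pos (a : nat -> C) (rho : R) : entire a -> 0 <= rho -> 0 <= S1 a rho.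
Proof.
  intros H Hr. apply Rle_trans with (Cmod (ev a 0)); [apply Cmod_ge_0|].
  apply Cmod_ev_le; auto. rewrite Cmod_0. auto.
Qed.

Lemma ev_incr_1 (a : nat -> C) (z : C) : entire a ->
  ev a z = (a O + Cser (fun n => a (S n) * z ^ S n))%C.
Proof.
  intros H. unfold ev. rewrite Cser_incr_1 by now apply ev_summable. simpl. ring.
Qed.

Lemma ev_0 (a : nat -> C) : entire a -> ev a 0 = a O.
Proof.
  intros H. unfold ev. rewrite Cser_incr_1 by now apply ev_summable.
  rewrite (Cser_ext _ (fun n => 0 * (a (S n) * 0 ^ S n))%C) by (intro; rewrite !Cpow_S; ring).
  rewrite Cser_mult_l by (apply (abs_summable_incr_1 _ (ev_summable a 0 H))).
  simpl. ring.
Qed.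

Lemma entire_lin (b : C) (a : nat -> C) : entire a -> entire (lin b a).
Proof.
  intros H B HB. destruct (H B HB) as [K HK].
  assert (HK0 : 0 <= K).
  { eapply Rle_trans; [|apply (HK O)]. simpl. assert (X := Cmod_ge_0 (a O)). lra. }
  exists (K + Cmod b * (B * K)). intros n. assert (Hb := Cmod_ge_0 b).
  assert (0 <= Cmod b * (B * K)) by (repeat apply Rmult_le_pos; lra).
  destruct n as [|m]; cbn [lin].
  - specialize (HK O). lra.
  - apply Rle_trans with ((Cmod (a (S m)) + Cmod b * Cmod (a m)) * B ^ S m).
    + apply Rmult_le_compat_r; [apply pow_le; lra|].
      rewrite <- Cmod_mult. apply Cmod_triangle.
    + rewrite Rmult_plus_distr_r. apply Rplus_le_compat; auto.
      replace (Cmod b * Cmod (a m) * B ^ S m) with (Cmod b * (B * (Cmod (a m) * B ^ m)))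
        by (simpl; ring).
      apply Rmult_le_compat_l; auto. apply Rmult_le_compat_l; [lra|auto].
Qed.

Lemma ev_lin (b : C) (a : nat -> C) (z : C) : entire a ->
  ev (lin b a) z = ((1 + b * z) * ev a z)%C.
Proof.
  intros H. assert (Hs := ev_summable a z H).
  unfold ev at 1. rewrite Cser_incr_1 by now apply ev_summable, entire_lin.
  rewrite (Cser_ext _ (fun n => a (S n) * z ^ S n + (b * z) * (a n * z ^ n))%C)
    by (intro; simpl; ring).
  rewrite Cser_plus.
  - rewrite Cser_mult_l by auto. fold (ev a z).
    assert (E : ev a z = (a O * z ^ 0 + Cser (fun n => a (S n) * z ^ S n))%C)
      by (now apply Cser_incr_1 in Hs).
    change (lin b a 0) with (a O). rewrite E. ring.
  - apply (abs_summable_incr_1 _ Hs).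
  - apply abs_summable_le with (fun n => Cmod (b * z) * Cmod (a n * z ^ n)%C).
    + intros n. rewrite <- Cmod_mult. lra.
    + apply @ex_series_scal. exact Hs.
Qed.

Lemma lin_comm (b c : C) (a : nat -> C) : lin b (lin c a) = lin c (lin b a).
Proof.
  apply functional_extensionality. intros [|[|n]]; simpl; ring.
Qed.

Lemma entire_scal (k : C) (a : nat -> C) : entire a -> entire (fun n => k * a n)%C.
Proof.
  intros H B HB. destruct (H B HB) as [K HK]. exists (Cmod k * K).
  intros n. rewrite Cmod_mult, Rmult_assoc. apply Rmult_le_compat_l; auto using Cmod_ge_0.
Qed.

Lemma ev_scal (k : C) (a : nat -> C) (z : C) : entire a ->
  ev (fun n => k * a n)%C z = (k * ev a z)%C.
Proof.
  intros H. unfold ev. rewrite <- Cser_mult_l by now apply ev_summable.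
  apply Cser_ext. intro; ring.
Qed.

(* Coefficients of the quotient of [a - ev a w] by [z - w]. *)
Definition quot (a : nat -> C) (w : C) (n : nat) : C :=
  Cser (fun i => a (S n + i)%nat * w ^ i)%C.

Lemma quot_summable (a : nat -> C) (w : C) (n : nat) : entire a ->
  abs_summable (fun i => a (S n + i)%nat * w ^ i)%C.
Proof.
  intros H. destruct (H (2 * Cmod w + 1)) as [K HK].
  { assert (X := Cmod_ge_0 w). lra. }
  assert (Hw := Cmod_ge_0 w).
  apply abs_summable_le with (fun i => K * (/2) ^ i); [|apply ex_series_geom_scal; lra].
  intros i. rewrite Cmod_mult, Cmod_pow.
  apply Rle_trans with (Cmod (a (S n + i)%nat) * (2 * Cmod w + 1) ^ (S n + i) * (/2) ^ i).
  - rewrite Rmult_assoc. apply Rmult_le_compat_l; [apply Cmod_ge_0|].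
    rewrite pow_add, Rmult_assoc, <- Rpow_mult_distr.
    rewrite <- (Rmult_1_l (Cmod w ^ i)). apply Rmult_le_compat; try lra.
    + now apply pow_le.
    + apply pow_R1_Rle. lra.
    + apply pow_incr. lra.
  - apply Rmult_le_compat_r; auto. apply pow_le. lra.
Qed.

Lemma quot_rec (a : nat -> C) (w : C) (n : nat) : entire a ->
  quot a w n = (a (S n) + w * quot a w (S n))%C.
Proof.
  intros H. unfold quot. rewrite Cser_incr_1 by now apply quot_summable.
  rewrite <- Cser_mult_l by now apply quot_summable.
  replace (S n + 0)%nat with (S n) by lia.
  rewrite Cmult_1_r. f_equal. apply Cser_ext. intros i.
  replace (S n + S i)%nat with (S (S n) + i)%nat by lia. simpl. ring.
Qed.

Lemma entire_quot (a : nat -> C) (w : C) : entire a -> entire (quot a w).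
Proof.
  (* For [B > 2 |w|] the series defining the n-th coefficient is dominated by [K / B^(n+1)] times a
     geometric series of ratio 1/2. *)
  intros H. apply entire_of_large with (2 * Cmod w). intros B HB HB0.
  destruct (H B HB0) as [K HK]. assert (Hw := Cmod_ge_0 w).
  exists (2 * K / B). intros n.
  assert (Hle : Cmod (quot a w n) <= Series (fun i => K / B ^ S n * (/2) ^ i)).
  { apply Cmod_Cser_le; [|apply ex_series_geom_scal; lra].
    intros i. rewrite Cmod_mult, Cmod_pow.
    assert (HBn : 0 < B ^ S n) by now apply pow_lt.
    apply Rmult_le_reg_r with (B ^ S n); auto.
    replace (K / B ^ S n * (/ 2) ^ i * B ^ S n) with (K * (/2)^i) by (field; lra).
    apply Rle_trans with (Cmod (a (S n + i)%nat) * B ^ (S n + i) * (/2) ^ i).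
    - rewrite pow_add.
      replace (Cmod (a (S n + i)%nat) * (B ^ S n * B ^ i) * (/ 2) ^ i) with
        (Cmod (a (S n + i)%nat) * ((B * / 2) ^ i) * B ^ S n) by (rewrite Rpow_mult_distr; ring).
      apply Rmult_le_compat_r; [lra|]. apply Rmult_le_compat_l; [apply Cmod_ge_0|].
      apply pow_incr. lra.
    - apply Rmult_le_compat_r; auto. apply pow_le. lra. }
  rewrite Series_geom_scal in Hle by lra.
  assert (HBn : 0 < B ^ n) by now apply pow_lt.
  apply Rle_trans with (K / B ^ S n / (1 - / 2) * B ^ n).
  - apply Rmult_le_compat_r; lra.
  - simpl. apply Req_le. field. lra.
Qed.

Lemma ev_quot (a : nat -> C) (w z : C) : entire a ->
  ev a z = (ev a w + (z - w) * ev (quot a w) z)%C.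
Proof.
  intros H. assert (HG := entire_quot a w H).
  assert (Hs := ev_summable _ z HG).
  assert (Haw : ev a w = (a O + w * quot a w O)%C).
  { unfold ev. rewrite Cser_incr_1 by now apply ev_summable.
    unfold quot. rewrite <- Cser_mult_l by now apply quot_summable.
    f_equal; [simpl; ring|]. apply Cser_ext. intro; simpl; ring. }
  assert (Hz : ev a z = (a O + Cser (fun n => a (S n) * z ^ S n))%C).
  { unfold ev. rewrite Cser_incr_1 by now apply ev_summable. simpl. ring. }
  assert (E : (z * ev (quot a w) z = Cser (fun n => a (S n) * z ^ S n)
     + w * Cser (fun n => quot a w (S n) * z ^ S n))%C).
  { unfold ev. rewrite <- !Cser_mult_l; auto.
    2: now apply (abs_summable_incr_1 (fun n => quot a w n * z ^ n)%C).
    rewrite <- Cser_plus.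
    - apply Cser_ext. intros n. rewrite (quot_rec a w n) by auto. simpl; ring.
    - now apply (abs_summable_incr_1 (fun n => a n * z ^ n)%C), ev_summable.
    - apply abs_summable_le with (fun n => Cmod w * Cmod (quot a w (S n) * z ^ S n)%C).
      + intros n. rewrite <- Cmod_mult. lra.
      + apply @ex_series_scal. now apply (abs_summable_incr_1 (fun n => quot a w n * z ^ n)%C). }
  assert (E2 : ev (quot a w) z = (quot a w O + Cser (fun n => quot a w (S n) * z ^ S n))%C).
  { unfold ev. rewrite Cser_incr_1 by auto. simpl. ring. }
  rewrite Haw, Hz.
  replace ((z - w) * ev (quot a w) z)%C with (z * ev (quot a w) z - w * ev (quot a w) z)%C by ring.
  rewrite E, E2. ring.
Qed.

(** The quotient by [z - w] is rescaled by [- w], so that the extracted factor is [1 - z/w] and the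
    constant coefficient is preserved. *)
Lemma lin_quot (a : nat -> C) (w : C) : entire a -> w <> 0 -> ev a w = 0 ->
  exists G, entire G /\ a = lin (- / w) G.
Proof.
  intros H Hw H0. exists (fun n => - w * quot a w n)%C. split.
  - now apply entire_scal, entire_quot.
  - apply functional_extensionality. intros [|n]; cbn [lin].
    + unfold ev in H0. rewrite Cser_incr_1 in H0 by now apply ev_summable.
      replace (- w * quot a w 0)%C with (- (w * quot a w 0))%C by ring.
      unfold quot. rewrite <- Cser_mult_l by now apply quot_summable.
      rewrite (Cser_ext _ (fun n => a (S n) * w ^ S n)%C) by (intro; simpl; ring).
      rewrite Cmult_1_r in H0.
      set (X := Cser (fun n => a (S n) * w ^ S n)%C) in *.
      replace (a O) with ((a O + X) - X)%C by ring. rewrite H0. ring.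
    + rewrite (quot_rec a w n) by auto. field. auto.
Qed.

(** The difference quotient at [w] is [quot a w], itself entire and thus bounded on the unit disc
    around [w]. *)
Lemma ev_lipschitz (a : nat -> C) (w : C) : entire a ->
  exists K, 0 < K /\ forall z, Cmod (z - w) <= 1 ->
    Cmod (ev a z - ev a w) <= K * Cmod (z - w).
Proof.
  intros H. assert (HG := entire_quot a w H). assert (Hw := Cmod_ge_0 w).
  assert (HS : 0 <= S1 (quot a w) (Cmod w + 1)) by (apply S1_pos; auto; lra).
  exists (S1 (quot a w) (Cmod w + 1) + 1). split; [lra|].
  intros z Hz. rewrite (ev_quot a w z) by auto.
  replace (ev a w + (z - w) * ev (quot a w) z - ev a w)%C with (ev (quot a w) z * (z - w))%C by ring.
  rewrite Cmod_mult. apply Rmult_le_compat_r; [apply Cmod_ge_0|].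
  apply Rle_trans with (S1 (quot a w) (Cmod w + 1)); [|lra].
  apply Cmod_ev_le; auto. replace z with (w + (z - w))%C by ring.
  eapply Rle_trans; [apply Cmod_triangle|lra].
Qed.

(** * Jensen's inequality *)

(** By Parseval this is the mean of [|a|^2] over the circle [|z| = rho]; taking the series as
    definition avoids integrals. *)
Definition L2sq (rho : R) (a : nat -> C) : R := Series (fun n => (Cmod (a n) * rho ^ n) ^ 2).

Lemma L2sq_ex (rho : R) (a : nat -> C) : entire a -> 0 <= rho ->
  ex_series (fun n => (Cmod (a n) * rho ^ n) ^ 2).
Proof.
  intros H Hr. destruct (entire_geom a rho H Hr) as [K [HK0 HK]].
  apply @ex_series_le with (fun n => K ^ 2 * (/4) ^ n).
  - intros n. change (Rabs ((Cmod (a n) * rho ^ n) ^ 2) <= K ^ 2 * (/4) ^ n).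
    rewrite Rabs_pos_eq by apply pow2_ge_0.
    replace (K ^ 2 * (/4) ^ n) with ((K * (/2) ^ n) ^ 2).
    2: { replace (/4) with (/2 * /2) by lra. rewrite !Rpow_mult_distr. ring. }
    apply pow_incr. split; auto. apply Rmult_le_pos; [apply Cmod_ge_0|now apply pow_le].
  - apply ex_series_geom_scal. lra.
Qed.

Lemma sum_n_S (x : nat -> R) (n : nat) : sum_n x (S n) = sum_n x n + x (S n).
Proof. exact (sum_Sn x n). Qed.

Lemma partial_le_Series (x : nat -> R) (n : nat) :
  (forall k, 0 <= x k) -> ex_series x -> sum_n x n <= Series x.
Proof.
  intros H0 Hx. apply Series_correct in Hx.
  assert (Hl : is_lim_seq (sum_n x) (Series x)) by exact Hx.
  apply (is_lim_seq_incr_compare (sum_n x) (Series x)); auto.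
  intros k. rewrite sum_n_S. specialize (H0 (S k)). lra.
Qed.

Lemma Series_le_bound (x : nat -> R) (M : R) :
  ex_series x -> (forall n, sum_n x n <= M) -> Series x <= M.
Proof.
  intros Hx H. apply Series_correct in Hx.
  assert (Hl : is_lim_seq (sum_n x) (Series x)) by exact Hx.
  apply (is_lim_seq_le (sum_n x) (fun _ => M) (Series x) M); auto. apply is_lim_seq_const.
Qed.

Lemma L2sq_term_le (rho : R) (a : nat -> C) (n : nat) : entire a -> 0 <= rho ->
  (Cmod (a n) * rho ^ n) ^ 2 <= L2sq rho a.
Proof.
  intros H Hr.
  eapply Rle_trans; [|apply (partial_le_Series _ n); [intro; apply pow2_ge_0|now apply L2sq_ex]].
  destruct n.
  - rewrite sum_O. lra.
  - rewrite sum_n_S.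
    assert (X : 0 <= sum_n (fun n => (Cmod (a n) * rho ^ n) ^ 2) n).
    { clear. induction n; [rewrite sum_O; apply pow2_ge_0|].
      rewrite sum_n_S. apply Rplus_le_le_0_compat; auto. apply pow2_ge_0. }
    lra.
Qed.

Lemma L2sq_le_S1 (rho : R) (a : nat -> C) : entire a -> 0 <= rho ->
  L2sq rho a <= S1 a rho ^ 2.
Proof.
  intros H Hr.
  assert (P : forall k, 0 <= Cmod (a k) * rho ^ k).
  { intro. apply Rmult_le_pos; [apply Cmod_ge_0|now apply pow_le]. }
  apply Series_le_bound; [now apply L2sq_ex|]. intros n.
  assert (X : 0 <= sum_n (fun n => Cmod (a n) * rho ^ n) n /\
    sum_n (fun n => (Cmod (a n) * rho ^ n) ^ 2) n <= (sum_n (fun n => Cmod (a n) * rho ^ n) n) ^ 2).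
  { induction n.
    - rewrite !sum_O. split; [apply P|lra].
    - rewrite !sum_n_S. specialize (P (S n)).
      destruct IHn as [I1 I2].
      revert P I1 I2. generalize (Cmod (a (S n)) * rho ^ S n).
      generalize (sum_n (fun n => Cmod (a n) * rho ^ n) n).
      generalize (sum_n (fun n => (Cmod (a n) * rho ^ n) ^ 2) n).
      intros s q p P I1 I2. split; [lra|nra]. }
  destruct X as [X1 X2]. eapply Rle_trans; [exact X2|]. apply pow_incr. split; auto.
  apply (partial_le_Series (fun n => Cmod (a n) * rho ^ n)); auto. now apply entire_ex_series.
Qed.

(* [1 - z/w] and [1 - conj w z/rho^2] have proportional moduli on [|z| = rho]. *)
Definition zf (w : C) : C := (- / w)%C.
Definition rf (rho : R) (w : C) : C := (- (Cconj w / RtoC (rho ^ 2)))%C.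

Lemma Cmod_pos (w : C) : w <> 0 -> 0 < Cmod w.
Proof. apply Cmod_gt_0. Qed.

(** The equality of moduli on the circle is turned into an identity of coefficients: the partial
    sums of the difference telescope to [kap] times the n-th term of [L2sq rho G], which tends to
    0. *)
Lemma L2sq_reflect (rho : R) (w : C) (G : nat -> C) : entire G -> 0 < rho -> w <> 0 ->
  L2sq rho (lin (zf w) G) = (rho / Cmod w) ^ 2 * L2sq rho (lin (rf rho w) G).
Proof.
  intros HG Hr Hw. assert (Hw' := Cmod_pos w Hw).
  assert (HW : Cmod w ^ 2 = fst w ^ 2 + snd w ^ 2) by apply Cmod2_alt.
  set (kap := 1 - rho ^ 2 / Cmod w ^ 2).
  set (x := fun n => (Cmod (G n) * rho ^ n) ^ 2).
  set (y := fun n => (Cmod (lin (zf w) G n) * rho ^ n) ^ 2).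
  set (v := fun n => (rho / Cmod w) ^ 2 * (Cmod (lin (rf rho w) G n) * rho ^ n) ^ 2).
  assert (Ey : ex_series y) by (apply L2sq_ex; [now apply entire_lin|lra]).
  assert (Ev : ex_series v).
  { apply @ex_series_scal. apply L2sq_ex; [now apply entire_lin|lra]. }
  assert (Ex : ex_series x) by (apply L2sq_ex; auto; lra).
  assert (Hpart : forall n, sum_n (fun n => y n - v n) n = kap * x n).
  { induction n.
    - rewrite sum_O. change (y O - v O = kap * x O). unfold y, v, kap, x. simpl lin. field. lra.
    - rewrite sum_n_S, IHn. unfold y, v, x, kap. cbn [lin].
      rewrite !Rpow_mult_distr.
      replace ((rho / Cmod w) ^ 2) with (rho ^ 2 / Cmod w ^ 2) by (field; lra).
      rewrite !Cmod2_alt. unfold Re, Im, zf, rf.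
      cbn [pow]. rewrite ?Rmult_1_r.
      destruct (G (S n)) as [u1 u2]. destruct (G n) as [v1 v2].
      destruct w as [w1 w2]. simpl in HW.
      assert (HW2 : w1 * w1 + w2 * w2 <> 0) by nra.
      unfold Cplus, Cmult, Copp, Cinv, Cdiv, Cconj, RtoC. simpl.
      generalize (rho ^ n). intros p. field. split; [nra|lra]. }
  assert (Hlim : is_lim_seq (fun n => kap * x n) (kap * 0)).
  { apply is_lim_seq_mult'; [apply is_lim_seq_const|]. now apply ex_series_lim_0. }
  assert (HS : is_series (fun n => y n - v n) 0).
  { unfold is_series. change (is_lim_seq (sum_n (fun n => y n - v n)) 0).
    rewrite Rmult_0_r in Hlim. eapply is_lim_seq_ext; [|exact Hlim]. intro; now rewrite Hpart. }
  apply is_series_unique in HS. rewrite Series_minus in HS by auto.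
  unfold L2sq. rewrite <- Series_scal_l. fold y. fold v. lra.
Qed.

(** The map [g] is a parameter so that the factors [1 - z/w] ([zf]) and their reflections ([rf rho])
    share all lemmas and the same [Q]. *)
Definition linprod (g : C -> C) (L : list C) (Q : nat -> C) : nat -> C :=
  fold_right (fun z G => lin (g z) G) Q L.

Definition sumR (g : C -> R) (L : list C) : R := fold_right Rplus 0 (map g L).

Lemma entire_linprod (g : C -> C) (L : list C) (Q : nat -> C) :
  entire Q -> entire (linprod g L Q).
Proof. intros H. induction L; simpl; auto. now apply entire_lin. Qed.

Lemma linprod_O (g : C -> C) (L : list C) (Q : nat -> C) : linprod g L Q O = Q O.
Proof. induction L; simpl; auto. Qed.

Lemma linprod_lin (g : C -> C) (L : list C) (b : C) (Q : nat -> C) :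
  linprod g L (lin b Q) = lin b (linprod g L Q).
Proof. induction L; simpl; auto. rewrite IHL. apply lin_comm. Qed.

Lemma linprod_app (g : C -> C) (L1 L2 : list C) (Q : nat -> C) :
  linprod g (L1 ++ L2) Q = linprod g L1 (linprod g L2 Q).
Proof. unfold linprod. apply fold_right_app. Qed.

Lemma linprod_perm (g : C -> C) (L1 L2 : list C) (Q : nat -> C) :
  Permutation L1 L2 -> linprod g L1 Q = linprod g L2 Q.
Proof.
  intros H. induction H; simpl; auto.
  - now rewrite IHPermutation.
  - apply lin_comm.
  - congruence.
Qed.

Lemma sumR_perm (g : C -> R) (L1 L2 : list C) : Permutation L1 L2 -> sumR g L1 = sumR g L2.
Proof. unfold sumR. intros H. induction H; simpl; lra. Qed.

Lemma sumR_le (f g : C -> R) (L : list C) :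
  (forall z, In z L -> f z <= g z) -> sumR f L <= sumR g L.
Proof.
  unfold sumR. induction L; simpl; intros H; [lra|].
  assert (f a <= g a) by auto. assert (fold_right Rplus 0 (map f L) <= fold_right Rplus 0 (map g L)) by auto.
  lra.
Qed.

Lemma sumR_ext (f g : C -> R) (L : list C) :
  (forall z, In z L -> f z = g z) -> sumR f L = sumR g L.
Proof. intros H. apply Rle_antisym; apply sumR_le; intros z Hz; rewrite (H z Hz); lra. Qed.

Lemma sumR_plus (f g : C -> R) (L : list C) : sumR (fun z => f z + g z) L = sumR f L + sumR g L.
Proof. unfold sumR. induction L; simpl; lra. Qed.

Lemma sumR_scal (k : R) (f : C -> R) (L : list C) : sumR (fun z => k * f z) L = k * sumR f L.
Proof. unfold sumR. induction L; simpl; lra. Qed.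

Lemma sumR_const (k : R) (L : list C) : sumR (fun _ => k) L = k * INR (length L).
Proof.
  unfold sumR. induction L; [simpl; lra|].
  cbn [map fold_right length]. rewrite S_INR, IHL. lra.
Qed.

Lemma L2sq_linprod (rho : R) (L : list C) (Q : nat -> C) :
  entire Q -> 0 < rho -> (forall z, In z L -> z <> 0) ->
  L2sq rho (linprod zf L Q) =
  exp (2 * sumR (fun z => ln (rho / Cmod z)) L) * L2sq rho (linprod (rf rho) L Q).
Proof.
  revert Q. induction L as [|w L IH]; intros Q HQ Hr H0.
  - unfold sumR; simpl. rewrite Rmult_0_r, exp_0. ring.
  - assert (Hw : w <> 0) by (apply H0; now left). assert (Hw' := Cmod_pos w Hw).
    assert (Hq : 0 < rho / Cmod w) by now apply Rdiv_lt_0_compat.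
    change (linprod zf (w :: L) Q) with (lin (zf w) (linprod zf L Q)).
    rewrite L2sq_reflect by (auto using entire_linprod).
    rewrite <- linprod_lin, IH; auto using entire_lin.
    2: { intros z Hz. apply H0. now right. }
    rewrite linprod_lin.
    change (lin (rf rho w) (linprod (rf rho) L Q)) with (linprod (rf rho) (w :: L) Q).
    replace (2 * sumR (fun z => ln (rho / Cmod z)) (w :: L)) with
      (ln (rho / Cmod w) + ln (rho / Cmod w) + 2 * sumR (fun z => ln (rho / Cmod z)) L)
      by (unfold sumR; simpl; ring).
    rewrite !exp_plus, exp_ln by auto. simpl. ring.
Qed.

(** In [L2sq_linprod] the mean square of the reflected product is at least the square of its
    constant coefficient, which is 1, and that of the original is at most the square of [S1]. *)
Lemma jensen (rho : R) (L : list C) (Q : nat -> C) :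
  entire Q -> 0 < rho -> (forall z, In z L -> z <> 0) -> Q O = 1 ->
  sumR (fun z => ln (rho / Cmod z)) L <= ln (S1 (linprod zf L Q) rho).
Proof.
  intros HQ Hr H0 HQ0.
  assert (HF := entire_linprod zf L Q HQ).
  assert (E := L2sq_linprod rho L Q HQ Hr H0).
  assert (H1 : 1 <= L2sq rho (linprod (rf rho) L Q)).
  { eapply Rle_trans; [|apply (L2sq_term_le rho _ O); [now apply entire_linprod|lra]].
    rewrite linprod_O, HQ0, Cmod_1. simpl. lra. }
  assert (H2 := L2sq_le_S1 rho _ HF (Rlt_le _ _ Hr)).
  assert (HS := S1_pos _ rho HF (Rlt_le _ _ Hr)).
  set (s := sumR (fun z => ln (rho / Cmod z)) L) in *.
  set (T := S1 (linprod zf L Q) rho) in *.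
  assert (Hes : 0 < exp s) by apply exp_pos.
  assert (Hsq : exp (2 * s) = exp s ^ 2).
  { replace (2 * s) with (s + s) by ring. rewrite exp_plus. ring. }
  assert (exp s <= T).
  { apply Rnot_lt_le. intro. nra. }
  rewrite <- (ln_exp s). destruct (Req_dec (exp s) T) as [Eq|Ne].
  - rewrite Eq. lra.
  - left. apply ln_increasing; lra.
Qed.

Lemma ln_le_mono (x y : R) : 0 < x -> x <= y -> ln x <= ln y.
Proof. intros Hx [H|H]; [left; now apply ln_increasing|subst; lra]. Qed.

Definition factors (F : nat -> C) (rho : R) (L : list C) (Q : nat -> C) : Prop :=
  entire Q /\ Q O = 1 /\ F = linprod zf L Q /\ (forall z, In z L -> z <> 0 /\ Cmod z < rho).

(** In Jensen's inequality at radius [2 rho] each listed zero contributes at least [ln 2]. The bound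
    does not depend on the list, so the extraction of zeros must stop. *)
Lemma factors_bound (F : nat -> C) (rho : R) (L : list C) (Q : nat -> C) :
  0 < rho -> factors F rho L Q -> INR (length L) * ln 2 <= ln (S1 F (2 * rho)).
Proof.
  intros Hr (HQ & HQ0 & HF & HL).
  rewrite HF. eapply Rle_trans; [|apply jensen; auto; try lra].
  2: { intros z Hz. now apply HL. }
  rewrite Rmult_comm, <- sumR_const. apply sumR_le. intros z Hz.
  destruct (HL z Hz) as [Hz0 Hz1]. assert (X := Cmod_pos z Hz0).
  apply ln_le_mono; [lra|]. apply Rmult_le_reg_r with (Cmod z); auto.
  unfold Rdiv. rewrite Rmult_assoc, Rinv_l; lra.
Qed.

(** As long as [Q] vanishes somewhere in the disc, that zero is split off by [lin_quot];
    [factors_bound] limits the number of rounds. *)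
Lemma full_factorization (F : nat -> C) (rho : R) : entire F -> F O = 1 -> 0 < rho ->
  exists L Q, factors F rho L Q /\ (forall z, Cmod z < rho -> ev Q z <> 0).
Proof.
  intros HF HF0 Hr.
  destruct (INR_unbounded (ln (S1 F (2 * rho)) / ln 2)) as [K HK].
  assert (Hln2 : 0 < ln 2) by (rewrite <- ln_1; apply ln_increasing; lra).
  assert (Hmax : forall L Q, factors F rho L Q -> (length L < K)%nat).
  { intros L Q H. apply factors_bound in H; auto. apply INR_lt.
    eapply Rle_lt_trans; [|exact HK]. apply Rmult_le_reg_r with (ln 2); auto.
    unfold Rdiv. rewrite Rmult_assoc, Rinv_l; lra. }
  assert (Hind : forall m L Q, (K - length L <= m)%nat -> factors F rho L Q ->
    exists L Q, factors F rho L Q /\ (forall z, Cmod z < rho -> ev Q z <> 0)).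
  { induction m; intros L Q Hm HLQ.
    - assert (X := Hmax L Q HLQ). lia.
    - destruct (excluded_middle_informative (forall z, Cmod z < rho -> ev Q z <> 0)) as [Hz|Hz].
      + eauto.
      + apply Classical_Pred_Type.not_all_ex_not in Hz. destruct Hz as [w Hw].
        apply Classical_Prop.imply_to_and in Hw. destruct Hw as [Hw1 Hw2].
        apply Classical_Prop.NNPP in Hw2.
        destruct HLQ as (HQ & HQ0 & HFe & HL).
        assert (Hw0 : w <> 0).
        { intro E. rewrite E, ev_0, HQ0 in Hw2 by auto. now apply C1_nz. }
        destruct (lin_quot Q w HQ Hw0 Hw2) as [G [HG HQG]].
        apply (IHm (w :: L) G).
        * simpl. lia.
        * repeat split; auto.
          -- rewrite HQG in HQ0. exact HQ0.
          -- rewrite HFe, HQG, linprod_lin. reflexivity.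
          -- destruct H as [<-|H]; auto. now apply HL.
          -- destruct H as [<-|H]; auto. now apply HL. }
  apply (Hind K nil F); [simpl; lia|].
  repeat split; auto; contradiction.
Qed.

(** * The minimum principle *)

Definition cis (t : R) : C := (cos t, sin t).

Lemma Cmod_cis (t : R) : Cmod (cis t) = 1.
Proof.
  unfold Cmod, cis. simpl fst. simpl snd.
  assert (X := sin2_cos2 t). unfold Rsqr in X.
  replace (cos t ^ 2 + sin t ^ 2) with 1 by (simpl; lra). apply sqrt_1.
Qed.

Lemma cis_plus (s t : R) : cis (s + t) = (cis s * cis t)%C.
Proof. unfold cis, Cmult. simpl. rewrite cos_plus, sin_plus. f_equal; ring. Qed.

Lemma cis_pow (t : R) (n : nat) : (cis t ^ n)%C = cis (INR n * t).
Proof.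
  induction n.
  - simpl. rewrite Rmult_0_l. unfold cis. rewrite cos_0, sin_0. reflexivity.
  - rewrite Cpow_S, IHn, <- cis_plus, S_INR. f_equal. ring.
Qed.

Lemma cis_surj (z : C) : Cmod z = 1 -> exists t, z = cis t.
Proof.
  destruct z as [x y]. intros H.
  assert (H2 : x ^ 2 + y ^ 2 = 1).
  { assert (X := Cmod2_alt (x, y)). rewrite H in X. simpl in X. simpl. lra. }
  assert (Hx : -1 <= x <= 1) by nra.
  destruct (Rle_dec 0 y) as [Hy|Hy].
  - exists (acos x). unfold cis. rewrite cos_acos, sin_acos by auto. f_equal.
    symmetry. apply sqrt_lem_1; unfold Rsqr; nra.
  - exists (- acos x). unfold cis. rewrite cos_neg, sin_neg, cos_acos, sin_acos by auto. f_equal.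
    assert (E : sqrt (1 - Rsqr x) = - y) by (apply sqrt_lem_1; unfold Rsqr; nra).
    rewrite E. ring.
Qed.

Lemma unit_root (s : nat) (zeta : C) : (0 < s)%nat -> Cmod zeta = 1 ->
  exists u, Cmod u = 1 /\ (u ^ s)%C = zeta.
Proof.
  intros Hs Hz. destruct (cis_surj zeta Hz) as [t ->].
  exists (cis (t / INR s)). split; [apply Cmod_cis|]. rewrite cis_pow. f_equal. field.
  apply not_0_INR. lia.
Qed.

Lemma monomial_factor (p : nat) (G : nat -> C) : entire G -> G p <> 0 ->
  (forall k, (k < p)%nat -> G k = 0) ->
  exists G', entire G' /\ G' O <> 0 /\ forall z, ev G z = (z ^ p * ev G' z)%C.
Proof.
  revert G. induction p; intros G HG Hp H0.
  - exists G. repeat split; auto. intros z. simpl. ring.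
  - assert (HQ : forall n, quot G 0 n = G (S n)).
    { intros n. rewrite quot_rec by auto. ring. }
    destruct (IHp (quot G 0)) as [G' (HG' & HG'0 & E)].
    + now apply entire_quot.
    + now rewrite HQ.
    + intros k Hk. rewrite HQ. apply H0. lia.
    + exists G'. repeat split; auto. intros z. rewrite (ev_quot G 0 z), ev_0, H0, E by (auto; lia).
      rewrite Cpow_S. ring.
Qed.

Lemma linprod_order (L : list C) (Q : nat -> C) (z0 : C) :
  entire Q -> (forall z, In z L -> z <> 0) -> ev Q z0 <> 0 -> z0 <> 0 ->
  exists s g, entire g /\ ev g z0 <> 0 /\
    forall z, ev (linprod zf L Q) z = ((z - z0) ^ s * ev g z)%C.
Proof.
  intros HQ HL HQ0 Hz0. induction L as [|w L IH].
  - exists O, Q. repeat split; auto. intros; simpl. ring.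
  - destruct IH as (s & g & Hg & Hg0 & E); [intros; apply HL; now right|].
    assert (Hw : w <> 0) by (apply HL; now left).
    assert (HE : forall z, ev (linprod zf (w :: L) Q) z =
      ((1 - z / w) * ((z - z0) ^ s * ev g z))%C).
    { intros z. change (linprod zf (w :: L) Q) with (lin (zf w) (linprod zf L Q)).
      rewrite ev_lin, E by now apply entire_linprod. unfold zf. field. auto. }
    destruct (excluded_middle_informative (w = z0)) as [->|Hne].
    + exists (S s), (fun n => - / z0 * g n)%C. repeat split.
      * now apply entire_scal.
      * rewrite ev_scal by auto. apply Cmult_neq_0; auto.
        intro X. apply C1_nz. replace (RtoC 1) with (- (- / z0 * z0))%C by (field; auto).
        rewrite X. ring.
      * intros z. rewrite HE, ev_scal, Cpow_S by auto. field. auto.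
    + exists s, (lin (zf w) g). repeat split.
      * now apply entire_lin.
      * rewrite ev_lin by auto. apply Cmult_neq_0; auto. unfold zf.
        intro X. apply Hne. symmetry. apply Ceq_minus.
        replace (z0 - w)%C with (- w * (1 + - / w * z0))%C by (field; auto). rewrite X. ring.
      * intros z. rewrite HE, ev_lin by auto. unfold zf. field. auto.
Qed.

(** No Taylor expansion at [z0] is made. At 0 the order is read off the coefficients; elsewhere it
    is the number of occurrences of [z0] in a full factorization over a larger disc, which must be
    normalized by [G O]. Hence the disjunction in the hypotheses. *)
Lemma local_order (G : nat -> C) (z0 : C) :
  entire G -> (exists n, G n <> 0) -> z0 = 0 \/ G O <> 0 ->
  exists s g, entire g /\ ev g z0 <> 0 /\ forall z, ev G z = ((z - z0) ^ s * ev g z)%C.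
Proof.
  intros HG [n Hn] Hc.
  destruct (excluded_middle_informative (z0 = 0)) as [->|Hz0].
  - assert (Hp : exists p, G p <> 0 /\ forall k, (k < p)%nat -> G k = 0).
    { clear Hc. induction n as [n IH] using lt_wf_ind.
      destruct (excluded_middle_informative (exists k, (k < n)%nat /\ G k <> 0)) as [(k & Hk & Hk')|Hno].
      - eauto.
      - exists n. split; auto. intros k Hk. apply Classical_Prop.NNPP. intro. apply Hno. eauto. }
    destruct Hp as (p & Hp & Hp').
    destruct (monomial_factor p G HG Hp Hp') as (g & Hg & Hg0 & E).
    exists p, g. repeat split; auto.
    + now rewrite ev_0.
    + intros z. rewrite E. f_equal. f_equal. ring.
  - destruct Hc as [|HG0]; [contradiction|].
    assert (HF := entire_scal (/ G O) G HG).
    destruct (full_factorization (fun n => / G O * G n)%C (Cmod z0 + 1)) as (L & Q & HLQ & HQz); auto.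
    + field. auto.
    + assert (X := Cmod_ge_0 z0). lra.
    + destruct HLQ as (HQ & HQ0 & HFe & HL).
      destruct (linprod_order L Q z0) as (s & g & Hg & Hg0 & E); auto.
      { intros z Hz. now apply HL. }
      { apply HQz. lra. }
      exists s, (fun n => G O * g n)%C. repeat split.
      * now apply entire_scal.
      * rewrite ev_scal by auto. now apply Cmult_neq_0.
      * intros z. rewrite ev_scal by auto.
        assert (E2 : ev G z = (G O * ev (fun n => / G O * G n)%C z)%C).
        { rewrite ev_scal by auto. field. auto. }
        rewrite E2, HFe, E. ring.
Qed.

(** If the infimum [m] were not attained, compactness would give a uniform gap [d] with
    [m + d <= phi] on the disc, contradicting the choice of [m]. *)
Lemma disc_min (phi : C -> R) (rho : R) : 0 <= rho -> (forall z, 0 <= phi z) ->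
  (forall z eps, 0 < eps -> exists d, 0 < d /\ forall w, Cmod (w - z) < d -> Rabs (phi w - phi z) < eps) ->
  exists z0, Cmod z0 <= rho /\ forall z, Cmod z <= rho -> phi z0 <= phi z.
Proof.
  intros Hrho Hpos Hcont.
  set (E := fun y => exists z, Cmod z <= rho /\ y = - phi z).
  destruct (completeness E) as [mm [Hub Hlub]].
  { exists 0. intros y (z & _ & ->). specialize (Hpos z). lra. }
  { exists (- phi 0), 0. split; auto. rewrite Cmod_0. auto. }
  set (m := - mm).
  destruct (excluded_middle_informative (exists z0, Cmod z0 <= rho /\ phi z0 <= m)) as [(z0 & H0 & H1)|Hno].
  { exists z0. split; auto. intros z Hz.
    assert (- phi z <= mm) by (apply Hub; exists z; auto). unfold m in *. lra. }
  exfalso.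
  assert (Hgt : forall z, Cmod z <= rho -> m < phi z).
  { intros z Hz. apply Rnot_le_lt. intro. apply Hno. eauto. }
  (* The compactness theorem concerns rectangles, so points of the square outside the disc get a
     gauge too, one that keeps their neighbourhood off the disc. Two coordinates each within [d]
     give a distance below [2 * d]. *)
  assert (Hdel : forall u v : R, { d : posreal |
     (Cmod (u, v) <= rho -> forall w, Cmod (w - (u, v)) < 2 * d -> m + d < phi w) /\
     (rho < Cmod (u, v) -> forall w, Cmod (w - (u, v)) < 2 * d -> rho < Cmod w) }).
  { intros u v. apply constructive_indefinite_description.
    destruct (Rle_lt_dec (Cmod (u, v)) rho) as [Hin|Hout].
    - specialize (Hgt _ Hin).
      destruct (Hcont (u, v) ((phi (u, v) - m) / 2)) as (d & Hd & Hd'); [lra|].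
      assert (Hp : 0 < Rmin (d / 2) ((phi (u, v) - m) / 2)) by (apply Rmin_pos; lra).
      exists (mkposreal _ Hp). split; [|intro; lra]. simpl. intros _ w Hw.
      assert (X := Rmin_l (d / 2) ((phi (u, v) - m) / 2)).
      assert (Y := Rmin_r (d / 2) ((phi (u, v) - m) / 2)).
      specialize (Hd' w). apply Rabs_lt_between in Hd'; lra.
    - assert (Hp : 0 < (Cmod (u, v) - rho) / 2) by lra.
      exists (mkposreal _ Hp). split; [intro; lra|]. simpl. intros _ w Hw.
      assert (T : Cmod (u, v) <= Cmod w + Cmod (w - (u, v))).
      { replace (u, v) with (w + - (w - (u, v)))%C at 1 by ring.
        rewrite <- (Cmod_opp (w - (u, v))). apply Cmod_triangle. }
      lra. }
  set (delta := fun u v => proj1_sig (Hdel u v)).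
  destruct (compactness_value_2d (- rho) rho (- rho) rho delta) as [d Hd].
  assert (Hall : forall z, Cmod z <= rho -> m + d <= phi z).
  { intros [x y] Hz. apply Rnot_lt_le. intro Hlt.
    assert (Hx := Rabs_fst_le_Cmod (x, y)). assert (Hy := Rabs_snd_le_Cmod (x, y)).
    simpl in Hx, Hy. apply Rabs_le_between in Hx. 
    assert (Hx' : - rho <= x <= rho) by lra.
    apply Rabs_le_between in Hy. assert (Hy' : - rho <= y <= rho) by lra.
    apply (Hd x y Hx' Hy'). intros (u & v & _ & _ & H1 & H2 & H3).
    unfold delta in *. destruct (Hdel u v) as [e [He1 He2]]. simpl in *.
    assert (Hc : Cmod ((x, y) - (u, v)) < 2 * e).
    { eapply Rle_lt_trans; [apply Cmod_le_sum|]. simpl. unfold Rminus in *. lra. }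
    destruct (Rle_lt_dec (Cmod (u, v)) rho) as [Hin|Hout].
    - specialize (He1 Hin _ Hc). lra.
    - specialize (He2 Hout _ Hc). lra. }
  assert (mm <= mm - d).
  { apply Hlub. intros yy (z & Hz & ->). specialize (Hall z Hz). unfold m in Hall. lra. }
  destruct d as [d Hd0]. simpl in *. lra.
Qed.

Lemma Cmod_diff_abs (z w : C) : Rabs (Cmod z - Cmod w) <= Cmod (z - w).
Proof.
  assert (H1 : Cmod z <= Cmod w + Cmod (z - w)).
  { replace z with (w + (z - w))%C at 1 by ring. apply Cmod_triangle. }
  assert (H2 : Cmod w <= Cmod z + Cmod (z - w)).
  { rewrite <- (Cmod_opp (z - w)). replace w with (z + - (z - w))%C at 1 by ring.
    apply Cmod_triangle. }
  apply Rabs_le. lra.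
Qed.

Lemma ev_disc_min (H : nat -> C) (rho : R) : entire H -> 0 <= rho ->
  exists z0, Cmod z0 <= rho /\ forall z, Cmod z <= rho -> Cmod (ev H z0) <= Cmod (ev H z).
Proof.
  intros HH Hr. apply (disc_min (fun z => Cmod (ev H z))); auto using Cmod_ge_0.
  intros z eps Heps. destruct (ev_lipschitz H z HH) as (K & HK & HL).
  exists (Rmin 1 (eps / K)). split.
  - apply Rmin_pos; [lra|]. now apply Rdiv_lt_0_compat.
  - intros w Hw. assert (X := Rmin_l 1 (eps / K)). assert (Y := Rmin_r 1 (eps / K)).
    eapply Rle_lt_trans; [apply Cmod_diff_abs|].
    eapply Rle_lt_trans; [apply HL; lra|].
    apply Rlt_le_trans with (K * (eps / K)); [apply Rmult_lt_compat_l; lra|].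
    apply Req_le. field. lra.
Qed.

(** The argument of d'Alembert and Argand: move so that the leading term [(z - z0)^s * ev g z0]
    points against [ev H z0]. *)
Lemma descent_direction (H g : nat -> C) (z0 : C) (s : nat) (tau : R) :
  entire g -> ev g z0 <> 0 -> (0 < s)%nat -> 0 < tau -> ev H z0 <> 0 ->
  (forall z, ev H z = (ev H z0 + (z - z0) ^ s * ev g z)%C) ->
  exists z, Cmod (z - z0) <= tau /\ Cmod (ev H z) < Cmod (ev H z0).
Proof.
  intros Hg Hg0 Hs Htau Hb E.
  set (b := ev H z0) in *. set (c := ev g z0) in *.
  assert (Pb := Cmod_pos b Hb). assert (Pc := Cmod_pos c Hg0).
  destruct (ev_lipschitz g z0 Hg) as (K & HK & HL). fold c in HL.
  assert (Nb : RtoC (Cmod b) <> 0) by (intro X; apply RtoC_inj in X; lra).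
  assert (Nc : RtoC (Cmod c) <> 0) by (intro X; apply RtoC_inj in X; lra).
  (* The unit number for which [zeta * c] is a negative multiple of [b]; an s-th root of it gives
     the direction of the step. *)
  set (zeta := (- (b / c) * (RtoC (Cmod c) / RtoC (Cmod b)))%C).
  assert (Hz1 : Cmod zeta = 1).
  { unfold zeta. rewrite Cmod_mult, Cmod_opp, !Cmod_div, !Cmod_R, !Rabs_pos_eq; auto; try lra.
    field. lra. }
  destruct (unit_root s zeta Hs Hz1) as (u & Hu & Hus).
  (* The four caps: 1 for the Lipschitz bound and [t^s <= t]; [tau] for the range; [|b|/|c|] so that
     the leading term does not overshoot 0; [|c|/(2K)] so that the error eats at most half of the
     gain. *)
  set (t := Rmin (Rmin 1 tau) (Rmin (Cmod b / Cmod c) (Cmod c / (2 * K)))).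
  assert (Ht : 0 < t).
  { unfold t. repeat apply Rmin_pos; try lra; apply Rdiv_lt_0_compat; lra. }
  assert (T1 : t <= 1) by (unfold t; eapply Rle_trans; [apply Rmin_l|apply Rmin_l]).
  assert (T2 : t <= tau) by (unfold t; eapply Rle_trans; [apply Rmin_l|apply Rmin_r]).
  assert (T3 : t <= Cmod b / Cmod c) by (unfold t; eapply Rle_trans; [apply Rmin_r|apply Rmin_l]).
  assert (T4 : t <= Cmod c / (2 * K)) by (unfold t; eapply Rle_trans; [apply Rmin_r|apply Rmin_r]).
  assert (Hts : 0 < t ^ s) by now apply pow_lt.
  assert (Hts1 : t ^ s <= t).
  { destruct s; [lia|]. simpl. rewrite <- (Rmult_1_r t) at 3.
    apply Rmult_le_compat_l; [lra|]. rewrite <- (pow1 s). apply pow_incr. lra. }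
  set (z := (z0 + RtoC t * u)%C).
  assert (Hzz : (z - z0 = RtoC t * u)%C) by (unfold z; ring).
  assert (Hm : Cmod (z - z0) = t).
  { rewrite Hzz, Cmod_mult, Cmod_R, Hu, Rabs_pos_eq; lra. }
  exists z. split; [lra|].
  assert (Eq : ev H z = (b * RtoC (1 - t ^ s * (Cmod c / Cmod b)) +
     RtoC (t ^ s) * zeta * (ev g z - c))%C).
  { rewrite (E z), Hzz, Cpow_mult_l, Hus, <- RtoC_pow, RtoC_minus, !RtoC_mult, RtoC_div by lra.
    unfold zeta. field. repeat split; auto. }
  rewrite Eq. eapply Rle_lt_trans; [apply Cmod_triangle|].
  rewrite !Cmod_mult, Hz1, !Cmod_R, Rmult_1_r.
  assert (HL' : Cmod (ev g z - c) <= K * t) by (rewrite <- Hm; apply HL; lra).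
  assert (U1 : 0 <= 1 - t ^ s * (Cmod c / Cmod b)).
  { assert (t ^ s * (Cmod c / Cmod b) <= Cmod b / Cmod c * (Cmod c / Cmod b)).
    { apply Rmult_le_compat_r; [|lra]. apply Rlt_le, Rdiv_lt_0_compat; lra. }
    replace (Cmod b / Cmod c * (Cmod c / Cmod b)) with 1 in H0 by (field; lra). lra. }
  rewrite !Rabs_pos_eq by lra.
  replace (Cmod b * (1 - t ^ s * (Cmod c / Cmod b))) with (Cmod b - t ^ s * Cmod c) by (field; lra).
  assert (K * t <= Cmod c / 2).
  { apply Rle_trans with (K * (Cmod c / (2 * K))); [apply Rmult_le_compat_l; lra|].
    apply Req_le; field; lra. }
  assert (t ^ s * Cmod (ev g z - c) <= t ^ s * (Cmod c / 2)) by (apply Rmult_le_compat_l; lra).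
  assert (0 < t ^ s * Cmod c) by now apply Rmult_lt_0_compat.
  lra.
Qed.

(** A minimizer over the closed disc lies on the circle, since descent is possible from an interior
    one, unless [H] is constant. *)
Lemma min_principle (H : nat -> C) (rho : R) : entire H -> 0 < rho ->
  (forall z, Cmod z <= rho -> ev H z <> 0) ->
  exists z, Cmod z = rho /\ Cmod (ev H z) <= Cmod (H O).
Proof.
  intros HH Hr Hnz. 
  assert (M0 : Cmod 0 <= rho) by (rewrite Cmod_0; lra).
  (* [local_order] for [H - ev H z0] needs [z0 = 0] or a nonzero constant coefficient. When
     [H O = ev H z0], the point 0 is a minimizer as well and replaces [z0]. *)
  assert (Hmin : exists z0, Cmod z0 <= rho /\
      (forall z, Cmod z <= rho -> Cmod (ev H z0) <= Cmod (ev H z)) /\ (z0 = 0 \/ H O <> ev H z0)).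
  { destruct (ev_disc_min H rho HH (Rlt_le _ _ Hr)) as (z0 & Hz0 & Hm).
    destruct (excluded_middle_informative (H O = ev H z0)) as [E|E].
    - exists 0. repeat split; auto. intros z Hz. rewrite ev_0, E by auto. auto.
    - exists z0. auto. }
  destruct Hmin as (z0 & Hz0 & Hm & Hc).
  set (G := fun n => match n with O => (H O - ev H z0)%C | S _ => H n end).
  assert (HG : entire G).
  { intros B HB. destruct (HH B HB) as [K HK].
    exists (K + Cmod (G O)). intros n. assert (X := Cmod_ge_0 (G O)). specialize (HK n).
    destruct n; [|simpl in *; lra].
    assert (Y := Cmod_ge_0 (H O)). cbn [pow] in *. lra. }
  assert (EG : forall z, ev H z = (ev H z0 + ev G z)%C).
  { intros z. rewrite (ev_incr_1 H z), (ev_incr_1 G z) by auto. unfold G. ring. }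
  destruct (excluded_middle_informative (exists n, G n <> 0)) as [Hn|Hn].
  - destruct (Req_dec (Cmod z0) rho) as [Eq|Ne].
    { exists z0. split; auto. rewrite <- ev_0 by auto. auto. }
    exfalso.
    destruct (local_order G z0 HG Hn) as (s & g & Hg & Hg0 & E).
    { destruct Hc as [|Hc]; auto. right. simpl. intro X. apply Hc. now apply Ceq_minus. }
    assert (Hs : (0 < s)%nat).
    { destruct s; [|lia]. exfalso. apply Hg0.
      assert (X := EG z0). rewrite E in X. simpl in X.
      replace (ev g z0) with (ev H z0 + 1 * ev g z0 - ev H z0)%C by ring. rewrite <- X. ring. }
    destruct (descent_direction H g z0 s (rho - Cmod z0)) as (z & Hz1 & Hz2); auto; try lra.
    { intros z. now rewrite (EG z), E. }
    assert (Hz : Cmod z <= rho).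
    { replace z with (z0 + (z - z0))%C by ring. eapply Rle_trans; [apply Cmod_triangle|lra]. }
    specialize (Hm z Hz). lra.
  - exists (RtoC rho). split; [rewrite Cmod_R, Rabs_pos_eq; lra|].
    assert (Z : forall n, G n = 0) by (intro n; apply Classical_Prop.NNPP; intro; apply Hn; eauto).
    assert (Zz : forall z, ev G z = 0).
    { intros z. apply Cmod_eq_0. apply Rle_antisym; [|apply Cmod_ge_0].
      replace 0 with (Series (fun n => 0 * (/ 2) ^ n)) by (rewrite Series_geom_scal; lra).
      apply Cmod_Cser_le; [|apply ex_series_geom_scal; lra].
      intro n. rewrite Z, Cmult_0_l, Cmod_0. lra. }
    rewrite <- (ev_0 H), (EG rho), (EG 0), !Zz by auto. lra.
Qed.

(** * Lower Jensen bound and power sums of the zeros *)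

Lemma Cmod_linprod_circle (rho : R) (L : list C) (Q : nat -> C) (z : C) :
  entire Q -> 0 < rho -> (forall w, In w L -> w <> 0) -> Cmod z = rho ->
  Cmod (ev (linprod zf L Q) z) =
  exp (sumR (fun w => ln (rho / Cmod w)) L) * Cmod (ev (linprod (rf rho) L Q) z).
Proof.
  intros HQ Hr HL Hz. induction L as [|w L IH].
  - unfold sumR. simpl. rewrite exp_0. ring.
  - assert (Hw : w <> 0) by (apply HL; now left). assert (Hw' := Cmod_pos w Hw).
    change (linprod zf (w :: L) Q) with (lin (zf w) (linprod zf L Q)).
    change (linprod (rf rho) (w :: L) Q) with (lin (rf rho w) (linprod (rf rho) L Q)).
    rewrite !ev_lin, !Cmod_mult, IH by (auto using entire_linprod; intros; apply HL; now right).
    replace (sumR (fun w => ln (rho / Cmod w)) (w :: L)) with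
      (ln (rho / Cmod w) + sumR (fun w => ln (rho / Cmod w)) L) by (unfold sumR; simpl; ring).
    rewrite exp_plus, exp_ln by now apply Rdiv_lt_0_compat.
    assert (E : Cmod (1 + zf w * z) = rho / Cmod w * Cmod (1 + rf rho w * z)); [|rewrite E; ring].
    assert (Nr : RtoC rho <> 0) by (intro X; apply RtoC_inj in X; lra).
    apply Rmult_eq_reg_r with (rho * Cmod w); [|nra].
    replace (rho / Cmod w * Cmod (1 + rf rho w * z) * (rho * Cmod w)) with
      (Rabs (rho ^ 2) * Cmod (1 + rf rho w * z)) by (rewrite Rabs_pos_eq by nra; field; lra).
    rewrite <- Cmod_R, <- Cmod_mult.
    (* On the circle [rho^2 = conj z * z], so [rho^2 - conj w * z = (conj z - conj w) * z]. *)
    replace (RtoC (rho ^ 2) * (1 + rf rho w * z))%C with ((Cconj z - Cconj w) * z)%C.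
    2: { assert (Nr2 : RtoC (rho ^ 2) <> 0) by (intro X; apply RtoC_inj in X; nra).
         assert (E : (Cconj z * z)%C = RtoC (rho ^ 2)) by (rewrite <- Hz, Cmod2_conj; ring).
         unfold rf. replace (RtoC (rho ^ 2) * (1 + - (Cconj w / RtoC (rho ^ 2)) * z))%C with
           (RtoC (rho ^ 2) - Cconj w * z)%C by (field; auto).
         rewrite <- E. ring. }
    rewrite <- Cminus_conj, !Cmod_mult, Cmod_conj, Hz.
    replace (1 + zf w * z)%C with (- ((z - w) / w))%C by (unfold zf; field; auto).
    rewrite Cmod_opp, Cmod_div by auto. field. lra.
Qed.

(** A root would satisfy [|w| |z| = rho^2], impossible for [|w| < rho] and [|z| <= rho]: reflection
    moves the zero out of the closed disc. *)
Lemma rf_factor_nonzero (rho : R) (w z : C) : 0 < rho -> Cmod w < rho -> Cmod z <= rho ->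
  (1 + rf rho w * z)%C <> 0.
Proof.
  intros Hr Hw Hz X.
  assert (Nr : RtoC (rho ^ 2) <> 0) by (intro Y; apply RtoC_inj in Y; nra).
  assert (E : (Cconj w * z)%C = RtoC (rho ^ 2)).
  { apply Ceq_minus. unfold rf in X.
    replace (Cconj w * z - RtoC (rho ^ 2))%C with
      (- RtoC (rho ^ 2) * (1 + - (Cconj w / RtoC (rho ^ 2)) * z))%C by (field; auto).
    rewrite X. ring. }
  assert (E2 : Cmod w * Cmod z = rho ^ 2).
  { rewrite <- (Cmod_conj w), <- Cmod_mult, E, Cmod_R, Rabs_pos_eq; nra. }
  assert (X1 := Cmod_ge_0 w). assert (X2 := Cmod_ge_0 z). nra.
Qed.

(** With [s] the sum of logarithms, [|F| = e^s |H|] on the circle. The minimum principle provides a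
    point there with [|H| <= 1], whence [mu <= e^s]. Dividing the mean square of [F] by [e^(2s)]
    then bounds that of [H], hence each coefficient of [H]. *)
Lemma jensen_lower (F : nat -> C) (rho mu : R) (L : list C) (Q : nat -> C) :
  0 < rho -> 0 < mu -> factors F rho L Q ->
  (forall z, Cmod z < rho -> ev Q z <> 0) ->
  (forall z, Cmod z = rho -> mu <= Cmod (ev F z)) ->
  ln mu <= sumR (fun w => ln (rho / Cmod w)) L /\
  forall n, Cmod (linprod (rf rho) L Q n) * rho ^ n <= S1 F rho / mu.
Proof.
  intros Hr Hmu (HQ & HQ0 & HF & HL) HQz Hmin.
  assert (HL0 : forall w, In w L -> w <> 0) by (intros w Hw; now apply HL).
  assert (HH := entire_linprod (rf rho) L Q HQ).
  assert (HFe := entire_linprod zf L Q HQ).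
  assert (Hs : mu <= exp (sumR (fun w => ln (rho / Cmod w)) L)).
  { destruct (min_principle (linprod (rf rho) L Q) rho) as (z & Hz & Hz2); auto.
    - intros z Hz.
      (* Inside the disc this is the hypothesis on [Q]; on the circle a zero of [Q] would be one of
         [F], against [mu <= |F|]. *)
      assert (HQz' : ev Q z <> 0).
      { destruct Hz as [Hz|Hz]; [now apply HQz|]. intro X. specialize (Hmin z Hz).
        rewrite HF, (Cmod_linprod_circle rho) in Hmin by auto.
        assert (E : ev (linprod (rf rho) L Q) z = 0).
        { clear - X HQ. induction L as [|w L IH]; auto. 
          change (linprod (rf rho) (w :: L) Q) with (lin (rf rho w) (linprod (rf rho) L Q)).
          rewrite ev_lin, IH by auto using entire_linprod. ring. }
        rewrite E, Cmod_0 in Hmin. lra. }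
      clear - HQz' HQ HL Hz Hr. induction L as [|w L IH]; auto.
      change (linprod (rf rho) (w :: L) Q) with (lin (rf rho w) (linprod (rf rho) L Q)).
      rewrite ev_lin by auto using entire_linprod. apply Cmult_neq_0.
      + apply rf_factor_nonzero; auto. apply HL. now left.
      + apply IH. intros x Hx. apply HL. now right.
    - specialize (Hmin z Hz). rewrite HF, (Cmod_linprod_circle rho) in Hmin by auto.
      rewrite linprod_O, HQ0, Cmod_1 in Hz2.
      assert (X := exp_pos (sumR (fun w => ln (rho / Cmod w)) L)). nra. }
  split.
  - rewrite <- (ln_exp (sumR _ L)). now apply ln_le_mono.
  - intros n.
    assert (E := L2sq_linprod rho L Q HQ Hr HL0). rewrite <- HF in E, HFe.
    assert (H1 := L2sq_le_S1 rho F HFe (Rlt_le _ _ Hr)).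
    assert (H2 := L2sq_term_le rho _ n HH (Rlt_le _ _ Hr)).
    assert (H3 := S1_pos F rho HFe (Rlt_le _ _ Hr)).
    set (s := sumR (fun w => ln (rho / Cmod w)) L) in *.
    set (x := Cmod (linprod (rf rho) L Q n) * rho ^ n) in *.
    assert (Hx : 0 <= x) by (apply Rmult_le_pos; [apply Cmod_ge_0|apply pow_le; lra]).
    replace (2 * s) with (s + s) in E by ring. rewrite exp_plus in E.
    assert (Hxs : (mu * x) ^ 2 <= S1 F rho ^ 2).
    { eapply Rle_trans; [|exact H1]. rewrite E.
      apply Rle_trans with (exp s * exp s * x ^ 2).
      - rewrite Rpow_mult_distr. apply Rmult_le_compat_r; [apply pow2_ge_0|]. nra.
      - apply Rmult_le_compat_l; auto. assert (Y := exp_pos s). nra. }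
    assert (mu * x <= S1 F rho) by (apply Rnot_lt_le; intro; nra).
    apply Rmult_le_reg_r with mu; auto. unfold Rdiv. rewrite Rmult_assoc, Rinv_l; lra.
Qed.

Fixpoint Csum (u : nat -> C) (n : nat) : C :=
  match n with O => 0 | S m => (Csum u m + u m)%C end.

Lemma Csum_ext (u v : nat -> C) (n : nat) :
  (forall i, (i < n)%nat -> u i = v i) -> Csum u n = Csum v n.
Proof.
  induction n; intros H; auto. simpl. rewrite IHn, H by (auto; intros; apply H; lia). reflexivity.
Qed.

Lemma Csum_plus (u v : nat -> C) (n : nat) : Csum (fun i => u i + v i)%C n = (Csum u n + Csum v n)%C.
Proof. induction n; simpl; [ring|]. rewrite IHn. ring. Qed.

Lemma Csum_scal (k : C) (u : nat -> C) (n : nat) : Csum (fun i => k * u i)%C n = (k * Csum u n)%C.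
Proof. induction n; simpl; [ring|]. rewrite IHn. ring. Qed.

Lemma Csum_head (u : nat -> C) (n : nat) : Csum u (S n) = (u O + Csum (fun i => u (S i)) n)%C.
Proof. induction n; [simpl; ring|]. cbn [Csum] in *. rewrite IHn. ring. Qed.

Lemma Cmod_Csum_le (u : nat -> C) (K : R) (n : nat) :
  (forall i, (i < n)%nat -> Cmod (u i) <= K) -> Cmod (Csum u n) <= INR n * K.
Proof.
  induction n; intros H.
  - simpl. rewrite Cmod_0. lra.
  - cbn [Csum]. eapply Rle_trans; [apply Cmod_triangle|]. rewrite S_INR.
    assert (Cmod (Csum u n) <= INR n * K) by (apply IHn; intros; apply H; lia).
    assert (Cmod (u n) <= K) by (apply H; lia). lra.
Qed.

(* Newton's identities: [- z a'(z) = a(z) * sum_i p_i z^(i+1)], so that [p i] is the sum of the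
   [-(i+1)]-th powers of the zeros. *)
Definition power_sums (a p : nat -> C) : Prop :=
  forall n, Csum (fun i => p i * a (n - i)%nat)%C (S n) = (- (INR (S n) * a (S n)))%C.

(** Newton's recursion uses all earlier values, so stage [n] is a whole function, correct on the
    indices below [n] and unchanged there by later stages. *)
Fixpoint newton (a : nat -> C) (n : nat) : nat -> C :=
  match n with
  | O => fun _ => 0
  | S m => fun i => if Nat.eqb i m
      then (- (INR (S m) * a (S m)) - Csum (fun j => newton a m j * a (m - j)%nat) m)%C
      else newton a m i
  end.

Lemma newton_stable (a : nat -> C) (n i : nat) : (i < n)%nat -> newton a n i = newton a (S i) i.
Proof.
  induction n; intros H; [lia|].
  destruct (Nat.eq_dec i n) as [->|Hne]; auto.
  simpl newton at 1. apply Nat.eqb_neq in Hne as He. rewrite He. apply IHn. lia.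
Qed.

Lemma power_sums_exist (a : nat -> C) : a O = 1 -> exists p, power_sums a p.
Proof.
  intros H0. exists (fun i => newton a (S i) i). intros n. cbn [Csum].
  rewrite (Csum_ext _ (fun j => newton a n j * a (n - j)%nat)%C).
  2: { intros i Hi. now rewrite (newton_stable a n i). }
  rewrite Nat.sub_diag, H0. cbn [newton]. rewrite Nat.eqb_refl. ring.
Qed.

(** Logarithmic derivatives add, and [- b z / (1 + b z)] is the geometric series with terms
    [(- b)^(i+1) z^(i+1)]. The assertion [T] is that series multiplied by [(1 + b z) a]. *)
Lemma power_sums_lin (a p : nat -> C) (b : C) : power_sums a p ->
  power_sums (lin b a) (fun i => p i + (- b) ^ S i)%C.
Proof.
  intros H.
  assert (T : forall n, Csum (fun i => (- b) ^ S i * lin b a (n - i)%nat)%C (S n) = (- b * a n)%C).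
  { induction n.
    - simpl. ring.
    - rewrite Csum_head.
      rewrite (Csum_ext _ (fun i => - b * ((- b) ^ S i * lin b a (n - i)%nat))%C).
      + rewrite Csum_scal, IHn. replace (S n - 0)%nat with (S n) by lia. simpl lin. simpl Cpow. ring.
      + intros i Hi. rewrite Nat.sub_succ, (Cpow_S _ (S i)). ring. }
  intros n.
  rewrite (Csum_ext _ (fun i => p i * lin b a (n - i)%nat + (- b) ^ S i * lin b a (n - i)%nat)%C)
    by (intros; ring).
  rewrite Csum_plus, T. destruct n as [|m].
  - specialize (H O). simpl in *. 
    replace (0 + p O * a O)%C with (- (1 * a 1%nat))%C. ring.
  - cbn [Csum]. rewrite Nat.sub_diag. cbn [lin].
    rewrite (Csum_ext (fun i => p i * lin b a (S m - i)%nat)%C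
      (fun i => p i * a (S m - i)%nat + b * (p i * a (m - i)%nat))%C).
    2: { intros i Hi. replace (S m - i)%nat with (S (m - i)) by lia. simpl lin. ring. }
    assert (E1 := H (S m)). assert (E2 := H m).
    cbn [Csum] in E1, E2. rewrite Nat.sub_diag in E1, E2.
    rewrite Csum_plus, Csum_scal. replace (S m - m)%nat with 1%nat in * by lia. cbn [lin].
    set (U := Csum (fun i => p i * a (S m - i)%nat)%C m) in *.
    set (V := Csum (fun i => p i * a (m - i)%nat)%C m) in *.
    replace (U + b * V + p m * (a 1%nat + b * a O) + p (S m) * a O + - b * a (S m))%C with
      ((U + p m * a 1%nat + p (S m) * a O) + b * (V + p m * a O) - b * a (S m))%C by ring.
    rewrite E2.
    rewrite E1, (S_INR (S m)), RtoC_plus. ring.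
Qed.

Definition sumC (g : C -> C) (L : list C) : C := fold_right Cplus (RtoC 0) (map g L).

Lemma sumC_ext (f g : C -> C) (L : list C) :
  (forall z, In z L -> f z = g z) -> sumC f L = sumC g L.
Proof.
  unfold sumC. induction L; simpl; intros H; auto. rewrite IHL, H by auto. reflexivity.
Qed.

Lemma sumC_plus (f g : C -> C) (L : list C) : sumC (fun z => f z + g z)%C L = (sumC f L + sumC g L)%C.
Proof. unfold sumC. induction L; simpl; [ring|]. rewrite IHL. ring. Qed.

Lemma sumC_scal (k : C) (f : C -> C) (L : list C) : sumC (fun z => k * f z)%C L = (k * sumC f L)%C.
Proof. unfold sumC. induction L; simpl; [ring|]. rewrite IHL. ring. Qed.

Lemma Cmod_sumC_le (f : C -> C) (g : C -> R) (L : list C) :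
  (forall z, In z L -> Cmod (f z) <= g z) -> Cmod (sumC f L) <= sumR g L.
Proof.
  unfold sumC, sumR. induction L; simpl; intros H; [rewrite Cmod_0; lra|].
  eapply Rle_trans; [apply Cmod_triangle|]. apply Rplus_le_compat; auto.
Qed.

Lemma power_sums_linprod (g : C -> C) (L : list C) (Q p : nat -> C) : power_sums Q p ->
  power_sums (linprod g L Q) (fun i => p i + sumC (fun z => (- g z) ^ S i) L)%C.
Proof.
  intros H. induction L as [|w L IH].
  - intros n. change (linprod g nil Q) with Q. rewrite <- (H n). apply Csum_ext. intros. unfold sumC. simpl. ring.
  - intros n. change (linprod g (w :: L) Q) with (lin (g w) (linprod g L Q)).
    rewrite <- (power_sums_lin _ _ (g w) IH n). apply Csum_ext. intros. unfold sumC. simpl. ring.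
Qed.

(** By Newton's recursion [p i] is a fixed polynomial in the coefficients up to index [i + 1]. The
    bound 2 is one that both [D_c] and its reflected product satisfy. *)
Lemma power_sums_bound (n : nat) : exists K, forall a p : nat -> C, a O = 1 -> (forall i, Cmod (a i) <= 2) ->
  power_sums a p -> forall i, (i < n)%nat -> Cmod (p i) <= K.
Proof.
  induction n as [|n [K HK]].
  - exists 0. intros. lia.
  - exists (Rmax K (INR (S n) * 2 + INR n * (K * 2))). intros a p H0 Ha H i Hi.
    assert (HKi := HK a p H0 Ha H).
    destruct (Nat.eq_dec i n) as [->|Hne].
    + eapply Rle_trans; [|apply Rmax_r].
      specialize (H n). cbn [Csum] in H. rewrite Nat.sub_diag, H0 in H.
      replace (p n) with (- (INR (S n) * a (S n)) + - Csum (fun i => p i * a (n - i)%nat) n)%C.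
      2: { rewrite <- H. ring. }
      eapply Rle_trans; [apply Cmod_triangle|]. rewrite !Cmod_opp, Cmod_mult, Cmod_R.
      rewrite Rabs_pos_eq by apply pos_INR. apply Rplus_le_compat.
      * apply Rmult_le_compat_l; auto. apply pos_INR.
      * apply Cmod_Csum_le. intros j Hj. rewrite Cmod_mult.
        apply Rmult_le_compat; auto using Cmod_ge_0.
    + eapply Rle_trans; [|apply Rmax_l]. apply HKi. lia.
Qed.

Lemma pow_diff_le (u v : R) (m : nat) : 0 <= u <= 1 -> 0 <= v <= 1 ->
  Rabs (u ^ m - v ^ m) <= INR m * Rabs (u - v).
Proof.
  intros Hu Hv. induction m.
  - simpl. rewrite Rminus_diag, Rabs_R0. lra.
  - rewrite S_INR. replace (u ^ S m - v ^ S m) with (u * (u ^ m - v ^ m) + v ^ m * (u - v)) by (simpl; ring).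
    eapply Rle_trans; [apply Rabs_triang|]. rewrite !Rabs_mult.
    assert (Hvm : 0 <= v ^ m <= 1).
    { split; [apply pow_le; lra|]. rewrite <- (pow1 m). apply pow_incr. lra. }
    rewrite (Rabs_pos_eq u), (Rabs_pos_eq (v ^ m)) by lra.
    assert (A1 := Rabs_pos (u ^ m - v ^ m)). assert (A2 := Rabs_pos (u - v)). nra.
Qed.

(** The conjugate is taken because [z^-m] and [(conj z / rho^2)^m] are both positive multiples of
    [dir z ^ m], so that their difference is a real multiple of it. *)
Definition dir (z : C) : C := (Cconj z / RtoC (Cmod z))%C.

(** The two power sums share the contribution of [Q]; their difference is the sum of
    [h(|z|) * dir z ^ m]. Replacing [h(|z|)] by [h 4] costs a multiple of [||z| - 4|], and [h 4] is
    bounded away from 0. *)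
Lemma angular_sums (m : nat) : (0 < m)%nat -> exists K, 0 < K /\
  forall F rho L Q, factors F rho L Q -> 6 <= rho ->
  (forall i, Cmod (F i) <= 2) -> (forall i, Cmod (linprod (rf rho) L Q i) <= 2) ->
  (forall z, In z L -> 2 <= Cmod z) ->
  Cmod (sumC (fun z => dir z ^ m)%C L) <= K * (1 + sumR (fun z => Rabs (Cmod z - 4)) L).
Proof.
  intros Hm. destruct (power_sums_bound m) as [K0 HK0].
  set (K1 := Rabs K0).
  (* [2 * 4^m] inverts the lower bound for [h 4], [2 * K1] bounds the difference of two power sums,
     and [2 * INR m] is a Lipschitz constant for [h] at 4 on [[2, rho]]. *)
  exists (2 * 4 ^ m * (2 * K1 + 2 * INR m) + 1). assert (HK1 := Rabs_pos K0). fold K1 in HK1.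
  assert (H4m : 0 < 4 ^ m) by (apply pow_lt; lra). assert (Hm0 := pos_INR m).
  split. { assert (0 <= 2 * 4 ^ m * (2 * K1 + 2 * INR m)) by (apply Rmult_le_pos; lra). lra. }
  intros F rho L Q (HQ & HQ0 & HF & HL) Hrho HFb HHb HL2.
  destruct (power_sums_exist Q HQ0) as [p Hp].
  assert (P1 := power_sums_linprod zf L Q p Hp). assert (P2 := power_sums_linprod (rf rho) L Q p Hp).
  rewrite <- HF in P1.
  assert (F0 : F O = 1) by (rewrite HF, linprod_O; auto).
  assert (H0 : linprod (rf rho) L Q O = 1) by (rewrite linprod_O; auto).
  (* Index [pred m], because entry [i] is the power sum of exponent [i + 1]. *)
  assert (B1 := HK0 _ _ F0 HFb P1 (pred m) ltac:(lia)).
  assert (B2 := HK0 _ _ H0 HHb P2 (pred m) ltac:(lia)).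
  cbv beta in B1, B2. replace (S (pred m)) with m in B1, B2 by lia.
  set (h := fun x : R => (/ x) ^ m - (x / rho ^ 2) ^ m).
  assert (Hdiff : (sumC (fun z => (- zf z) ^ m) L - sumC (fun z => (- rf rho z) ^ m) L)%C =
    sumC (fun z => RtoC (h (Cmod z)) * dir z ^ m)%C L).
  { replace (sumC (fun z => (- zf z) ^ m) L - sumC (fun z => (- rf rho z) ^ m) L)%C with
      (sumC (fun z => (- zf z) ^ m) L + (- (1)) * sumC (fun z => (- rf rho z) ^ m) L)%C by ring.
    rewrite <- sumC_scal, <- sumC_plus. apply sumC_ext. intros z Hz.
    assert (Hz2 := HL2 z Hz).
    assert (Nz : RtoC (Cmod z) <> 0) by (intro X; apply RtoC_inj in X; lra).
    assert (Nz' : z <> 0) by now apply HL.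
    assert (Nr : RtoC (rho ^ 2) <> 0) by (intro X; apply RtoC_inj in X; nra).
    assert (E1 : (- zf z)%C = (RtoC (/ Cmod z) * dir z)%C).
    { unfold zf, dir. rewrite RtoC_inv by lra.
      assert (Hc : (Cconj z = RtoC (Cmod z) * RtoC (Cmod z) / z)%C).
      { rewrite <- RtoC_mult. replace (Cmod z * Cmod z) with (Cmod z ^ 2) by ring.
        rewrite Cmod2_conj. field. auto. }
      rewrite Hc. field. auto. }
    assert (E2 : (- rf rho z)%C = (RtoC (Cmod z / rho ^ 2) * dir z)%C).
    { unfold rf, dir. rewrite RtoC_div by nra. field. auto. }
    rewrite E1, E2, !Cpow_mult_l, <- !RtoC_pow. unfold h. rewrite RtoC_minus. ring. }
  assert (Hb : Cmod (sumC (fun z => RtoC (h (Cmod z)) * dir z ^ m)%C L) <= 2 * K1).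
  { rewrite <- Hdiff.
    replace (sumC (fun z => (- zf z) ^ m) L - sumC (fun z => (- rf rho z) ^ m) L)%C with
     ((p (pred m) + sumC (fun z => (- zf z) ^ m) L) + - (p (pred m) + sumC (fun z => (- rf rho z) ^ m) L))%C by ring.
    eapply Rle_trans; [apply Cmod_triangle|]. rewrite Cmod_opp.
    assert (X := Rle_abs K0). fold K1 in X. lra. }
  assert (Hdir : forall z, In z L -> Cmod (dir z ^ m) = 1).
  { intros z Hz. assert (Hz2 := HL2 z Hz). unfold dir.
    assert (Nz : RtoC (Cmod z) <> 0) by (intro X; apply RtoC_inj in X; lra).
    rewrite Cmod_pow, Cmod_div, Cmod_conj, Cmod_R, Rabs_pos_eq by (auto; lra).
    unfold Rdiv. rewrite Rinv_r by lra. apply pow1. }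
  set (Y := sumR (fun z => Rabs (Cmod z - 4)) L).
  assert (Hh : forall x, 2 <= x <= rho -> Rabs (h x - h 4) <= 2 * INR m * Rabs (x - 4)).
  { intros x Hx. unfold h.
    replace ((/ x) ^ m - (x / rho ^ 2) ^ m - ((/ 4) ^ m - (4 / rho ^ 2) ^ m)) with
      (((/ x) ^ m - (/ 4) ^ m) + - ((x / rho ^ 2) ^ m - (4 / rho ^ 2) ^ m)) by ring.
    eapply Rle_trans; [apply Rabs_triang|]. rewrite Rabs_Ropp.
    assert (Hr2 : 36 <= rho ^ 2) by nra.
    assert (Q1 : forall t, 0 <= t <= rho -> 0 <= t / rho ^ 2 <= 1).
    { intros t Ht. split.
      - apply Rmult_le_pos; [lra|]. apply Rlt_le, Rinv_0_lt_compat. lra.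
      - apply Rmult_le_reg_r with (rho ^ 2); [lra|]. unfold Rdiv. rewrite Rmult_assoc, Rinv_l; nra. }
    assert (I1 : 0 <= / x <= 1).
    { split; [apply Rlt_le, Rinv_0_lt_compat; lra|]. rewrite <- Rinv_1. apply Rinv_le_contravar; lra. }
    assert (D1 := pow_diff_le (/ x) (/ 4) m I1 ltac:(lra)).
    assert (D2 := pow_diff_le (x / rho ^ 2) (4 / rho ^ 2) m (Q1 x ltac:(lra)) (Q1 4 ltac:(lra))).
    assert (A := Rabs_pos (x - 4)).
    assert (R1 : Rabs (/ x - / 4) <= Rabs (x - 4)).
    { replace (/ x - / 4) with (- ((x - 4) * (/ x * / 4))) by (field; lra).
      rewrite Rabs_Ropp, Rabs_mult, (Rabs_pos_eq (/ x * / 4)) by nra. nra. }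
    assert (R2 : Rabs (x / rho ^ 2 - 4 / rho ^ 2) <= Rabs (x - 4)).
    { replace (x / rho ^ 2 - 4 / rho ^ 2) with ((x - 4) * (1 / rho ^ 2)) by (field; lra).
      specialize (Q1 1 ltac:(lra)). rewrite Rabs_mult, (Rabs_pos_eq (1 / rho ^ 2)) by lra. nra. }
    assert (INR m * Rabs (/ x - / 4) <= INR m * Rabs (x - 4)) by (apply Rmult_le_compat_l; auto).
    assert (INR m * Rabs (x / rho ^ 2 - 4 / rho ^ 2) <= INR m * Rabs (x - 4)) by (apply Rmult_le_compat_l; auto).
    lra. }
  (* [rho >= 6] gives [4 / rho^2 <= 1/8], so the reflected term is at most [8^-m], half of [4^-m] or
     less. *)
  assert (H4 : / (2 * 4 ^ m) <= h 4).
  { unfold h. assert ((4 / rho ^ 2) ^ m <= (/ 8) ^ m).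
    { apply pow_incr. assert (Hr2 : 36 <= rho ^ 2) by nra. split.
      - apply Rmult_le_pos; [lra|]. apply Rlt_le, Rinv_0_lt_compat. lra.
      - apply Rmult_le_reg_r with (rho ^ 2); [lra|]. unfold Rdiv. rewrite Rmult_assoc, Rinv_l; lra. }
    assert ((/ 8) ^ m <= / 2 * (/ 4) ^ m).
    { replace (/ 8) with (/ 2 * / 4) by lra. rewrite Rpow_mult_distr.
      apply Rmult_le_compat_r; [apply pow_le; lra|]. destruct m as [|k]; [lia|]. simpl.
      assert ((/ 2) ^ k <= 1) by (rewrite <- (pow1 k); apply pow_incr; lra). lra. }
    replace (/ (2 * 4 ^ m)) with (/ 2 * (/ 4) ^ m) by (rewrite pow_inv; field; lra).
    lra. }
  assert (Hmain : h 4 * Cmod (sumC (fun z => dir z ^ m)%C L) <= 2 * K1 + 2 * INR m * Y).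
  { assert (0 < / (2 * 4 ^ m)) by (apply Rinv_0_lt_compat; lra).
    rewrite <- (Rabs_pos_eq (h 4)) by lra. rewrite <- Cmod_R, <- Cmod_mult, <- sumC_scal.
    replace (sumC (fun z => RtoC (h 4%R) * dir z ^ m)%C L) with
      (sumC (fun z => RtoC (h (Cmod z)) * dir z ^ m)%C L +
       sumC (fun z => RtoC (h 4%R - h (Cmod z)) * dir z ^ m)%C L)%C.
    2: { rewrite <- sumC_plus. apply sumC_ext. intros. rewrite RtoC_minus. ring. }
    eapply Rle_trans; [apply Cmod_triangle|]. apply Rplus_le_compat; auto.
    unfold Y. rewrite <- sumR_scal. apply Cmod_sumC_le. intros z Hz.
    rewrite Cmod_mult, Hdir, Cmod_R, Rmult_1_r, Rabs_minus_sym by auto.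
    apply Hh. split; auto. apply Rlt_le. now apply HL. }
  assert (HY : 0 <= Y).
  { unfold Y. replace 0 with (sumR (fun _ => 0) L) by (rewrite sumR_const; ring).
    apply sumR_le. intros. apply Rabs_pos. }
  set (T := Cmod (sumC (fun z => dir z ^ m)%C L)) in *.
  assert (HT : 0 <= T) by apply Cmod_ge_0.
  assert (T <= 2 * 4 ^ m * (2 * K1 + 2 * INR m * Y)).
  { assert (/ (2 * 4 ^ m) * T <= 2 * K1 + 2 * INR m * Y).
    { eapply Rle_trans; [|exact Hmain]. now apply Rmult_le_compat_r. }
    apply Rmult_le_reg_l with (/ (2 * 4 ^ m)); [apply Rinv_0_lt_compat; lra|].
    rewrite <- Rmult_assoc, Rinv_l by lra. lra. }
  assert (0 <= 4 ^ m * (K1 * Y)) by (apply Rmult_le_pos; [lra|now apply Rmult_le_pos]).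
  assert (0 <= 4 ^ m * INR m) by (apply Rmult_le_pos; lra).
  nra.
Qed.

(** * The critical orbit and the coefficients of D_c *)

(** Reverse triangle inequality with the term [M] set against the sum of all others; the induction
    peels off the head. *)
Lemma Cmod_Cser_ge (u : nat -> C) (M : nat) : abs_summable u ->
  2 * Cmod (u M) - Series (fun n => Cmod (u n)) <= Cmod (Cser u).
Proof.
  revert u. induction M; intros u Hu; assert (Hu1 := abs_summable_incr_1 u Hu);
    rewrite (Series_incr_1 (fun n => Cmod (u n))), (Cser_incr_1 u) by auto.
  - assert (X := Cmod_Cser_le _ _ (fun n => Rle_refl (Cmod (u (S n)))) Hu1).
    assert (T : Cmod (u O) <= Cmod (u O + Cser (fun n => u (S n)))%C + Cmod (Cser (fun n => u (S n)))).
    { rewrite <- (Cmod_opp (Cser _)).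
      replace (u O) with ((u O + Cser (fun n => u (S n))) + - Cser (fun n => u (S n)))%C at 1 by ring.
      apply Cmod_triangle. }
    lra.
  - specialize (IHM _ Hu1). cbv beta in IHM.
    assert (T : Cmod (Cser (fun n => u (S n))) <= Cmod (u O + Cser (fun n => u (S n)))%C + Cmod (u O)).
    { rewrite <- (Cmod_opp (u O)).
      replace (Cser (fun n => u (S n))) with ((u O + Cser (fun n => u (S n))) + - u O)%C at 1 by ring.
      apply Cmod_triangle. }
    lra.
Qed.

Lemma Series_geometric_tail (x : nat -> R) (q : R) : 0 <= q < 1 -> (forall n, 0 <= x n) ->
  (forall n, x (S n) <= q * x n) -> Series x <= x O / (1 - q).
Proof.
  intros Hq H0 H. rewrite <- Series_geom_scal by auto.
  apply Series_le; [|now apply ex_series_geom_scal].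
  intros n. split; auto. induction n.
  - simpl. lra.
  - eapply Rle_trans; [apply H|]. simpl.
    replace (x O * (q * q ^ n)) with (q * (x O * q ^ n)) by ring. apply Rmult_le_compat_l; lra.
Qed.

(** Two geometric series descend from the peak [x M]: [1/(1-q)] to the right, at most [q/(1-q)] to
    the left. *)
Lemma Series_peak (M : nat) (x : nat -> R) (q : R) : 0 <= q < 1 -> ex_series x -> (forall n, 0 <= x n) ->
  (forall n, (n < M)%nat -> x n <= q * x (S n)) -> (forall n, (M <= n)%nat -> x (S n) <= q * x n) ->
  Series x <= x M * ((1 + q) / (1 - q)).
Proof.
  intros Hq. 
  (* Stated with the exact finite sum on the left, [(q - q^(M+1))/(1-q)], and with a bound for
     [x O], so that shifting the sequence closes the induction. *)
  assert (Hmain : forall M x, ex_series x -> (forall n, 0 <= x n) ->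
    (forall n, (n < M)%nat -> x n <= q * x (S n)) -> (forall n, (M <= n)%nat -> x (S n) <= q * x n) ->
    x O <= q ^ M * x M /\ Series x <= x M * ((1 + q - q ^ S M) / (1 - q))).
  { clear M x. induction M; intros x Hx H0 Hup Hdown.
    - split; [simpl; lra|]. replace ((1 + q - q ^ 1) / (1 - q)) with (/ (1 - q)) by (field; lra).
      apply Series_geometric_tail; auto. intros; apply Hdown; lia.
    - assert (Hx1 : ex_series (fun n => x (S n))) by (apply (ex_series_incr_1 x); exact Hx).
      destruct (IHM (fun n => x (S n))) as [I1 I2]; auto.
      { intros; apply Hup; lia. } { intros; apply Hdown; lia. }
      assert (A : x O <= q ^ S M * x (S M)).
      { eapply Rle_trans; [apply Hup; lia|]. simpl. rewrite Rmult_assoc. apply Rmult_le_compat_l; lra. }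
      split; auto. rewrite Series_incr_1 by auto.
      replace (x (S M) * ((1 + q - q ^ S (S M)) / (1 - q))) with
        (q ^ S M * x (S M) + x (S M) * ((1 + q - q ^ S M) / (1 - q))) by (simpl; field; lra).
      lra. }
  intros Hx H0 Hup Hdown. destruct (Hmain M x Hx H0 Hup Hdown) as [_ H].
  eapply Rle_trans; [exact H|]. apply Rmult_le_compat_l; auto.
  apply Rmult_le_compat_r; [apply Rlt_le, Rinv_0_lt_compat; lra|].
  assert (0 <= q ^ S M) by (apply pow_le; lra). lra.
Qed.

Lemma Series_plateau (M : nat) (x : nat -> R) : ex_series x -> (forall n, 0 <= x n <= 1) ->
  (forall n, (M <= n)%nat -> x (S n) <= / 2 * x n) -> Series x <= INR M + 2.
Proof.
  revert x. induction M; intros x Hx H0 Hdown.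
  - assert (X := Series_geometric_tail x (/ 2) ltac:(lra) (fun n => proj1 (H0 n)) (fun n => Hdown n ltac:(lia))).
    destruct (H0 O). simpl. lra.
  - rewrite Series_incr_1, S_INR by auto.
    assert (X : Series (fun n => x (S n)) <= INR M + 2).
    { apply IHM; auto. - apply (ex_series_incr_1 x); exact Hx. - intros; apply Hdown; lia. }
    destruct (H0 O). lra.
Qed.

(** With [|r| = 2 + e] the next excess is [4 e + e^2 + (c + 2)], and [e >= - c - 2] absorbs the
    negative last term into one [e]. *)
Lemma r_excess (c : R) (n : nat) : c < -2 -> - c - 2 <= Rabs (r c (S n)) - 2 /\
  3 * (Rabs (r c (S n)) - 2) <= Rabs (r c (S (S n))) - 2 /\ 0 < r c (S (S n)).
Proof.
  intros Hc. 
  assert (Hbase : - c - 2 <= Rabs (r c (S n)) - 2).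
  { induction n.
    - simpl. rewrite Rabs_left; nra.
    - change (r c (S (S n))) with (r c (S n) ^ 2 + c). rewrite <- pow2_abs.
      rewrite Rabs_pos_eq; nra. }
  split; auto. change (r c (S (S n))) with (r c (S n) ^ 2 + c). rewrite <- pow2_abs.
  rewrite (Rabs_pos_eq (_ + c)) by nra. nra.
Qed.

Lemma r_mono (c : R) (i j : nat) : c < -2 -> (1 <= i <= j)%nat -> Rabs (r c i) <= Rabs (r c j).
Proof.
  intros Hc [Hi Hij]. induction Hij; [lra|].
  destruct m as [|m]; [lia|]. destruct (r_excess c m Hc) as (H1 & H2 & _). lra.
Qed.

Lemma r_ge_2 (c : R) (n : nat) : c < -2 -> 2 < Rabs (r c (S n)).
Proof. intros Hc. destruct (r_excess c n Hc) as (H & _). lra. Qed.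

Lemma r_unbounded (c B : R) : c < -2 -> exists N, forall n, (N <= n)%nat -> B <= Rabs (r c (S n)).
Proof.
  intros Hc.
  assert (G : forall n, (- c - 2) * (1 + INR n) <= Rabs (r c (S n)) - 2).
  { induction n.
    - simpl INR. destruct (r_excess c 0 Hc). lra.
    - rewrite S_INR. destruct (r_excess c n Hc) as (H1 & H2 & _). nra. }
  destruct (INR_unbounded (B / (- c - 2))) as [N HN]. exists N. intros n Hn.
  specialize (G n). apply le_INR in Hn.
  assert (B <= (- c - 2) * INR n).
  { replace B with ((- c - 2) * (B / (- c - 2))) by (field; lra). apply Rmult_le_compat_l; lra. }
  lra.
Qed.

Definition Dc (c : R) (n : nat) : C := RtoC (Dcoef c n).

Lemma Dcoef_ratio (c : R) (n : nat) : c < -2 ->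
  Rabs (Dcoef c n) = 2 * Rabs (r c (S n)) * Rabs (Dcoef c (S n)).
Proof.
  intros Hc. unfold Dcoef. cbn [rprod].
  assert (Hr := r_ge_2 c n Hc).
  assert (Hr0 : r c (S n) <> 0) by (intro X; rewrite X, Rabs_R0 in Hr; lra).
  assert (Hp : rprod c n <> 0).
  { clear Hr Hr0. induction n; simpl rprod; [lra|]. apply Rmult_integral_contrapositive. split; auto.
    assert (X := r_ge_2 c n Hc). intro Y. change (r c (S n) = 0) in Y. rewrite Y, Rabs_R0 in X. lra. }
  rewrite <- (Rabs_pos_eq 2) at 2 by lra. rewrite <- !Rabs_mult. f_equal.
  assert (2 ^ n <> 0) by (apply pow_nonzero; lra). cbn [pow]. field. auto.
Qed.

Lemma Dcoef_pos (c : R) (n : nat) : c < -2 -> 0 < Rabs (Dcoef c n).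
Proof.
  intros Hc. induction n.
  - unfold Dcoef. simpl. rewrite Rabs_pos_eq; lra.
  - rewrite (Dcoef_ratio c n Hc) in IHn. assert (X := r_ge_2 c n Hc).
    assert (Y := Rabs_pos (Dcoef c (S n))). nra.
Qed.

Lemma Dcoef_step (c rho q : R) (n : nat) : c < -2 -> 0 < rho -> rho <= q * (2 * Rabs (r c (S n))) ->
  Rabs (Dcoef c (S n)) * rho ^ S n <= q * (Rabs (Dcoef c n) * rho ^ n).
Proof.
  intros Hc Hr H. rewrite (Dcoef_ratio c n Hc).
  assert (Y := Dcoef_pos c (S n) Hc). assert (Z : 0 < rho ^ n) by now apply pow_lt.
  replace (Rabs (Dcoef c (S n)) * rho ^ S n) with (rho * (Rabs (Dcoef c (S n)) * rho ^ n)) by (simpl; ring).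
  replace (q * (2 * Rabs (r c (S n)) * Rabs (Dcoef c (S n)) * rho ^ n)) with
    (q * (2 * Rabs (r c (S n))) * (Rabs (Dcoef c (S n)) * rho ^ n)) by ring.
  apply Rmult_le_compat_r; auto. apply Rlt_le, Rmult_lt_0_compat; auto.
Qed.

Lemma Dcoef_step_up (c rho q : R) (n : nat) : c < -2 -> 0 < rho -> 2 * Rabs (r c (S n)) <= q * rho ->
  Rabs (Dcoef c n) * rho ^ n <= q * (Rabs (Dcoef c (S n)) * rho ^ S n).
Proof.
  intros Hc Hr H. rewrite (Dcoef_ratio c n Hc).
  assert (Y := Dcoef_pos c (S n) Hc). assert (Z : 0 < rho ^ n) by now apply pow_lt.
  replace (q * (Rabs (Dcoef c (S n)) * rho ^ S n)) with (q * rho * (Rabs (Dcoef c (S n)) * rho ^ n)) by (simpl; ring).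
  rewrite (Rmult_assoc _ (Rabs _)).
  apply Rmult_le_compat_r; auto. apply Rlt_le, Rmult_lt_0_compat; auto.
Qed.

Lemma Cmod_Dc (c : R) (n : nat) : Cmod (Dc c n) = Rabs (Dcoef c n).
Proof. apply Cmod_R. Qed.

Lemma Dc_0 (c : R) : Dc c O = 1.
Proof. unfold Dc, Dcoef. simpl. now rewrite Rmult_1_r, Rinv_1. Qed.

(** Once [2 |r_{n+1}| >= B] the terms [|a_n| B^n] no longer increase, so the finitely many earlier
    ones give the bound. *)
Lemma entire_Dc (c : R) : c < -2 -> entire (Dc c).
Proof.
  intros Hc B HB. destruct (r_unbounded c (B / 2) Hc) as [N HN].
  assert (Hinit : exists K, forall n, (n <= N)%nat -> Rabs (Dcoef c n) * B ^ n <= K).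
  { clear HN. induction N as [|N [K HK]].
    - exists (Rabs (Dcoef c 0) * B ^ 0). intros n Hn. replace n with O by lia. lra.
    - exists (Rmax K (Rabs (Dcoef c (S N)) * B ^ S N)). intros n Hn.
      destruct (Nat.eq_dec n (S N)) as [->|Hne]; [apply Rmax_r|].
      eapply Rle_trans; [apply HK; lia|apply Rmax_l]. }
  destruct Hinit as [K HK]. exists K. intros n. rewrite Cmod_Dc.
  destruct (Nat.le_gt_cases n N) as [Hn|Hn]; auto.
  induction n; [lia|].
  assert (Rabs (Dcoef c n) * B ^ n <= K).
  { destruct (Nat.eq_dec n N) as [->|Hne]; [apply HK; lia|]. apply IHn; lia. }
  eapply Rle_trans; [apply (Dcoef_step c B 1 n Hc HB)|lra].
  specialize (HN n ltac:(lia)). lra.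
Qed.

(** The ratio of successive terms at radius 4 is [4 / (2 |r_{n+1}|)], less than 1 since the orbit
    stays beyond 2. *)
Lemma Dcoef_le_4 (c : R) (n : nat) : c < -2 -> Rabs (Dcoef c n) * 4 ^ n <= 1.
Proof.
  intros Hc. induction n.
  - unfold Dcoef. simpl. rewrite Rabs_pos_eq; lra.
  - eapply Rle_trans; [apply (Dcoef_step c 4 1 n Hc)|lra]; [lra|]. assert (X := r_ge_2 c n Hc). lra.
Qed.

(** A step multiplies by [2/a >= exp (- (a - 2)/2)] where [a = |r_{n+1}|]. As the excesses at least
    triple, all of them together are at most 3/2 of the last one, and [1/2 * 3/2 = 3/4]. *)
Lemma Dcoef_lower (c : R) (n : nat) : c < -2 ->
  exp (- (3 / 4 * (Rabs (r c (S n)) - 2))) <= Rabs (Dcoef c (S n)) * 4 ^ S n.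
Proof.
  intros Hc.
  assert (St : forall n, exp (- (1 / 2 * (Rabs (r c (S n)) - 2))) * (Rabs (Dcoef c n) * 4 ^ n)
    <= Rabs (Dcoef c (S n)) * 4 ^ S n).
  { clear n. intros n. rewrite (Dcoef_ratio c n Hc). assert (X := r_ge_2 c n Hc).
    assert (Y := Dcoef_pos c (S n) Hc). assert (Z : 0 < 4 ^ n) by (apply pow_lt; lra).
    set (a := Rabs (r c (S n))) in *.
    replace (Rabs (Dcoef c (S n)) * 4 ^ S n) with (2 / a * (2 * a * Rabs (Dcoef c (S n)) * 4 ^ n)) by (simpl; field; lra).
    apply Rmult_le_compat_r; [repeat apply Rmult_le_pos; lra|].
    rewrite exp_Ropp. replace (2 / a) with (/ (a / 2)) by (field; lra).
    apply Rinv_le_contravar; [lra|].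
    eapply Rle_trans; [|apply exp_ineq1_le]. lra. }
  induction n.
  - eapply Rle_trans; [|apply St]. 
    replace (Rabs (Dcoef c 0) * 4 ^ 0) with 1.
    2: { unfold Dcoef. simpl. rewrite Rabs_pos_eq; lra. }
    rewrite Rmult_1_r.
    assert (X := r_ge_2 c 0 Hc).
    destruct (Req_dec (- (3 / 4 * (Rabs (r c 1) - 2))) (- (1 / 2 * (Rabs (r c 1) - 2)))) as [E|E]; [rewrite E; lra|].
    left. apply exp_increasing. lra.
  - eapply Rle_trans; [|apply St].
    apply Rle_trans with (exp (- (1 / 2 * (Rabs (r c (S (S n))) - 2))) * exp (- (3 / 4 * (Rabs (r c (S n)) - 2)))).
    + rewrite <- exp_plus. destruct (r_excess c n Hc) as (H1 & H2 & _).
      match goal with |- exp ?a <= exp ?b => assert (Hab : a <= b) by lra; destruct Hab as [Hab|Hab] end.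
      * left. now apply exp_increasing.
      * rewrite Hab. lra.
    + apply Rmult_le_compat_l; auto. apply Rlt_le, exp_pos.
Qed.

(** At [c = -2] the orbit stays in [[-2, 2]], and each iterate is continuous in [c]. The escape
    index is therefore as late as desired for [c] near [-2]. *)
Lemma r_near (N : nat) : exists delta, 0 < delta <= 1 /\
  forall c, -2 - delta < c < -2 -> forall n, (n <= N)%nat -> r c n < 100.
Proof.
  assert (Hc : forall n, continuity_pt (fun c => r c n) (-2)).
  { induction n.
    - apply continuity_pt_const. intros x y. reflexivity.
    - change (fun c => r c (S n)) with (fun c => r c n ^ 2 + c).
      apply (continuity_pt_plus (fun c => r c n ^ 2) (fun c => c)).
      + apply continuity_pt_ext with (fun c => r c n * r c n); [intros; ring|].
        now apply (continuity_pt_mult (fun c => r c n) (fun c => r c n)).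
      + apply derivable_continuous_pt, derivable_pt_id. }
  assert (H2 : forall n, -2 <= r (-2) n <= 2).
  { induction n; simpl; [lra|]. nra. }
  assert (Hone : forall n, exists d, 0 < d /\ forall c, -2 - d < c < -2 -> r c n < 100).
  { intros n. destruct (Hc n 1 ltac:(lra)) as (d & Hd & Hd'). exists d. split; auto.
    intros c Hcd. specialize (Hd' c). simpl in Hd'. unfold D_x, no_cond, Rdist in Hd'.
    assert (X : Rabs (r c n - r (-2) n) < 1).
    { apply Hd'. repeat split; [lra|]. rewrite Rabs_left; lra. }
    apply Rabs_def2 in X. specialize (H2 n). lra. }
  induction N as [|N (d & Hd & IH)].
  - destruct (Hone O) as (d & Hd & H). exists (Rmin d 1). split.
    + split; [apply Rmin_pos; lra|apply Rmin_r].
    + intros c Hcd n Hn. replace n with O by lia. apply H. assert (X := Rmin_l d 1). lra.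
  - destruct (Hone (S N)) as (d' & Hd' & H). exists (Rmin d d').
    assert (X := Rmin_l d d'). assert (Y := Rmin_r d d'). split.
    + split; [apply Rmin_pos; lra|lra].
    + intros c Hcd n Hn. destruct (Nat.eq_dec n (S N)) as [->|Hne]; [apply H; lra|].
      apply IH; [lra|lia].
Qed.

Lemma escape_time (c : R) : c < -2 -> exists M, 100 <= r c M /\ forall n, (n < M)%nat -> r c n < 100.
Proof.
  intros Hc.
  assert (Hex : exists n, 100 <= r c n).
  { destruct (r_unbounded c 100 Hc) as [N HN]. exists (S (S N)).
    specialize (HN (S N) ltac:(lia)). destruct (r_excess c N Hc) as (_ & _ & H).
    rewrite Rabs_pos_eq in HN; lra. }
  destruct Hex as [n Hn]. induction n as [n IH] using lt_wf_ind.
  destruct (excluded_middle_informative (exists k, (k < n)%nat /\ 100 <= r c k)) as [(k & H1 & H2)|Hno].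
  - eauto.
  - exists n. split; auto. intros k Hk. apply Rnot_le_lt. intro. apply Hno. eauto.
Qed.

(** The n-th term is at most [(|z|/4)^n], so for [|z| < 2] the constant term 1 outweighs the others.
    It keeps the logarithms and inverses of the moduli bounded. *)
Lemma ev_Dc_nonzero (c : R) (z : C) : c < -2 -> Cmod z < 2 -> ev (Dc c) z <> 0.
Proof.
  intros Hc Hz X. assert (Hs := ev_summable (Dc c) z (entire_Dc c Hc)).
  assert (Y := Cmod_Cser_ge _ 0 Hs). fold (ev (Dc c) z) in Y. rewrite X, Cmod_0, Dc_0 in Y.
  replace (1 * z ^ 0)%C with (RtoC 1) in Y by (simpl; ring). rewrite Cmod_1 in Y.
  assert (Z := Cmod_ge_0 z).
  assert (W : Series (fun n => Cmod (Dc c n * z ^ n)%C) <= 1 / (1 - Cmod z / 4)).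
  { rewrite <- Series_geom_scal by lra. apply Series_le; [|apply ex_series_geom_scal; lra].
    intros n. split; [apply Cmod_ge_0|]. rewrite Cmod_mult, Cmod_pow, Cmod_Dc.
    assert (V := Dcoef_le_4 c n Hc).
    replace (Cmod z ^ n) with (4 ^ n * (Cmod z / 4) ^ n) by (rewrite <- Rpow_mult_distr; f_equal; field).
    rewrite <- Rmult_assoc. apply Rmult_le_compat_r; auto. apply pow_le. lra. }
  assert (1 / (1 - Cmod z / 4) < 2).
  { apply Rmult_lt_reg_r with (1 - Cmod z / 4); [lra|]. unfold Rdiv at 1. rewrite Rmult_assoc, Rinv_l; lra. }
  lra.
Qed.

(** * Moduli of the zeros *)

Lemma S1_Dc_peak (c rho q : R) (M : nat) : c < -2 -> 0 < rho -> 0 <= q < 1 ->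
  (forall n, (n < M)%nat -> 2 * Rabs (r c (S n)) <= q * rho) ->
  (forall n, (M <= n)%nat -> rho <= q * (2 * Rabs (r c (S n)))) ->
  S1 (Dc c) rho <= Rabs (Dcoef c M) * rho ^ M * ((1 + q) / (1 - q)).
Proof.
  intros Hc Hr Hq Hup Hdown. unfold S1.
  rewrite (Series_ext _ (fun n => Rabs (Dcoef c n) * rho ^ n)) by (intro; now rewrite Cmod_Dc).
  apply (Series_peak M (fun n => Rabs (Dcoef c n) * rho ^ n)); auto.
  - apply (ex_series_ext (fun n => Cmod (Dc c n) * rho ^ n)); [intro; now rewrite Cmod_Dc|].
    apply entire_ex_series; [now apply entire_Dc|lra].
  - intros n. apply Rmult_le_pos; [apply Rabs_pos|apply pow_le; lra].
  - intros n Hn. now apply Dcoef_step_up; auto.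
  - intros n Hn. now apply Dcoef_step; auto.
Qed.

Lemma Cmod_ev_Dc_lower (c rho : R) (M : nat) (z : C) : c < -2 -> Cmod z = rho ->
  2 * (Rabs (Dcoef c M) * rho ^ M) - S1 (Dc c) rho <= Cmod (ev (Dc c) z).
Proof.
  intros Hc Hz. assert (X := Cmod_Cser_ge _ M (ev_summable (Dc c) z (entire_Dc c Hc))).
  cbv beta in X. rewrite Cmod_mult, Cmod_pow, Cmod_Dc, Hz in X.
  unfold S1. eapply Rle_trans; [|exact X]. apply Req_le. apply f_equal.
  apply Series_ext. intros n. rewrite Cmod_mult, Cmod_pow, Hz. reflexivity.
Qed.

Lemma ln_le_sub1 (x : R) : 0 < x -> ln x <= x - 1.
Proof. intros Hx. assert (X := exp_ineq1_le (ln x)). rewrite exp_ln in X by auto. lra. Qed.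

Lemma ln_le_linear (s x : R) : 0 < s -> 0 < x -> ln x <= s * x - 1 - ln s.
Proof.
  intros Hs Hx. assert (X := ln_le_sub1 (s * x) (Rmult_lt_0_compat _ _ Hs Hx)).
  rewrite ln_mult in X by auto. lra.
Qed.

(** Apply [ln t <= t - 1] at [x/4] and at its inverse. Jensen's inequality speaks of logarithms, the
    later estimates of [|x - 4|]. *)
Lemma dist4_le_ln (x rho : R) : 0 < x -> x <= rho -> 4 <= rho ->
  Rabs (x - 4) <= rho * Rabs (ln (x / 4)).
Proof.
  intros Hx Hr Hr4. assert (Hx4 : 0 < x / 4) by lra.
  assert (U := ln_le_sub1 (x / 4) Hx4).
  assert (V := ln_le_sub1 (/ (x / 4)) (Rinv_0_lt_compat _ Hx4)).
  rewrite ln_Rinv in V by auto.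
  destruct (Rle_lt_dec 4 x) as [H|H].
  - rewrite (Rabs_pos_eq (x - 4)) by lra.
    assert (W : 1 - / (x / 4) <= Rabs (ln (x / 4))) by (assert (Y := Rle_abs (ln (x / 4))); lra).
    apply Rle_trans with (x * (1 - / (x / 4))); [apply Req_le; field; lra|].
    apply Rmult_le_compat; try lra.
    assert (/ (x / 4) <= / 1) by (apply Rinv_le_contravar; lra). lra.
  - rewrite (Rabs_left (x - 4)) by lra.
    assert (W : 1 - x / 4 <= Rabs (ln (x / 4))).
    { rewrite <- Rabs_Ropp. assert (Y := Rle_abs (- ln (x / 4))). lra. }
    apply Rle_trans with (4 * (1 - x / 4)); [lra|]. apply Rmult_le_compat; lra.
Qed.

Lemma filter_split_perm (p : C -> bool) (L : list C) :
  Permutation L (filter p L ++ filter (fun z => negb (p z)) L).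
Proof.
  induction L as [|a L IH]; simpl; auto. destruct (p a); simpl.
  - now constructor.
  - now apply Permutation_cons_app.
Qed.

Lemma sumR_filter (p : C -> bool) (g : C -> R) (L : list C) :
  sumR g (filter p L) = sumR (fun z => if p z then g z else 0) L.
Proof.
  unfold sumR. induction L as [|a L IH]; simpl; auto. destruct (p a); simpl; lra.
Qed.

(** Zeros of modulus at least [rho4] would enter with negative logarithms; they are moved into the
    cofactor before Jensen's inequality is applied. *)
Lemma jensen_inside (F : nat -> C) (rho rho4 : R) (L : list C) (Q : nat -> C) :
  factors F rho L Q -> 0 < rho4 ->
  sumR (fun z => if Rlt_dec (Cmod z) rho4 then ln (rho4 / Cmod z) else 0) L <= ln (S1 F rho4).
Proof.
  intros (HQ & HQ0 & HF & HL) H4.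
  set (p := fun z => if Rlt_dec (Cmod z) rho4 then true else false).
  rewrite (sumR_ext _ (fun z => if p z then ln (rho4 / Cmod z) else 0)).
  2: { intros z _. unfold p. destruct (Rlt_dec (Cmod z) rho4); auto. }
  rewrite <- sumR_filter.
  rewrite HF, (linprod_perm zf _ _ Q (filter_split_perm p L)), linprod_app.
  apply jensen; auto using entire_linprod.
  - intros z Hz. apply filter_In in Hz. now apply HL.
  - now rewrite linprod_O.
Qed.

(** With [lr = ln (rho/4)], Jensen's lower bound at [rho] reads [M * lr - O(1)]. If all moduli were
    4, the sum would be [lr] times the number of zeros. Counting from both sides thus forces the
    moduli towards 4 on average. *)
Lemma zero_counts (c rho : R) (M : nat) (L : list C) (Q : nat -> C) :
  c < -2 -> (2 <= M)%nat -> 100 <= r c M <= 10000 -> rho = 16 * r c M ->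
  factors (Dc c) rho L Q -> (forall z, Cmod z < rho -> ev Q z <> 0) ->
  (forall z, In z L -> 2 <= Cmod z) /\
  (forall n, Cmod (linprod (rf rho) L Q n) <= 2) /\
  INR M - 7501 <= 2 * INR (length L) /\
  sumR (fun z => Rabs (Cmod z - 4)) L <= 160000 * (3 * ln 40000 + 7501 + 2 * ln (INR M + 2)).
Proof.
  intros Hc HM2 HrM Hrho HLQ HQz. assert (HLQ' := HLQ). destruct HLQ' as (HQ & HQ0 & HF & HL).
  assert (Hr0 : 1600 <= rho <= 160000) by lra.
  assert (HL2 : forall z, In z L -> 2 <= Cmod z).
  { intros z Hz. apply Rnot_lt_le. intro Hlt. apply (ev_Dc_nonzero c z Hc Hlt).
    rewrite HF. destruct (in_split z L Hz) as (l1 & l2 & E).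
    rewrite E, (linprod_perm zf _ _ Q (Permutation_sym (Permutation_middle l1 l2 z))).
    change (linprod zf (z :: l1 ++ l2) Q) with (lin (zf z) (linprod zf (l1 ++ l2) Q)).
    rewrite ev_lin by now apply entire_linprod.
    unfold zf. field_simplify; [reflexivity|]. now apply HL. }
  assert (HrMabs : Rabs (r c M) = r c M) by (apply Rabs_pos_eq; lra).
  assert (Hlow : forall n, (n < M)%nat -> Rabs (r c (S n)) <= r c M).
  { intros n Hn. rewrite <- HrMabs. apply r_mono; auto; lia. }
  (* From [|r_1| <= r_M] one has [c >= - r_M], so [r_{M+1} >= r_M (r_M - 1) >= 99 r_M]. The factor
     64 makes [rho = 16 r_M] a factor 8 away from both [2 r_M] and [2 * 64 r_M], whence the ratio
     1/8 below. *)
  assert (Hhigh : forall n, (M <= n)%nat -> 64 * r c M <= Rabs (r c (S n))).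
  { intros n Hn. eapply Rle_trans; [|apply (r_mono c (S M) (S n) Hc); lia].
    eapply Rle_trans; [|apply Rle_abs]. simpl. 
    assert (- r c M <= c).
    { assert (X := Hlow 0%nat ltac:(lia)). simpl in X. rewrite Rabs_left in X; nra. }
    nra. }
  set (al := Rabs (Dcoef c M)). assert (Hal : 0 < al) by now apply Dcoef_pos.
  set (x := al * rho ^ M).
  assert (HrhoM : 0 < rho ^ M) by (apply pow_lt; lra).
  assert (Hx : 0 < x) by now apply Rmult_lt_0_compat.
  assert (HS1 : S1 (Dc c) rho <= x * (9 / 7)).
  { replace (9 / 7) with ((1 + / 8) / (1 - / 8)) by field. apply S1_Dc_peak; auto; try lra.
    - intros n Hn. specialize (Hlow n Hn). lra.
    - intros n Hn. specialize (Hhigh n Hn). lra. }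
  assert (HS2 : S1 (Dc c) (2 * rho) <= al * (2 * rho) ^ M * 3).
  { replace 3 with ((1 + / 2) / (1 - / 2)) by field. apply S1_Dc_peak; auto; try lra.
    - intros n Hn. specialize (Hlow n Hn). lra.
    - intros n Hn. specialize (Hhigh n Hn). lra. }
  assert (HS4 : S1 (Dc c) 4 <= INR M + 2).
  { unfold S1. apply Series_plateau.
    - apply entire_ex_series; [now apply entire_Dc|lra].
    - intros n. rewrite Cmod_Dc. split; [|now apply Dcoef_le_4].
      apply Rmult_le_pos; [apply Rabs_pos|apply pow_le; lra].
    - intros n Hn. rewrite !Cmod_Dc. apply Dcoef_step; auto; [lra|].
      specialize (Hhigh n Hn). lra. }
  (* The peak term minus all others: [2 x - 9/7 x]. The quotient of [S1] by [mu] is then at most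
     9/5, which yields the bound 2 on the coefficients. *)
  set (mu := x * (5 / 7)). assert (Hmu : 0 < mu) by (unfold mu; lra).
  destruct (jensen_lower (Dc c) rho mu L Q) as [HJ HH]; auto; try lra.
  { intros z Hz. assert (X := Cmod_ev_Dc_lower c rho M z Hc Hz). unfold mu. fold al in X. fold x in X. lra. }
  split; auto. split.
  { intros n. specialize (HH n). assert (P := Cmod_ge_0 (linprod (rf rho) L Q n)).
    assert (R1 : 1 <= rho ^ n) by (apply pow_R1_Rle; lra).
    assert (S1 (Dc c) rho / mu <= 2).
    { apply Rmult_le_reg_r with mu; auto. unfold Rdiv. rewrite Rmult_assoc, Rinv_l by lra. unfold mu. lra. }
    nra. }
  assert (HJ4 := jensen_inside (Dc c) rho 4 L Q HLQ ltac:(lra)).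
  assert (HJ4' : ln (S1 (Dc c) 4) <= ln (INR M + 2)).
  { assert (1 <= S1 (Dc c) 4); [|apply ln_le_mono; lra].
    assert (X := Cmod_ev_le (Dc c) 0 4 (entire_Dc c Hc)). rewrite ev_0, Dc_0, Cmod_0, Cmod_1 in X by now apply entire_Dc.
    apply X. lra. }
  assert (HJ2 := jensen (2 * rho) L Q HQ ltac:(lra) (fun z Hz => proj1 (HL z Hz)) HQ0).
  rewrite <- HF in HJ2.
  set (k := INR (length L)) in *.
  assert (Hln2 : 0 < ln 2) by (rewrite <- ln_1; apply ln_increasing; lra).
  assert (E2 : sumR (fun z => ln (2 * rho / Cmod z)) L = sumR (fun z => ln (rho / Cmod z)) L + ln 2 * k).
  { unfold k. rewrite <- sumR_const, <- sumR_plus. apply sumR_ext. intros z Hz. specialize (HL2 z Hz).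
    replace (2 * rho / Cmod z) with (rho / Cmod z * 2) by (field; lra).
    apply ln_mult; [apply Rdiv_lt_0_compat; lra|lra]. }
  assert (Epow : forall y, 0 < y -> ln (y ^ M) = INR M * ln y) by (intros; now rewrite ln_pow).
  assert (Emu : ln mu = ln al + INR M * ln rho + ln (5 / 7)).
  { unfold mu. rewrite (ln_mult x) by lra. unfold x. rewrite (ln_mult al), Epow by lra. ring. }
  assert (HJ2' : ln (S1 (Dc c) (2 * rho)) <= ln al + INR M * (ln 2 + ln rho) + ln 3).
  { rewrite <- (ln_mult 2 rho), <- Epow by lra.
    assert (0 < (2 * rho) ^ M) by (apply pow_lt; lra).
    assert (0 < al * (2 * rho) ^ M) by now apply Rmult_lt_0_compat.
    rewrite <- !ln_mult by lra. apply ln_le_mono; auto.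
    assert (X := Cmod_ev_le (Dc c) 0 (2 * rho) (entire_Dc c Hc)).
    rewrite ev_0, Dc_0, Cmod_0, Cmod_1 in X by now apply entire_Dc.
    specialize (X ltac:(lra)). lra. }
  (* Subtract the lower bound at [rho] from Jensen's inequality at [2 rho]: each zero gains [ln 2],
     the peak term gains [M ln 2], and the remaining factor [3 * 7/5] is below [2^3]. *)
  assert (Hk : k <= INR M + 3).
  { assert (ln 3 - ln (5 / 7) <= 3 * ln 2).
    { assert (ln 3 <= ln (5 / 7) + (ln 2 + (ln 2 + ln 2))); [|lra].
      rewrite <- !ln_mult by lra. apply ln_le_mono; lra. }
    apply Rmult_le_reg_l with (ln 2); auto. nra. }
  (* [7500 = 3/4 * 10000], from [Dcoef_lower] and [r_M <= 10000]; the extra 1 in 7501 covers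
     [ln (5/7)]. *)
  assert (Hal4 : - 7500 - INR M * ln 4 <= ln al).
  { destruct M as [|m]; [lia|]. assert (X := Dcoef_lower c m Hc). fold al in X.
    rewrite HrMabs in X.
    assert (H4 : 0 < 4 ^ S m) by (apply pow_lt; lra).
    apply ln_le_mono in X; [|apply exp_pos]. rewrite ln_exp, ln_mult, Epow in X by lra. lra. }
  assert (H57 : - 1 <= ln (5 / 7)).
  { replace (5 / 7) with (/ (7 / 5)) by field. rewrite ln_Rinv by lra.
    assert (X := ln_le_sub1 (7 / 5) ltac:(lra)). lra. }
  set (lr := ln rho - ln 4).
  assert (Elr : lr = ln (rho / 4)).
  { unfold lr, Rdiv. rewrite ln_mult, ln_Rinv by lra. ring. }
  assert (Hlr1 : 1 <= lr).
  { rewrite Elr, <- (ln_exp 1). apply ln_le_mono; [apply exp_pos|]. assert (X := exp_le_3). lra. }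
  assert (Hlr2 : lr <= ln 40000) by (rewrite Elr; apply ln_le_mono; lra).
  assert (HJlow : INR M * lr - 7501 <= sumR (fun z => ln (rho / Cmod z)) L) by (unfold lr; lra).
  assert (Elog : forall z, In z L -> ln (Cmod z / 4) = lr + -1 * ln (rho / Cmod z)).
  { intros z Hz. specialize (HL2 z Hz). unfold lr, Rdiv.
    rewrite !ln_mult, !ln_Rinv by (try apply Rinv_0_lt_compat; lra). ring. }
  split.
  (* Since [|z| >= 2] and [rho >= 8], [rho/|z| <= (rho/4)^2], so a zero contributes at most [2 lr];
     then divide by [lr >= 1]. *)
  - assert (Hup : sumR (fun z => ln (rho / Cmod z)) L <= 2 * lr * k).
    { unfold k. rewrite <- sumR_const. apply sumR_le. intros z Hz. specialize (HL2 z Hz).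
      apply Rle_trans with (ln (rho / 4 * (rho / 4))); [|rewrite ln_mult, Elr by lra; lra].
      apply ln_le_mono; [apply Rdiv_lt_0_compat; lra|].
      apply Rmult_le_reg_r with (Cmod z); [lra|]. unfold Rdiv at 1. rewrite Rmult_assoc, Rinv_l by lra.
      assert (2 * (rho / 4 * (rho / 4)) <= rho / 4 * (rho / 4) * Cmod z) by nra. nra. }
    assert (0 <= INR M) by apply pos_INR. nra.
  (* The sum is [k lr - sum ln (rho/|z|)], at most [(M + 3) lr - (M lr - 7501)]: the terms in [M]
     cancel. *)
  - assert (Hsum : sumR (fun z => ln (Cmod z / 4)) L <= 3 * ln 40000 + 7501).
    { rewrite (sumR_ext _ _ _ Elog), sumR_plus, sumR_scal, sumR_const. fold k. nra. }
    (* [|t| = t + 2 max(-t, 0)]; the negative parts come from the zeros in [|z| < 4], to which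
       Jensen's inequality at radius 4 applies. *)
    assert (Habs : sumR (fun z => Rabs (ln (Cmod z / 4))) L =
      sumR (fun z => ln (Cmod z / 4)) L + 2 *
      sumR (fun z => if Rlt_dec (Cmod z) 4 then ln (4 / Cmod z) else 0) L).
    { rewrite <- sumR_scal, <- sumR_plus. apply sumR_ext. intros z Hz. specialize (HL2 z Hz).
      destruct (Rlt_dec (Cmod z) 4) as [H|H].
      - replace (4 / Cmod z) with (/ (Cmod z / 4)) by (field; lra). rewrite ln_Rinv by lra.
        rewrite Rabs_left; [lra|]. rewrite <- ln_1. apply ln_increasing; lra.
      - rewrite Rabs_pos_eq; [lra|]. rewrite <- ln_1. apply ln_le_mono; lra. }
    apply Rle_trans with (160000 * sumR (fun z => Rabs (ln (Cmod z / 4))) L).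
    + rewrite <- sumR_scal. apply sumR_le. intros z Hz. assert (HLz := HL z Hz).
      specialize (HL2 z Hz). apply dist4_le_ln; lra.
    + apply Rmult_le_compat_l; lra.
Qed.

(** The number of zeros grows at least like [M/2], the total deviation of the moduli only like
    [ln M]; [delta] serves to make [M] large. *)
Lemma zero_statistics (eta : R) : 0 < eta -> exists delta, 0 < delta /\
  forall c, -2 - delta < c < -2 -> exists rho L Q,
    factors (Dc c) rho L Q /\ (forall z, Cmod z < rho -> ev Q z <> 0) /\ 1000 <= rho /\
    (forall z, In z L -> 2 <= Cmod z) /\
    (forall n, Cmod (linprod (rf rho) L Q n) <= 2) /\
    1 <= eta * INR (length L) /\
    sumR (fun z => Rabs (Cmod z - 4)) L <= eta * INR (length L).
Proof.
  intros Heta.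
  (* Chosen so that replacing the logarithm by [s * (M + 2)] plus a constant costs
     [160000 * 2 * s = eta/4] per unit of [M], half of the [eta/2] that the count of zeros
     supplies. *)
  set (s := eta / 1280000). assert (Hs : 0 < s) by (unfold s; lra).
  set (A := 160000 * (3 * ln 40000 + 7501 + 2 * (2 * s - 1 - ln s))).
  (* The first threshold yields [1 <= eta * k]; in the second, 3751 covers the 7501/2 zeros missing
     from [M/2]. *)
  destruct (INR_unbounded (Rmax (7501 + 2 / eta) ((A + 3751 * eta) / (eta / 4)))) as [N HN].
  destruct (r_near (N + 2)) as (delta & Hd & Hnear).
  exists delta. split; [lra|]. intros c Hcd. assert (Hc : c < -2) by lra.
  destruct (escape_time c Hc) as (M & HM1 & HM2).
  assert (HMN : (N + 2 < M)%nat).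
  { apply Nat.nle_gt. intro Hle. specialize (Hnear c Hcd M Hle). lra. }
  (* [r_M = r_{M-1}^2 + c] with [r_{M-1} < 100]. That bound is one-sided, so [r_{M-1} > 0] is needed
     as well, which holds from index 2 on; hence the margin [N + 2]. *)
  assert (HrM : 100 <= r c M <= 10000).
  { split; auto. destruct M as [|[|m]]; try lia.
    change (r c (S (S m))) with (r c (S m) ^ 2 + c).
    specialize (HM2 (S m) ltac:(lia)).
    destruct m as [|m]; [lia|]. destruct (r_excess c m Hc) as (_ & _ & Hp). nra. }
  destruct (full_factorization (Dc c) (16 * r c M)) as (L & Q & HLQ & HQz); auto using entire_Dc, Dc_0; try lra.
  destruct (zero_counts c (16 * r c M) M L Q) as (R1 & R2 & R3 & R4); auto; try lia.
  exists (16 * r c M), L, Q. split; [auto|]. split; [auto|]. split; [lra|]. split; [auto|]. split; [auto|].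
  assert (HMN' : INR N <= INR M) by (apply le_INR; lia).
  assert (X1 := Rmax_l (7501 + 2 / eta) ((A + 3751 * eta) / (eta / 4))).
  assert (X2 := Rmax_r (7501 + 2 / eta) ((A + 3751 * eta) / (eta / 4))).
  set (k := INR (length L)) in *.
  split.
  - assert (2 / eta <= 2 * k) by lra.
    apply Rmult_le_reg_l with (2 / eta); [apply Rdiv_lt_0_compat; lra|].
    replace (2 / eta * (eta * k)) with (2 * k) by (field; lra). lra.
  - eapply Rle_trans; [exact R4|].
    assert (Hln := ln_le_linear s (INR M + 2) Hs ltac:(assert (Z := pos_INR M); lra)).
    apply Rle_trans with (A + eta / 4 * INR M).
    + unfold A. replace (eta / 4) with (160000 * (2 * s)) by (unfold s; field). lra.
    + assert (A + 3751 * eta <= eta / 4 * INR M).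
      { apply Rle_trans with (eta / 4 * ((A + 3751 * eta) / (eta / 4))); [apply Req_le; field; lra|].
        apply Rmult_le_compat_l; lra. }
      nra.
Qed.

(** * Multiplicities *)

Fixpoint dser (k : nat) (a : nat -> C) : nat -> C :=
  match k with O => a | S j => fun n => (INR (S n) * dser j a (S n))%C end.

Lemma dser_fact (k : nat) (a : nat -> C) (n : nat) :
  dser k a n = (RtoC (INR (fact (n + k)) / INR (fact n)) * a (n + k)%nat)%C.
Proof.
  revert n. induction k; intros n.
  - rewrite Nat.add_0_r. simpl. replace (INR (fact n) / INR (fact n)) with 1; [ring|].
    field. apply INR_fact_neq_0.
  - cbn [dser]. rewrite IHk. replace (S n + k)%nat with (n + S k)%nat by lia.
    rewrite Cmult_assoc, <- RtoC_mult. f_equal. f_equal.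
    change (fact (S n)) with (S n * fact n)%nat. rewrite mult_INR. field.
    split; [apply INR_fact_neq_0|apply not_0_INR; lia].
Qed.

Lemma entire_dser (k : nat) (a : nat -> C) : entire a -> entire (dser k a).
Proof.
  intros H. induction k; auto. intros B HB. destruct (IHk (2 * B)) as [K HK]; [lra|].
  exists (K / B). intros n. cbn [dser]. rewrite Cmod_mult, Cmod_R, Rabs_pos_eq by apply pos_INR.
  assert (Hn : INR (S n) <= 2 ^ S n).
  { clear. induction n; [simpl; lra|]. rewrite S_INR.
    assert (1 <= 2 ^ S n) by (apply pow_R1_Rle; lra). change (2 ^ S (S n)) with (2 * 2 ^ S n). lra. }
  specialize (HK (S n)). rewrite Rpow_mult_distr in HK.
  apply Rmult_le_reg_r with B; auto. unfold Rdiv. rewrite (Rmult_assoc K), Rinv_l, Rmult_1_r by lra.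
  eapply Rle_trans; [|exact HK].
  assert (P : 0 <= Cmod (dser k a (S n)) * B ^ S n) by (apply Rmult_le_pos; [apply Cmod_ge_0|apply pow_le; lra]).
  replace (INR (S n) * Cmod (dser k a (S n)) * B ^ n * B) with
    (INR (S n) * (Cmod (dser k a (S n)) * B ^ S n)) by (simpl; ring).
  replace (Cmod (dser k a (S n)) * (2 ^ S n * B ^ S n)) with
    (2 ^ S n * (Cmod (dser k a (S n)) * B ^ S n)) by ring.
  now apply Rmult_le_compat_r.
Qed.

(** Leibniz's rule: a linear factor has only one nonzero derivative, so two terms remain. At the
    root of the factor the first vanishes. *)
Lemma dser_lin (k : nat) (b : C) (a : nat -> C) (n : nat) :
  dser (S k) (lin b a) n = (lin b (dser (S k) a) n + INR (S k) * b * dser k a n)%C.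
Proof.
  revert n. induction k; intros n.
  - cbn [dser]. destruct n as [|n]; cbn [lin].
    + simpl. ring.
    + rewrite (S_INR (S n)), RtoC_plus. simpl (INR 1). ring.
  - change (dser (S (S k)) (lin b a) n) with (INR (S n) * dser (S k) (lin b a) (S n))%C.
    rewrite IHk. destruct n as [|n]; cbn [lin].
    + change (dser (S (S k)) a 0%nat) with (INR 1 * dser (S k) a 1%nat)%C.
      change (dser (S k) a 0%nat) with (INR 1 * dser k a 1%nat)%C.
      rewrite (S_INR (S k)), RtoC_plus. simpl (INR 1). ring.
    + change (dser (S (S k)) a (S n)) with (INR (S (S n)) * dser (S k) a (S (S n)))%C.
      change (dser (S (S k)) a n) with (INR (S n) * dser (S k) a (S n))%C.
      change (dser (S k) a (S n)) with (INR (S (S n)) * dser k a (S (S n)))%C.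
      rewrite (S_INR (S k)), (S_INR (S n)), !RtoC_plus. ring.
Qed.

Lemma ev_plus (a b : nat -> C) (z : C) : entire a -> entire b ->
  ev (fun n => a n + b n)%C z = (ev a z + ev b z)%C.
Proof.
  intros Ha Hb. unfold ev. rewrite <- Cser_plus by now apply ev_summable.
  apply Cser_ext. intro; ring.
Qed.

Lemma ev_dser_lin (k : nat) (b z : C) (a : nat -> C) : entire a -> (1 + b * z = 0)%C ->
  ev (dser (S k) (lin b a)) z = (INR (S k) * b * ev (dser k a) z)%C.
Proof.
  intros Ha Hz.
  replace (dser (S k) (lin b a)) with (fun n => lin b (dser (S k) a) n + INR (S k) * b * dser k a n)%C
    by (apply functional_extensionality; intro; now rewrite dser_lin).
  assert (E1 := entire_dser (S k) a Ha). assert (E2 := entire_dser k a Ha).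
  rewrite ev_plus, ev_lin, ev_scal, Hz by auto using entire_lin, entire_scal. ring.
Qed.

Lemma entire_iter_lin (m : nat) (b : C) (G : nat -> C) : entire G -> entire (Nat.iter m (lin b) G).
Proof. intros H. induction m; simpl; auto using entire_lin. Qed.

(** Differentiating and evaluating at the root removes one linear factor at the cost of a nonzero
    constant, so [m] factors take exactly [m] derivatives. *)
Lemma ev_dser_iter_lin (m : nat) (b z : C) (G : nat -> C) : entire G -> (1 + b * z = 0)%C -> b <> 0 ->
  ev G z <> 0 ->
  (forall k, (k < m)%nat -> ev (dser k (Nat.iter m (lin b) G)) z = 0) /\
  ev (dser m (Nat.iter m (lin b) G)) z <> 0.
Proof.
  intros HG Hz Hb HGz. induction m as [|m [IH1 IH2]].
  - split; auto. intros; lia.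
  - assert (E := entire_iter_lin m b G HG). split.
    + intros [|k] Hk; cbn [Nat.iter].
      * simpl dser. rewrite ev_lin, Hz by auto. ring.
      * change (Nat.iter (S m) (lin b) G) with (lin b (Nat.iter m (lin b) G)).
        rewrite ev_dser_lin, IH1 by (auto; lia). ring.
    + change (Nat.iter (S m) (lin b) G) with (lin b (Nat.iter m (lin b) G)).
      rewrite ev_dser_lin by auto. repeat apply Cmult_neq_0; auto.
      intro X. apply RtoC_inj in X. revert X. apply not_0_INR. lia.
Qed.

Lemma linprod_collect (L : list C) (Q : nat -> C) (z : C) :
  linprod zf L Q = Nat.iter (count_occ Co_eq_dec L z) (lin (zf z)) (linprod zf (remove Co_eq_dec z L) Q).
Proof.
  assert (Hit : forall m b b' G, lin b (Nat.iter m (lin b') G) = Nat.iter m (lin b') (lin b G)).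
  { induction m; intros; simpl; auto. rewrite lin_comm. now rewrite IHm. }
  induction L as [|w L IH]; auto. cbn [count_occ remove].
  change (linprod zf (w :: L) Q) with (lin (zf w) (linprod zf L Q)). rewrite IH.
  destruct (Co_eq_dec w z) as [->|Hne].
  - destruct (Co_eq_dec z z); [reflexivity|contradiction].
  - destruct (Co_eq_dec z w) as [E|_]; [symmetry in E; contradiction|]. apply Hit.
Qed.

Lemma ev_linprod_nonzero (L : list C) (Q : nat -> C) (z : C) : entire Q -> ev Q z <> 0 ->
  (forall w, In w L -> w <> 0 /\ w <> z) -> ev (linprod zf L Q) z <> 0.
Proof.
  intros HQ HQz HL. induction L as [|w L IH]; auto.
  change (linprod zf (w :: L) Q) with (lin (zf w) (linprod zf L Q)).
  rewrite ev_lin by now apply entire_linprod. apply Cmult_neq_0.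
  - destruct (HL w) as [Hw Hwz]; [now left|]. intro X. apply Hwz. symmetry. apply Ceq_minus.
    replace (z - w)%C with (- w * (1 + zf w * z))%C by (unfold zf; field; auto). rewrite X. ring.
  - apply IH. intros; apply HL; now right.
Qed.

Lemma Dderiv_is_ev (c : R) (k : nat) (z w : C) : c < -2 ->
  Dderiv_is c k z w <-> w = ev (dser k (Dc c)) z.
Proof.
  intros Hc. assert (HE := ev_summable _ z (entire_dser k _ (entire_Dc c Hc))).
  assert (Hpow : forall n, Defs.Cpow z n = Cpow z n).
  { intros n. reflexivity. }
  assert (Ht : (fun n => Cscal (INR (fact (n + k)) / INR (fact n) * Dcoef c (n + k)) (Defs.Cpow z n)) =
    (fun n => dser k (Dc c) n * Cpow z n)%C).
  { apply functional_extensionality. intros n. rewrite dser_fact, Hpow. unfold Dc.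
    rewrite <- RtoC_mult. unfold Cscal, Cmult, RtoC. simpl. f_equal; ring. }
  unfold Dderiv_is. rewrite Ht. unfold Csum_to. unfold ev, Cser.
  assert (S1 := Series_correct _ (ex_series_fst _ HE)). assert (S2 := Series_correct _ (ex_series_snd _ HE)).
  split.
  - intros [H1 H2]. apply is_series_Reals, is_series_unique in H1. apply is_series_Reals, is_series_unique in H2.
    rewrite H1, H2. apply surjective_pairing.
  - intros ->. split; now apply is_series_Reals.
Qed.

Lemma zero_mult_unique (c : R) (z : C) (m n : nat) : c < -2 ->
  zero_mult c z m -> zero_mult c z n -> m = n.
Proof.
  intros Hc.
  assert (W : forall i j, (i < j)%nat -> zero_mult c z i -> zero_mult c z j -> False).
  { intros i j Hij [_ (w & H1 & H2)] [H3 _]. specialize (H3 i Hij).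
    apply Dderiv_is_ev in H1, H3; auto. congruence. }
  intros H1 H2. destruct (Nat.lt_trichotomy m n) as [H|[H|H]]; auto; exfalso; eauto.
Qed.

Lemma zero_mult_count (c rho : R) (L : list C) (Q : nat -> C) (z : C) : c < -2 ->
  factors (Dc c) rho L Q -> ev Q z <> 0 -> zero_mult c z (count_occ Co_eq_dec L z).
Proof.
  intros Hc (HQ & HQ0 & HF & HL) HQz.
  assert (HL0 : forall w, In w L -> w <> 0) by (intros w Hw; now apply HL).
  assert (HR := entire_linprod zf (remove Co_eq_dec z L) Q HQ).
  assert (HRz : ev (linprod zf (remove Co_eq_dec z L) Q) z <> 0).
  { apply ev_linprod_nonzero; auto. intros w Hw. apply in_remove in Hw. destruct Hw. auto. }
  assert (M : (forall k, (k < count_occ Co_eq_dec L z)%nat -> ev (dser k (Dc c)) z = 0) /\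
    ev (dser (count_occ Co_eq_dec L z) (Dc c)) z <> 0).
  { rewrite HF, (linprod_collect L Q z).
    (* At 0 the factor [zf z] has no meaning as a root factor, but 0 is not listed and its count is
       0. *)
    destruct (excluded_middle_informative (z = 0)) as [E|E].
    - assert (N : count_occ Co_eq_dec L z = O).
      { apply count_occ_not_In. intro Hin. now apply (HL0 z Hin). }
      rewrite N. split; [intros; lia|]. exact HRz.
    - apply ev_dser_iter_lin; auto.
      + unfold zf. field. auto.
      + unfold zf. intro X. apply C1_nz. replace (RtoC 1) with (- (- / z * z))%C by (field; auto).
        rewrite X. ring. }
  destruct M as [M1 M2]. split.
  - intros k Hk. apply Dderiv_is_ev; auto. now rewrite M1.
  - exists (ev (dser (count_occ Co_eq_dec L z) (Dc c)) z). split; auto. now apply Dderiv_is_ev.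
Qed.

Lemma count_occ_filter (p : C -> bool) (L : list C) (z : C) :
  count_occ Co_eq_dec (filter p L) z = if p z then count_occ Co_eq_dec L z else O.
Proof.
  induction L as [|w L IH]; simpl; [now destruct (p z)|].
  destruct (p w) eqn:Ew; simpl; destruct (Co_eq_dec w z) as [->|]; rewrite ?IH, ?Ew; auto.
Qed.

Definition in_disc (z : C) : bool := if Rlt_dec (Cmod z) 1000 then true else false.

(** Every point of the disc has exactly one multiplicity, its count in [L], which determines a list
    of zeros up to order. *)
Lemma zeros_list_characterized (c rho : R) (L : list C) (Q : nat -> C) : c < -2 -> 1000 <= rho ->
  factors (Dc c) rho L Q -> (forall z, Cmod z < rho -> ev Q z <> 0) ->
  zeros_list c (filter in_disc L) /\
  forall l, zeros_list c l -> Permutation l (filter in_disc L).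
Proof.
  intros Hc Hr HLQ HQz.
  assert (Hm : forall z, Cmod z < 1000 -> zero_mult c z (count_occ Co_eq_dec L z)).
  { intros z Hz. apply zero_mult_count with rho Q; auto. apply HQz. lra. }
  assert (Hin : forall z, Cmod z < 1000 -> in_disc z = true).
  { intros z Hz. unfold in_disc. destruct (Rlt_dec (Cmod z) 1000); [reflexivity|contradiction]. }
  split; [split|].
  - intros z Hz. apply filter_In in Hz. destruct Hz as [_ Hz]. unfold in_disc in Hz.
    destruct (Rlt_dec (Cmod z) 1000) as [H|H]; [exact H|discriminate].
  - intros z m Hz H. change (Cmod z < 1000) in Hz. rewrite count_occ_filter, Hin by auto.
    eapply zero_mult_unique; eauto.
  - intros l [H1 H2]. apply (Permutation_count_occ Co_eq_dec). intros z.
    rewrite count_occ_filter. unfold in_disc. destruct (Rlt_dec (Cmod z) 1000) as [H|H].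
    + apply H2; auto.
    + apply count_occ_not_In. intro Hi. apply H. now apply H1.
Qed.

(** * Equidistribution from trigonometric moments *)

Definition dirichlet (N : nat) (x : C) : C := Csum (fun s => x ^ s)%C N.

Lemma unit_conj (x : C) : Cmod x = 1 -> (x * Cconj x = 1)%C.
Proof. intros H. rewrite <- Cmod2_conj, H. f_equal. ring. Qed.

(** Expands the square of [D_N + x^N]. Unrolled over [N], it presents the Fejer kernel [|D_N|^2] as
    [N] plus real parts of powers [x^m] with [0 < m < N], without a double sum. *)
Lemma dirichlet_succ (N : nat) (x : C) : Cmod x = 1 ->
  Cmod (dirichlet (S N) x) ^ 2 =
  Cmod (dirichlet N x) ^ 2 + 1 + 2 * Re (Csum (fun s => x ^ (N - s))%C N).
Proof.
  intros Hx.
  assert (E : Csum (fun s => x ^ (N - s))%C N = (x ^ N * Cconj (dirichlet N x))%C).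
  { unfold dirichlet.
    assert (Hc : forall u n, Cconj (Csum u n) = Csum (fun i => Cconj (u i)) n).
    { induction n; simpl; [unfold Cconj, RtoC; simpl; f_equal; ring|]. now rewrite Cplus_conj, IHn. }
    rewrite Hc, <- Csum_scal. apply Csum_ext. intros i Hi.
    replace N with ((N - i) + i)%nat at 2 by lia.
    rewrite Cpow_add_r, Cpow_conj.
    assert (Y : (x ^ i * Cconj x ^ i)%C = 1).
    { rewrite <- Cpow_mult_l, unit_conj by auto. apply Cpow_1_l. }
    replace (x ^ (N - i) * x ^ i * Cconj x ^ i)%C with (x ^ (N - i) * (x ^ i * Cconj x ^ i))%C by ring.
    rewrite Y. ring. }
  rewrite E.
  change (dirichlet (S N) x) with (dirichlet N x + x ^ N)%C.
  assert (P : Cmod (x ^ N) ^ 2 = 1) by (rewrite Cmod_pow, Hx, pow1; ring).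
  rewrite !Cmod2_alt in *. unfold Re, Im, Cconj, Cmult, Cplus in *. simpl in *. lra.
Qed.

Lemma sumR_Re (g : C -> C) (X : list C) : sumR (fun x => Re (g x)) X = Re (sumC g X).
Proof. unfold sumR, sumC. induction X; simpl; auto. rewrite IHX. reflexivity. Qed.

Lemma sumC_Csum (g : nat -> C -> C) (X : list C) (n : nat) :
  sumC (fun x => Csum (fun s => g s x) n) X = Csum (fun s => sumC (g s) X) n.
Proof.
  induction n; simpl.
  - unfold sumC. induction X; simpl; auto. rewrite IHX. ring.
  - rewrite sumC_plus, IHn. reflexivity.
Qed.

(** The constant term of the kernel contributes [N] per point, everything else is a moment. The
    error grows by [2 N W] per step, within [(N + 1)^2 W - N^2 W]. *)
Lemma dirichlet_sum (N : nat) (X : list C) (W : R) : 0 <= W -> (forall x, In x X -> Cmod x = 1) ->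
  (forall m, (0 < m < N)%nat -> Cmod (sumC (fun x => x ^ m)%C X) <= W) ->
  Rabs (sumR (fun x => Cmod (dirichlet N x) ^ 2) X - INR N * INR (length X)) <= INR N ^ 2 * W.
Proof.
  intros HW HX. induction N as [|N IH]; intros H.
  - rewrite (sumR_ext _ (fun _ => 0)).
    + rewrite sumR_const. simpl. rewrite Rmult_0_l, Rmult_0_l, Rminus_diag, Rabs_R0. lra.
    + intros. unfold dirichlet. simpl Csum. rewrite Cmod_0. ring.
  - specialize (IH ltac:(intros; apply H; lia)).
    rewrite (sumR_ext _ (fun x => (Cmod (dirichlet N x) ^ 2 + 1) + 2 * Re (Csum (fun s => x ^ (N - s))%C N)))
      by (intros; now apply dirichlet_succ, HX).
    rewrite !sumR_plus, sumR_scal, sumR_const, sumR_Re, sumC_Csum, S_INR.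
    assert (B : Cmod (Csum (fun s => sumC (fun x => x ^ (N - s))%C X) N) <= INR N * W).
    { apply Cmod_Csum_le. intros i Hi. apply H. lia. }
    assert (B2 := re_le_Cmod (Csum (fun s => sumC (fun x => x ^ (N - s))%C X) N)).
    set (e := Re _) in *. assert (HN := pos_INR N).
    apply Rabs_le_between in IH. assert (B3 : Rabs e <= INR N * W) by lra. apply Rabs_le_between in B3.
    apply Rabs_le. split; nra.
Qed.

Lemma dirichlet_decay (N : nat) (x : C) : Cmod x = 1 -> Cmod (x - 1) * Cmod (dirichlet N x) <= 2.
Proof.
  intros Hx. rewrite <- Cmod_mult.
  assert (E : ((x - 1) * dirichlet N x = x ^ N - 1)%C).
  { unfold dirichlet. induction N; simpl; [ring|]. rewrite Cmult_plus_distr_l, IHN. ring. }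
  rewrite E. eapply Rle_trans; [apply Cmod_triangle|]. rewrite Cmod_opp, Cmod_pow, Hx, pow1, Cmod_1. lra.
Qed.

Definition node (N i : nat) : C := cis (2 * PI * INR i / INR N).
Definition nodes (N : nat) : list C := map (node N) (List.seq 0 N).

Lemma sumC_nodes (N : nat) (g : C -> C) : sumC g (nodes N) = Csum (fun i => g (node N i)) N.
Proof.
  unfold nodes, sumC. rewrite map_map.
  assert (G : forall n k, fold_right Cplus (RtoC 0) (map (fun x => g (node N x)) (List.seq k n)) =
     Csum (fun i => g (node N (k + i))) n).
  { induction n; intros k; [reflexivity|]. rewrite Csum_head. simpl List.seq. simpl map. simpl fold_right.
    rewrite IHn, Nat.add_0_r. f_equal. apply Csum_ext. intros. do 2 f_equal. lia. }
  rewrite G. reflexivity.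
Qed.

Lemma nodes_power_sum (N m : nat) : (0 < m < N)%nat -> sumC (fun w => w ^ m)%C (nodes N) = 0.
Proof.
  intros Hm. rewrite sumC_nodes.
  assert (HN : 0 < INR N) by (apply lt_0_INR; lia).
  assert (Hm1 : 0 < INR m) by (apply lt_0_INR; lia). assert (Hm2 : INR m < INR N) by (apply lt_INR; lia).
  set (q := cis (2 * PI * INR m / INR N)).
  rewrite (Csum_ext _ (fun i => q ^ i)%C).
  2: { intros i _. unfold node, q. rewrite !cis_pow. f_equal. field. lra. }
  assert (HqN : (q ^ N)%C = 1).
  { unfold q. rewrite cis_pow. replace (INR N * (2 * PI * INR m / INR N)) with (0 + 2 * INR m * PI) by (field; lra).
    unfold cis. rewrite cos_period, sin_period, cos_0, sin_0. reflexivity. }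
  assert (E : forall n, ((q - 1) * Csum (fun i => q ^ i) n = q ^ n - 1)%C).
  { induction n; simpl; [ring|]. rewrite Cmult_plus_distr_l, IHn. ring. }
  specialize (E N). rewrite HqN in E.
  assert (Hq1 : (q - 1)%C <> 0).
  { intro X. apply (f_equal fst) in X. unfold q, cis, Cminus, Cplus, Copp, RtoC in X. simpl in X.
    set (t := PI * INR m / INR N).
    replace (2 * PI * INR m / INR N) with (2 * t) in X by (unfold t; field; lra).
    rewrite cos_2a_sin in X.
    assert (P := PI_RGT_0).
    assert (Ht : 0 < t < PI).
    { unfold t. split.
      - apply Rdiv_lt_0_compat; auto. now apply Rmult_lt_0_compat.
      - apply Rmult_lt_reg_r with (INR N); auto. unfold Rdiv. rewrite Rmult_assoc, Rinv_l by lra. nra. }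
    assert (S := sin_gt_0 t ltac:(lra) ltac:(lra)). nra. }
  set (Z := Csum (fun i => q ^ i)%C N) in *.
  replace Z with (/ (q - 1) * ((q - 1) * Z))%C by (field; auto).
  rewrite E. ring.
Qed.

Lemma nodes_unit (N : nat) (w : C) : In w (nodes N) -> Cmod w = 1.
Proof. intros H. apply in_map_iff in H. destruct H as (i & <- & _). apply Cmod_cis. Qed.

Lemma length_nodes (N : nat) : length (nodes N) = N.
Proof. unfold nodes. rewrite length_map. apply length_seq. Qed.

Lemma sumC_map (g h : C -> C) (X : list C) : sumC g (map h X) = sumC (fun x => g (h x)) X.
Proof. unfold sumC. now rewrite map_map. Qed.

Lemma sumR_map (g : C -> R) (h : C -> C) (X : list C) : sumR g (map h X) = sumR (fun x => g (h x)) X.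
Proof. unfold sumR. now rewrite map_map. Qed.

Lemma rotated_dirichlet_sum (N : nat) (X : list C) (d : C) (W : R) : 0 <= W -> Cmod d = 1 ->
  (forall x, In x X -> Cmod x = 1) ->
  (forall m, (0 < m < N)%nat -> Cmod (sumC (fun x => x ^ m)%C X) <= W) ->
  Rabs (sumR (fun x => Cmod (dirichlet N (x * d)) ^ 2) X - INR N * INR (length X)) <= INR N ^ 2 * W.
Proof.
  intros HW Hd HX H.
  rewrite <- (length_map (fun x => x * d)%C X), <- (sumR_map (fun y => Cmod (dirichlet N y) ^ 2) (fun x => x * d)%C).
  apply dirichlet_sum; auto.
  - intros x Hx. apply in_map_iff in Hx. destruct Hx as (y & <- & Hy). rewrite Cmod_mult, (HX y Hy), Hd. ring.
  - intros m Hm. rewrite sumC_map.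
    rewrite (sumC_ext _ (fun x => d ^ m * x ^ m)%C).
    + rewrite sumC_scal, Cmod_mult, Cmod_pow, Hd, pow1, Rmult_1_l. auto.
    + intros. rewrite Cpow_mult_l. ring.
Qed.

(** The moments of the roots of unity vanish below [N], so the preceding estimate holds with [W = 0]
    and becomes an equality: divided by [N^2], the kernel is a partition of unity over the nodes. *)
Lemma dirichlet_partition (N : nat) (d : C) : Cmod d = 1 ->
  sumR (fun w => Cmod (dirichlet N (w * d)) ^ 2) (nodes N) = INR N ^ 2.
Proof.
  intros Hd.
  assert (X := rotated_dirichlet_sum N (nodes N) d 0 (Rle_refl 0) Hd (nodes_unit N)).
  rewrite length_nodes in X.
  assert (Y : Rabs (sumR (fun w => Cmod (dirichlet N (w * d)) ^ 2) (nodes N) - INR N * INR N) <= INR N ^ 2 * 0).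
  { apply X. intros m Hm. rewrite nodes_power_sum by auto. rewrite Cmod_0. lra. }
  rewrite Rmult_0_r in Y. apply Rabs_le_between in Y. lra.
Qed.

Lemma Rabs_sumR_le (g : C -> R) (h : C -> R) (L : list C) :
  (forall z, In z L -> Rabs (g z) <= h z) -> Rabs (sumR g L) <= sumR h L.
Proof.
  unfold sumR. induction L; simpl; intros H; [rewrite Rabs_R0; lra|].
  eapply Rle_trans; [apply Rabs_triang|]. apply Rplus_le_compat; auto.
Qed.

Lemma sumR_exchange (g : C -> C -> R) (L X : list C) :
  sumR (fun z => sumR (fun w => g z w) X) L = sumR (fun w => sumR (fun z => g z w) L) X.
Proof.
  induction L as [|a L IH].
  - unfold sumR at 1. simpl. symmetry. change (sumR (fun _ => 0) X = 0). rewrite sumR_const. ring.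
  - change (sumR (fun w => g a w) X + sumR (fun z => sumR (fun w => g z w) X) L =
      sumR (fun w => g a w + sumR (fun z => g z w) L) X).
    now rewrite IH, sumR_plus.
Qed.

(* [g] is interpolated at the nodes with the squared Dirichlet kernel. *)
Lemma fejer_interpolation (g : C -> R) (B eta delta : R) (N : nat) (d : C) :
  (forall z, Rabs (g z) <= B) -> 0 < delta -> (0 < N)%nat -> 0 <= eta ->
  (forall z w, Cmod z = 1 -> Cmod w = 1 -> Cmod (w - z) < delta -> Rabs (g w - g z) <= eta) ->
  Cmod d = 1 ->
  Rabs (INR N ^ 2 * g (Cconj d) - sumR (fun w => g w * Cmod (dirichlet N (w * d)) ^ 2) (nodes N))
  <= eta * INR N ^ 2 + 8 * B / delta ^ 2 * INR N.
Proof.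
  intros HB Hdel HN Heta Hg Hd.
  assert (HB0 : 0 <= B) by (eapply Rle_trans; [apply Rabs_pos|apply (HB 0)]).
  replace (INR N ^ 2 * g (Cconj d) - sumR (fun w => g w * Cmod (dirichlet N (w * d)) ^ 2) (nodes N)) with
    (sumR (fun w => (g (Cconj d) - g w) * Cmod (dirichlet N (w * d)) ^ 2) (nodes N)).
  2: { rewrite (sumR_ext _ (fun w => g (Cconj d) * Cmod (dirichlet N (w * d)) ^ 2
         + -1 * (g w * Cmod (dirichlet N (w * d)) ^ 2))) by (intros; ring).
       rewrite sumR_plus, !sumR_scal, dirichlet_partition by auto. ring. }
  replace (eta * INR N ^ 2 + 8 * B / delta ^ 2 * INR N) with
    (sumR (fun w => eta * Cmod (dirichlet N (w * d)) ^ 2 + 8 * B / delta ^ 2) (nodes N)).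
  2: { rewrite sumR_plus, sumR_scal, dirichlet_partition, sumR_const, length_nodes by auto. ring. }
  apply Rabs_sumR_le. intros w Hw. assert (Hw1 := nodes_unit N w Hw).
  set (D := Cmod (dirichlet N (w * d))).
  assert (HD : 0 <= D ^ 2) by apply pow2_ge_0.
  rewrite Rabs_mult, (Rabs_pos_eq (D ^ 2)) by auto.
  assert (Hc : Cmod (Cconj d) = 1) by now rewrite Cmod_conj.
  assert (HK : 0 <= 8 * B / delta ^ 2).
  { apply Rmult_le_pos; [lra|]. apply Rlt_le, Rinv_0_lt_compat, pow_lt; auto. }
  (* Nodes near [Cconj d] are handled by continuity and the partition of unity; at each of the
     others the kernel is at most [4 / delta^2]. *)
  destruct (Rlt_le_dec (Cmod (w - Cconj d)) delta) as [Hlt|Hge].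
  - assert (X := Hg _ _ Hc Hw1 Hlt). rewrite Rabs_minus_sym in X. nra.
  - assert (X : Rabs (g (Cconj d) - g w) <= 2 * B).
    { unfold Rminus. eapply Rle_trans; [apply Rabs_triang|]. rewrite Rabs_Ropp.
      assert (Y := HB (Cconj d)). assert (Z := HB w). lra. }
    assert (Hwd : Cmod (w * d) = 1) by (rewrite Cmod_mult, Hw1, Hd; ring).
    (* The kernel in [w * d] peaks at [w * d = 1], that is at [w = Cconj d], where [g] is
       evaluated. *)
    assert (E : Cmod (w * d - 1) = Cmod (w - Cconj d)).
    { replace (w * d - 1)%C with ((w - Cconj d) * d)%C.
      - rewrite Cmod_mult, Hd. ring.
      - replace ((w - Cconj d) * d)%C with (w * d - d * Cconj d)%C by ring. now rewrite unit_conj. }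
    assert (Y := dirichlet_decay N (w * d) Hwd). rewrite E in Y. fold D in Y.
    assert (HD0 : 0 <= D) by apply Cmod_ge_0.
    assert (delta * D <= 2) by nra.
    assert (D ^ 2 <= 4 / delta ^ 2).
    { apply Rmult_le_reg_r with (delta ^ 2); [apply pow_lt; auto|].
      unfold Rdiv. rewrite Rmult_assoc, Rinv_l by (apply pow_nonzero; lra).
      replace (D ^ 2 * delta ^ 2) with ((delta * D) ^ 2) by ring.
      assert (0 <= delta * D) by nra. nra. }
    assert (Rabs (g (Cconj d) - g w) * D ^ 2 <= 2 * B * (4 / delta ^ 2)).
    { apply Rmult_le_compat; auto. apply Rabs_pos. }
    replace (8 * B / delta ^ 2) with (2 * B * (4 / delta ^ 2)) by (field; lra).
    assert (0 <= eta * D ^ 2) by now apply Rmult_le_pos. lra.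
Qed.

(** Interpolate each [g (Cconj d)] at the nodes and exchange the sums: the total kernel weight of a
    node over [X] is nearly [N * k] by the moment bounds. The node average thus replaces any Fourier
    expansion of [g]. *)
Lemma equidistribution (g : C -> R) (B eta delta W : R) (N : nat) (X : list C) :
  (forall z, Rabs (g z) <= B) -> 0 < delta -> (0 < N)%nat -> 0 <= eta -> 0 <= W ->
  (forall z w, Cmod z = 1 -> Cmod w = 1 -> Cmod (w - z) < delta -> Rabs (g w - g z) <= eta) ->
  (forall d, In d X -> Cmod d = 1) ->
  (forall m, (0 < m < N)%nat -> Cmod (sumC (fun d => d ^ m)%C X) <= W) ->
  Rabs (sumR (fun d => g (Cconj d)) X - INR (length X) * (sumR g (nodes N) / INR N))
  <= INR (length X) * (eta + 8 * B / delta ^ 2 / INR N) + B * INR N * W.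
Proof.
  intros HB Hdel HN Heta HW Hg HX H.
  assert (HB0 : 0 <= B) by (eapply Rle_trans; [apply Rabs_pos|apply (HB 0)]).
  assert (HN' : 0 < INR N) by (apply lt_0_INR; lia).
  assert (HN2 : 0 < INR N ^ 2) by now apply pow_lt.
  set (k := INR (length X)).
  set (T := sumR (fun d => sumR (fun w => g w * Cmod (dirichlet N (w * d)) ^ 2) (nodes N)) X).
  assert (A1 : Rabs (INR N ^ 2 * sumR (fun d => g (Cconj d)) X - T) <=
     (eta * INR N ^ 2 + 8 * B / delta ^ 2 * INR N) * k).
  { unfold k, T. rewrite <- sumR_const, <- sumR_scal.
    replace (sumR (fun z => INR N ^ 2 * g (Cconj z)) X -
      sumR (fun d => sumR (fun w => g w * Cmod (dirichlet N (w * d)) ^ 2) (nodes N)) X) with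
      (sumR (fun d => INR N ^ 2 * g (Cconj d) - sumR (fun w => g w * Cmod (dirichlet N (w * d)) ^ 2) (nodes N)) X).
    2: { rewrite (sumR_ext _ (fun d => INR N ^ 2 * g (Cconj d) + -1 *
            sumR (fun w => g w * Cmod (dirichlet N (w * d)) ^ 2) (nodes N))) by (intros; ring).
         rewrite sumR_plus, !sumR_scal. ring. }
    apply Rabs_sumR_le. intros d Hd. apply fejer_interpolation; auto. }
  assert (A2 : Rabs (T - INR N * k * sumR g (nodes N)) <= B * (INR N ^ 2 * W) * INR N).
  { unfold T. rewrite (sumR_exchange (fun d w => g w * Cmod (dirichlet N (w * d)) ^ 2)).
    replace (B * (INR N ^ 2 * W) * INR N) with (sumR (fun _ => B * (INR N ^ 2 * W)) (nodes N))
      by (rewrite sumR_const, length_nodes; ring).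
    replace (sumR (fun w => sumR (fun d => g w * Cmod (dirichlet N (w * d)) ^ 2) X) (nodes N) -
      INR N * k * sumR g (nodes N)) with
      (sumR (fun w => g w * (sumR (fun d => Cmod (dirichlet N (d * w)) ^ 2) X - INR N * k)) (nodes N)).
    2: { rewrite (sumR_ext _ (fun w => sumR (fun d => g w * Cmod (dirichlet N (w * d)) ^ 2) X
           + -1 * (INR N * k * g w))).
         - rewrite sumR_plus, !sumR_scal. ring.
         - intros w Hw. rewrite sumR_scal.
           rewrite (sumR_ext (fun d => Cmod (dirichlet N (d * w)) ^ 2) (fun d => Cmod (dirichlet N (w * d)) ^ 2))
             by (intros; now rewrite Cmult_comm). ring. }
    apply Rabs_sumR_le. intros w Hw. rewrite Rabs_mult.
    apply Rmult_le_compat; auto using Rabs_pos. apply rotated_dirichlet_sum; auto. now apply nodes_unit with N. }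
  apply Rmult_le_reg_l with (INR N ^ 2); auto.
  rewrite <- (Rabs_pos_eq (INR N ^ 2)) at 1 by lra. rewrite <- Rabs_mult.
  replace (INR N ^ 2 * (sumR (fun d => g (Cconj d)) X - k * (sumR g (nodes N) / INR N))) with
    ((INR N ^ 2 * sumR (fun d => g (Cconj d)) X - T) + (T - INR N * k * sumR g (nodes N))) by (field; lra).
  eapply Rle_trans; [apply Rabs_triang|].
  replace (INR N ^ 2 * (k * (eta + 8 * B / delta ^ 2 / INR N) + B * INR N * W)) with
    ((eta * INR N ^ 2 + 8 * B / delta ^ 2 * INR N) * k + B * (INR N ^ 2 * W) * INR N) by (field; lra).
  lra.
Qed.

(** * Weak convergence *)

Lemma circ4_continuity (f : Co -> R) (t : R) : continuous_fun f -> continuity_pt (circ4 f) t.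
Proof.
  intros Hf eps Heps. destruct (Hf (4 * cos t, 4 * sin t) eps Heps) as (d & Hd & H).
  destruct (continuity_cos t (d / 16) ltac:(lra)) as (d1 & Hd1 & H1).
  destruct (continuity_sin t (d / 16) ltac:(lra)) as (d2 & Hd2 & H2).
  exists (Rmin d1 d2). split; [now apply Rmin_pos|]. intros x [Hx1 Hx2].
  specialize (H1 x). specialize (H2 x). simpl in *. unfold Rdist in *.
  assert (M1 := Rmin_l d1 d2). assert (M2 := Rmin_r d1 d2).
  specialize (H1 ltac:(split; [auto|lra])). specialize (H2 ltac:(split; [auto|lra])).
  unfold circ4. apply H.
  change (Cmod (Csub (4 * cos x, 4 * sin x) (4 * cos t, 4 * sin t)) < d).
  eapply Rle_lt_trans; [apply Cmod_le_sum|]. simpl.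
  replace (4 * cos x - 4 * cos t) with (4 * (cos x - cos t)) by ring.
  replace (4 * sin x - 4 * sin t) with (4 * (sin x - sin t)) by ring.
  rewrite !Rabs_mult, (Rabs_pos_eq 4) by lra. lra.
Qed.

Lemma box_uniform_continuity (f : Co -> R) (b eta : R) : continuous_fun f -> 0 < eta ->
  exists delta, 0 < delta /\ forall z w, Cmod z <= b -> Cmod w <= b ->
    Cmod (w - z) < delta -> Rabs (f w - f z) < eta.
Proof.
  intros Hf Heta.
  destruct (uniform_continuity_2d (fun x y => f (x, y)) (- b) b (- b) b) with (eps := mkposreal eta Heta)
    as [delta Hd].
  - intros x y _ _ eps. destruct (Hf (x, y) eps (cond_pos eps)) as (d & Hd & H).
    assert (Hd2 : 0 < d / 2) by lra. exists (mkposreal _ Hd2). simpl. intros u v Hu Hv.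
    apply H. change (Cmod (Csub (u, v) (x, y)) < d).
    eapply Rle_lt_trans; [apply Cmod_le_sum|]. simpl. lra.
  - exists delta. split; [apply cond_pos|]. intros [x y] [u v] Hz Hw Hzw.
    assert (A1 := Rabs_fst_le_Cmod (x, y)). assert (A2 := Rabs_snd_le_Cmod (x, y)).
    assert (A3 := Rabs_fst_le_Cmod (u, v)). assert (A4 := Rabs_snd_le_Cmod (u, v)).
    assert (A5 := Rabs_fst_le_Cmod ((u, v) - (x, y))%C). assert (A6 := Rabs_snd_le_Cmod ((u, v) - (x, y))%C).
    simpl in *.
    assert (C1 : Rabs x <= b) by lra. assert (C2 : Rabs y <= b) by lra.
    assert (C3 : Rabs u <= b) by lra. assert (C4 : Rabs v <= b) by lra.
    apply Rabs_le_between in C1, C2, C3, C4.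
    apply Hd; auto; unfold Rminus; lra.
Qed.

Lemma riemann_sum_circle (h : R -> R) (eta : R) : (forall t, continuity_pt h t) -> 0 < eta ->
  exists N0, forall N, (N0 <= N)%nat -> (0 < N)%nat ->
    Rabs (RInt h 0 (2 * PI) - 2 * PI / INR N * sum_f_R0 (fun i => h (2 * PI * INR i / INR N)) (N - 1))
      <= 2 * PI * eta.
Proof.
  intros Hh Heta. assert (HPI := PI_RGT_0).
  destruct (@Heine_cor2 h 0 (2 * PI) (fun x _ => Hh x) (mkposreal eta Heta)) as [delta Hd].
  destruct (INR_unbounded (2 * PI / delta)) as [N0 HN0]. exists N0. intros N HN HNpos.
  assert (HN' : 0 < INR N) by (apply lt_0_INR; lia).
  assert (Hstep : 2 * PI / INR N < delta).
  { apply le_INR in HN. destruct delta as [delta Hdp]. simpl in *.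
    apply Rmult_lt_reg_r with (INR N); auto. unfold Rdiv. rewrite Rmult_assoc, Rinv_l, Rmult_1_r by lra.
    apply Rlt_le_trans with (delta * INR N0); [|apply Rmult_le_compat_l; lra].
    replace (2 * PI) with (delta * (2 * PI / delta)) by (field; lra). now apply Rmult_lt_compat_l. }
  set (s := 2 * PI / INR N) in *. assert (Hs : 0 < s) by (apply Rdiv_lt_0_compat; lra).
  assert (Hex : forall a b, ex_RInt h a b).
  { intros a b. apply (@ex_RInt_continuous R_CompleteNormedModule). intros z _. apply continuity_pt_filterlim, Hh. }
  assert (Hx : forall i, 2 * PI * INR i / INR N = INR i * s) by (intro; unfold s; field; lra).
  assert (Hone : forall j, (j < N)%nat ->
    Rabs (RInt h (INR j * s) (INR (S j) * s) - s * h (INR j * s)) <= s * eta).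
  { intros j Hj. rewrite S_INR.
    assert (HjN : INR (S j) <= INR N) by (apply le_INR; lia). rewrite S_INR in HjN.
    assert (Hj0 := pos_INR j).
    assert (Hjs : (INR j + 1) * s <= 2 * PI).
    { replace (2 * PI) with (INR N * s) by (unfold s; field; lra). apply Rmult_le_compat_r; lra. }
    replace (s * h (INR j * s)) with (RInt (fun _ => h (INR j * s)) (INR j * s) ((INR j + 1) * s)).
    2: { rewrite RInt_const. change (((INR j + 1) * s - INR j * s) * h (INR j * s) = s * h (INR j * s)). ring. }
    rewrite <- (RInt_minus h (fun _ => h (INR j * s))); auto using ex_RInt_const.
    eapply Rle_trans.
    - apply abs_RInt_le_const with (M := eta); [nra| |].
      + apply (@ex_RInt_minus R_NormedModule); auto using ex_RInt_const.
      + intros t Ht. left. apply Hd; try nra. simpl. rewrite Rabs_pos_eq; nra.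
    - apply Req_le. ring. }
  assert (Hind : forall j, (j < N)%nat ->
    Rabs (RInt h 0 (INR (S j) * s) - s * sum_f_R0 (fun i => h (2 * PI * INR i / INR N)) j)
      <= INR (S j) * (s * eta)).
  { induction j; intros Hj.
    - specialize (Hone O Hj). cbn [sum_f_R0]. rewrite Hx. simpl INR in *. rewrite ?Rmult_0_l in *. lra.
    - specialize (IHj ltac:(lia)). specialize (Hone (S j) Hj).
      rewrite <- (RInt_Chasles h 0 (INR (S j) * s) (INR (S (S j)) * s)) by auto.
      cbn [sum_f_R0]. rewrite (Hx (S j)).
      set (S0 := sum_f_R0 _ j) in *.
      change (Rabs (RInt h 0 (INR (S j) * s) + RInt h (INR (S j) * s) (INR (S (S j)) * s) -
        s * (S0 + h (INR (S j) * s))) <= INR (S (S j)) * (s * eta)).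
      replace (RInt h 0 (INR (S j) * s) + RInt h (INR (S j) * s) (INR (S (S j)) * s) -
        s * (S0 + h (INR (S j) * s))) with ((RInt h 0 (INR (S j) * s) - s * S0) +
        (RInt h (INR (S j) * s) (INR (S (S j)) * s) - s * h (INR (S j) * s))) by ring.
      eapply Rle_trans; [apply Rabs_triang|]. rewrite (S_INR (S j)) in *. lra. }
  specialize (Hind (N - 1)%nat ltac:(lia)). replace (S (N - 1)) with N in Hind by lia.
  replace (INR N * s) with (2 * PI) in Hind by (unfold s; field; lra).
  eapply Rle_trans; [exact Hind|]. apply Req_le. unfold s. field. lra.
Qed.

Lemma sumR_nodes (g : C -> R) (N : nat) : (0 < N)%nat ->
  sumR g (nodes N) = sum_f_R0 (fun i => g (node N i)) (N - 1).
Proof.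
  intros HN. unfold nodes, sumR. rewrite map_map.
  assert (G : forall n, fold_right Rplus 0 (map (fun x => g (node N x)) (List.seq 0 (S n))) =
     sum_f_R0 (fun i => g (node N i)) n).
  { induction n; [simpl; lra|]. rewrite seq_S, map_app, fold_right_app. cbn [map fold_right sum_f_R0].
    rewrite <- IHn. rewrite Rplus_0_r, Nat.add_0_l.
    generalize (g (node N (S n))). generalize (map (fun x => g (node N x)) (List.seq 0 (S n))).
    clear. intros l x. induction l; simpl; lra. }
  rewrite <- G. replace (S (N - 1)) with N by lia. reflexivity.
Qed.

Definition four_times (f : C -> R) (w : C) : R := f (RtoC 4 * w)%C.

Lemma node_average (f : C -> R) (eta : R) : continuous_fun f -> 0 < eta ->
  exists N0, forall N, (N0 <= N)%nat -> (0 < N)%nat ->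
    Rabs (sumR (four_times f) (nodes N) / INR N - RInt (circ4 f) 0 (2 * PI) / (2 * PI)) <= eta.
Proof.
  intros Hf Heta. assert (HPI := PI_RGT_0).
  destruct (riemann_sum_circle (circ4 f) eta (fun t => circ4_continuity f t Hf) Heta) as [N0 HN0].
  exists N0. intros N HN HNpos. specialize (HN0 N HN HNpos). rewrite sumR_nodes by auto.
  assert (HN' : 0 < INR N) by (apply lt_0_INR; lia).
  replace (sum_f_R0 (fun i => four_times f (node N i)) (N - 1)) with
    (sum_f_R0 (fun i => circ4 f (2 * PI * INR i / INR N)) (N - 1)).
  2: { apply sum_eq. intros i _. unfold four_times, circ4, node, cis, Cmult, RtoC. simpl. f_equal. f_equal; ring. }
  set (S0 := sum_f_R0 _ _) in *. set (I := RInt _ _ _) in *.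
  apply Rmult_le_reg_l with (2 * PI); [lra|].
  rewrite <- (Rabs_pos_eq (2 * PI)) at 1 by lra. rewrite <- Rabs_mult, <- Rabs_Ropp.
  replace (- (2 * PI * (S0 / INR N - I / (2 * PI)))) with (I - 2 * PI / INR N * S0) by (field; lra).
  lra.
Qed.

Lemma angular_sums_upto (N : nat) : exists K, 0 < K /\
  forall F rho L Q, factors F rho L Q -> 6 <= rho ->
  (forall i, Cmod (F i) <= 2) -> (forall i, Cmod (linprod (rf rho) L Q i) <= 2) ->
  (forall z, In z L -> 2 <= Cmod z) -> forall m, (0 < m < N)%nat ->
  Cmod (sumC (fun z => dir z ^ m)%C L) <= K * (1 + sumR (fun z => Rabs (Cmod z - 4)) L).
Proof.
  induction N as [|N (K & HK & IH)].
  - exists 1. split; [lra|]. intros; lia.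
  - destruct N as [|N].
    + exists 1. split; [lra|]. intros; lia.
    + destruct (angular_sums (S N) ltac:(lia)) as (K' & HK' & H).
      exists (Rmax K K'). split; [eapply Rlt_le_trans; [exact HK|apply Rmax_l]|].
      intros F rho L Q H1 H2 H3 H4 H5 m Hm.
      assert (P : 0 <= sumR (fun z => Rabs (Cmod z - 4)) L).
      { replace 0 with (sumR (fun _ => 0) L) by (rewrite sumR_const; ring). apply sumR_le.
        intros; apply Rabs_pos. }
      assert (M1 := Rmax_l K K'). assert (M2 := Rmax_r K K').
      destruct (Nat.eq_dec m (S N)) as [->|Hne].
      * eapply Rle_trans; [eapply H; eauto|]. apply Rmult_le_compat_r; lra.
      * eapply Rle_trans; [eapply IH; eauto; lia|]. apply Rmult_le_compat_r; lra.
Qed.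

Lemma Cmod_dir (z : C) : z <> 0 -> Cmod (dir z) = 1.
Proof.
  intros Hz. assert (P := Cmod_pos z Hz).
  assert (Nz : RtoC (Cmod z) <> 0) by (intro X; apply RtoC_inj in X; lra).
  unfold dir. rewrite Cmod_div, Cmod_conj, Cmod_R, Rabs_pos_eq by (auto; lra). field. lra.
Qed.

(** [Cconj (dir z)] is [z/|z|]. For [||z| - 4| < delta] uniform continuity applies; otherwise the
    trivial bound [2 B] is at most [2 B / delta * ||z| - 4|]. One bound serves all zeros, near and
    far. *)
Lemma radial_projection (f : C -> R) (B eta delta : R) (z : C) :
  (forall z, Rabs (f z) <= B) -> 0 <= eta -> 0 < delta <= 1 ->
  (forall z w, Cmod z <= 5 -> Cmod w <= 5 -> Cmod (w - z) < delta -> Rabs (f w - f z) < eta) ->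
  z <> 0 ->
  Rabs (f z - four_times f (Cconj (dir z))) <= eta + 2 * B / delta * Rabs (Cmod z - 4).
Proof.
  intros HB Heta Hdel Hf Hz. assert (P := Cmod_pos z Hz).
  assert (Nz : RtoC (Cmod z) <> 0) by (intro X; apply RtoC_inj in X; lra).
  assert (HB0 : 0 <= B) by (eapply Rle_trans; [apply Rabs_pos|apply (HB 0)]).
  assert (HD := Cmod_dir z Hz).
  assert (E : Cmod (z - RtoC 4 * Cconj (dir z)) = Rabs (Cmod z - 4)).
  { replace z with (RtoC (Cmod z) * Cconj (dir z))%C at 1.
    - replace (RtoC (Cmod z) * Cconj (dir z) - RtoC 4 * Cconj (dir z))%C with
        (RtoC (Cmod z - 4) * Cconj (dir z))%C by (rewrite RtoC_minus; ring).
      rewrite Cmod_mult, Cmod_conj, HD, Cmod_R. ring.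
    - unfold dir. rewrite Cdiv_conj, Cconj_conj by auto.
      replace (Cconj (RtoC (Cmod z))) with (RtoC (Cmod z)).
      + field. auto.
      + unfold Cconj, RtoC. simpl. f_equal. ring. }
  assert (HK : 0 <= 2 * B / delta) by (apply Rmult_le_pos; [lra|apply Rlt_le, Rinv_0_lt_compat; lra]).
  assert (A := Rabs_pos (Cmod z - 4)).
  unfold four_times. destruct (Rlt_le_dec (Rabs (Cmod z - 4)) delta) as [H|H].
  - assert (X : Rabs (f z - f (RtoC 4 * Cconj (dir z))%C) < eta).
    { apply Hf.
      - rewrite Cmod_mult, Cmod_conj, HD, Cmod_R, Rabs_pos_eq; lra.
      - apply Rabs_lt_between in H. lra.
      - now rewrite E. }
    assert (0 <= 2 * B / delta * Rabs (Cmod z - 4)) by now apply Rmult_le_pos. lra.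
  - assert (X : Rabs (f z - f (RtoC 4 * Cconj (dir z))%C) <= 2 * B).
    { unfold Rminus. eapply Rle_trans; [apply Rabs_triang|]. rewrite Rabs_Ropp.
      assert (Y := HB z). assert (Z := HB (RtoC 4 * Cconj (dir z))%C). lra. }
    assert (2 * B / delta * delta <= 2 * B / delta * Rabs (Cmod z - 4)) by (apply Rmult_le_compat_l; auto).
    replace (2 * B / delta * delta) with (2 * B) in H0 by (field; lra). lra.
Qed.

(** Chebyshev's inequality: a zero outside the disc of radius 1000 has [||z| - 4| >= 1], so the
    total deviation pays for its removal. *)
Lemma disc_part (f : C -> R) (B : R) (L : list C) : (forall z, Rabs (f z) <= B) ->
  Rabs (sumR f L - sumR f (filter in_disc L)) <= B * sumR (fun z => Rabs (Cmod z - 4)) L /\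
  0 <= INR (length L) - INR (length (filter in_disc L)) <= sumR (fun z => Rabs (Cmod z - 4)) L.
Proof.
  intros HB.
  assert (HB0 : 0 <= B) by (eapply Rle_trans; [apply Rabs_pos|apply (HB 0)]).
  assert (Hout : forall z, in_disc z = false -> 1 <= Rabs (Cmod z - 4)).
  { intros z. unfold in_disc. destruct (Rlt_dec (Cmod z) 1000) as [H|H]; [discriminate|].
    intros _. rewrite Rabs_pos_eq; lra. }
  replace (INR (length L)) with (sumR (fun _ => 1) L) by (rewrite sumR_const; ring).
  replace (INR (length (filter in_disc L))) with (sumR (fun _ => 1) (filter in_disc L)) by (rewrite sumR_const; ring).
  assert (E : forall h, sumR h L - sumR h (filter in_disc L) = sumR (fun z => if in_disc z then 0 else h z) L).
  { intros h. rewrite sumR_filter.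
    replace (sumR h L - sumR (fun z => if in_disc z then h z else 0) L) with
      (sumR h L + -1 * sumR (fun z => if in_disc z then h z else 0) L) by ring.
    rewrite <- sumR_scal, <- sumR_plus. apply sumR_ext. intros z _. destruct (in_disc z); ring. }
  rewrite !E. split; [|split].
  - rewrite <- sumR_scal. apply Rabs_sumR_le. intros z _. destruct (in_disc z) eqn:Ez.
    + rewrite Rabs_R0. apply Rmult_le_pos; auto. apply Rabs_pos.
    + specialize (HB z). specialize (Hout z Ez). nra.
  - replace 0 with (sumR (fun _ => 0) L) at 1 by (rewrite sumR_const; ring).
    apply sumR_le. intros z _. destruct (in_disc z); lra.
  - apply sumR_le. intros z _. destruct (in_disc z) eqn:Ez; auto. apply Rabs_pos.
Qed.

(** The order of choices matters: [N] and [K] depend on [f] and [eps] only, then [eta0] is fixed in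
    terms of them, and [delta] comes last. *)
Lemma zeros_average (f : C -> R) (eps : R) : bounded_fun f -> continuous_fun f -> 0 < eps ->
  exists delta, 0 < delta /\ forall c, -2 - delta < c < -2 ->
    exists L, zeros_list c L /\ (forall l, zeros_list c l -> Permutation l L) /\
      (0 < length L)%nat /\
      Rabs (sumR f L / INR (length L) - RInt (circ4 f) 0 (2 * PI) / (2 * PI)) < eps.
Proof.
  intros [B0 HB0] Hf Heps.
  set (B := Rmax B0 1). assert (HB1 : 1 <= B) by apply Rmax_r.
  assert (HB : forall z, Rabs (f z) <= B) by (intros z; eapply Rle_trans; [apply HB0|apply Rmax_l]).
  (* The errors will add up to at most [11 * eta * n], so 32 leaves ample room. *)
  set (eta := eps / 32). assert (Heta : 0 < eta) by (unfold eta; lra).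
  destruct (box_uniform_continuity f 5 eta Hf Heta) as (d0 & Hd0 & Hunif).
  set (d := Rmin d0 1). assert (Hd : 0 < d <= 1) by (split; [apply Rmin_pos; lra|apply Rmin_r]).
  assert (Hd0' : d <= d0) by apply Rmin_l.
  assert (Hunif' : forall z w, Cmod z <= 5 -> Cmod w <= 5 -> Cmod (w - z) < d -> Rabs (f w - f z) < eta)
    by (intros; apply Hunif; auto; lra).
  destruct (node_average f eta Hf Heta) as [N0 HN0].
  destruct (INR_unbounded (8 * B / (d / 4) ^ 2 / eta)) as [N1 HN1].
  set (N := (N0 + N1 + 1)%nat). assert (HNpos : (0 < N)%nat) by lia.
  assert (HN' : 0 < INR N) by (apply lt_0_INR; lia).
  specialize (HN0 N ltac:(lia) HNpos).
  set (mean := RInt (circ4 f) 0 (2 * PI) / (2 * PI)) in *.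
  set (avg := sumR (four_times f) (nodes N) / INR N) in *.
  assert (HNe : 8 * B / (d / 4) ^ 2 / INR N <= eta).
  { apply Rmult_le_reg_r with (INR N); auto. unfold Rdiv at 1. rewrite Rmult_assoc, Rinv_l, Rmult_1_r by lra.
    assert (INR N1 <= INR N) by (apply le_INR; lia).
    apply Rle_trans with (eta * (8 * B / (d / 4) ^ 2 / eta)); [apply Req_le; field; lra|].
    apply Rmult_le_compat_l; lra. }
  destruct (angular_sums_upto N) as (K & HK & Hang).
  (* The total factor of [1 + Y]: radial projection, then [B] for the values lost outside the disc
     and [B] for the changed number of points, then the moments. *)
  set (A := 2 * B / d + 2 * B + B * INR N * K).
  assert (HBd : 0 <= 2 * B / d) by (apply Rmult_le_pos; [lra|apply Rlt_le, Rinv_0_lt_compat; lra]).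
  assert (HBN : 0 <= B * INR N * K) by (repeat apply Rmult_le_pos; lra).
  assert (HA : 0 < A) by (unfold A; lra).
  set (eta0 := Rmin (1 / 2) (eta / A)).
  assert (Heta0 : 0 < eta0) by (apply Rmin_pos; [lra|now apply Rdiv_lt_0_compat]).
  assert (Heta1 : eta0 <= 1 / 2) by apply Rmin_l.
  assert (Heta2 : A * eta0 <= eta).
  { apply Rle_trans with (A * (eta / A)); [apply Rmult_le_compat_l; [lra|apply Rmin_r]|]. apply Req_le. field. lra. }
  destruct (zero_statistics eta0 Heta0) as (delta & Hdelta & Hstat).
  exists delta. split; auto. intros c Hc.
  destruct (Hstat c Hc) as (rho & L & Q & HLQ & HQz & Hrho & HL2 & HH & HkY & HY).
  destruct (zeros_list_characterized c rho L Q ltac:(lra) Hrho HLQ HQz) as [Hz1 Hz2].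
  exists (filter in_disc L). split; auto. split; auto.
  set (k := INR (length L)) in *. set (Y := sumR (fun z => Rabs (Cmod z - 4)) L) in *.
  assert (Hk : 0 < k) by nra.
  destruct (disc_part f B L HB) as [D1 D2]. fold k Y in D1, D2.
  set (n := INR (length (filter in_disc L))) in *.
  assert (HY0 : 0 <= Y) by lra.
  assert (Hnk : k / 2 <= n).
  { assert (eta0 * k <= 1 / 2 * k) by (apply Rmult_le_compat_r; lra). lra. }
  assert (Hn : 0 < n) by lra.
  split. { apply INR_lt. exact Hn. }
  assert (HL0 : forall z, In z L -> z <> 0) by (intros z Hz; now apply HLQ).
  assert (HF2 : forall i, Cmod (Dc c i) <= 2).
  { intros i. rewrite Cmod_Dc. assert (X := Dcoef_le_4 c i ltac:(lra)).
    assert (1 <= 4 ^ i) by (apply pow_R1_Rle; lra). assert (Z := Rabs_pos (Dcoef c i)). nra. }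
  assert (Hpow := Hang (Dc c) rho L Q HLQ ltac:(lra) HF2 HH HL2). fold Y in Hpow.
  assert (Heq : Rabs (sumR (fun z => four_times f (Cconj (dir z))) L - k * avg) <=
    k * (eta + 8 * B / (d / 4) ^ 2 / INR N) + B * INR N * (K * (1 + Y))).
  (* [d / 4], since [four_times] multiplies distances by 4. *)
  { assert (X := equidistribution (four_times f) B eta (d / 4) (K * (1 + Y)) N (map dir L)).
    rewrite length_map, sumR_map in X. fold k avg in X. apply X; auto; try lra.
    - intros z. apply HB.
    - apply Rmult_le_pos; lra.
    - intros z w Hz Hw Hzw. unfold four_times. left. apply Hunif'.
      + rewrite Cmod_mult, Hz, Cmod_R, Rabs_pos_eq; lra.
      + rewrite Cmod_mult, Hw, Cmod_R, Rabs_pos_eq; lra.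
      + replace (RtoC 4 * w - RtoC 4 * z)%C with (RtoC 4 * (w - z))%C by ring.
        rewrite Cmod_mult, Cmod_R, Rabs_pos_eq; lra.
    - intros x Hx. apply in_map_iff in Hx. destruct Hx as (z & <- & Hz). apply Cmod_dir. auto.
    - intros m Hm. rewrite sumC_map. auto. }
  assert (Hrad : Rabs (sumR f L - sumR (fun z => four_times f (Cconj (dir z))) L) <= eta * k + 2 * B / d * Y).
  { replace (sumR f L - sumR (fun z => four_times f (Cconj (dir z))) L) with
      (sumR (fun z => f z - four_times f (Cconj (dir z))) L).
    2: { rewrite (sumR_ext _ (fun z => f z + -1 * four_times f (Cconj (dir z)))) by (intros; ring).
         rewrite sumR_plus, sumR_scal. ring. }
    unfold Y, k. rewrite <- sumR_const, <- sumR_scal, <- sumR_plus.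
    apply Rabs_sumR_le. intros z Hz. apply radial_projection; auto; lra. }
  assert (Havg : Rabs avg <= B).
  { unfold avg, Rdiv. rewrite Rabs_mult, (Rabs_pos_eq (/ INR N)) by (apply Rlt_le, Rinv_0_lt_compat; auto).
    apply Rmult_le_reg_r with (INR N); auto. rewrite Rmult_assoc, Rinv_l, Rmult_1_r by lra.
    rewrite <- (length_nodes N) at 2. rewrite <- sumR_const. apply Rabs_sumR_le. intros w _. apply HB. }
  set (SL := sumR f L) in *. set (SN := sumR f (filter in_disc L)) in *.
  set (SD := sumR (fun z => four_times f (Cconj (dir z))) L) in *.
  assert (Hkn : Rabs ((k - n) * avg) <= Y * B).
  { rewrite Rabs_mult, (Rabs_pos_eq (k - n)) by lra. apply Rmult_le_compat; try lra. apply Rabs_pos. }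
  assert (Hnm : Rabs (n * (avg - mean)) <= n * eta).
  { rewrite Rabs_mult, (Rabs_pos_eq n) by lra. apply Rmult_le_compat_l; lra. }
  assert (Hfin : Rabs (SN - n * mean) <= 3 * eta * k + n * eta + A * (1 + Y)).
  { replace (SN - n * mean) with
      (- (SL - SN) + ((SL - SD) + ((SD - k * avg) + ((k - n) * avg + n * (avg - mean))))) by ring.
    eapply Rle_trans; [apply Rabs_triang|]. rewrite Rabs_Ropp.
    assert (T1 := Rabs_triang (SL - SD) ((SD - k * avg) + ((k - n) * avg + n * (avg - mean)))).
    assert (T2 := Rabs_triang (SD - k * avg) ((k - n) * avg + n * (avg - mean))).
    assert (T3 := Rabs_triang ((k - n) * avg) (n * (avg - mean))).
    assert (k * (eta + 8 * B / (d / 4) ^ 2 / INR N) <= k * (2 * eta)) by (apply Rmult_le_compat_l; lra).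
    assert (HA1 : A * (1 + Y) = 2 * B / d + 2 * B + (2 * B / d * Y + 2 * B * Y + B * INR N * (K * (1 + Y))))
      by (unfold A; ring).
    lra. }
  (* Both 1 and [Y] are at most [eta0 * k], and [A * eta0 <= eta]. *)
  assert (HAY : A * (1 + Y) <= 2 * eta * k).
  { apply Rle_trans with (A * (2 * (eta0 * k))); [apply Rmult_le_compat_l; lra|].
    replace (A * (2 * (eta0 * k))) with (2 * (A * eta0) * k) by ring.
    apply Rmult_le_compat_r; lra. }
  change (Rabs (SN / n - mean) < eps).
  replace (SN / n - mean) with ((SN - n * mean) * / n) by (field; lra).
  rewrite Rabs_mult, (Rabs_pos_eq (/ n)) by (apply Rlt_le, Rinv_0_lt_compat; auto).
  apply Rmult_lt_reg_r with n; auto. rewrite Rmult_assoc, Rinv_l, Rmult_1_r by lra.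
  eapply Rle_lt_trans; [exact Hfin|].
  (* [3 eta k + eta n + 2 eta k] with [k <= 2 n]. *)
  apply Rle_lt_trans with (11 * eta * n); [nra|]. unfold eta. nra.
Qed.

(* Weak convergence mu_c -> uniform measure on |lambda| = 4 as c -> -2^-:
   for every bounded continuous test function f : C -> R,
   int f d mu_c -> (1/(2 pi)) int_0^{2 pi} f(4 e^{i t}) dt. *)
Theorem theorem1 :
  forall f : Co -> R, bounded_fun f -> continuous_fun f ->
  exists pr : Riemann_integrable (circ4 f) 0 (2 * PI),
  forall eps, 0 < eps -> exists delta, 0 < delta /\
    forall c, -2 - delta < c < -2 ->
      (exists l, zeros_list c l) /\
      (forall l, zeros_list c l ->
         (0 < length l)%nat /\
         Rabs (avg_over f l - RiemannInt pr / (2 * PI)) < eps).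
Proof.
  intros f Hb Hf. assert (HPI := PI_RGT_0).
  assert (pr : Riemann_integrable (circ4 f) 0 (2 * PI)).
  { apply continuity_implies_RiemannInt; [lra|]. intros t _. now apply circ4_continuity. }
  exists pr. intros eps Heps. destruct (zeros_average f eps Hb Hf Heps) as (delta & Hd & H).
  exists delta. split; auto. intros c Hc. destruct (H c Hc) as (L & H1 & H2 & H3 & H4).
  split; [eauto|]. intros l Hl. assert (P := H2 l Hl).
  rewrite <- (RInt_Reals (circ4 f) 0 (2 * PI) pr).
  change (avg_over f l) with (sumR f l / INR (length l)).
  rewrite (Permutation_length P), (sumR_perm f l L P). auto.
Qed.
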